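(* Let $\eta\in\mathbb{R}^n$ with $\eta_1>\eta_2>\cdots>\eta_n>0$, and consider standard $n$-dimensional Brownian motion started at $\eta$ and terminated when it hits a wall of the chamber $x_1>x_2>\cdots>x_n>0$ of the Weyl group $B_n$ (equivalently, $n$ particles in independent standard one-dimensional Brownian motions started at $\eta_1,\dots,\eta_n$, with the process terminating if two particles collide or a particle touches $0$). Given that no wall has been hit up to time $t$, the distribution of the radius of the position vector at time $t$, divided by $\sqrt t$, converges in measure, as $t\to\infty$, to the distribution at time $1$ of the Bessel process with parameter $n(n+1)$, which is the radial part of an $n(n+1)$-dimensional standard normal. More precisely, the ratio between the radial distribution of the constrained motion at time $t$ (given that no wall has been hit up to time $t$) and the radial distribution at time $t$ of unconstrained Brownian motion in $n^2+n$ dimensions converges uniformly to $1$ at a rate of $O(t^{\epsilon-1/2})$ inside the region $|\lambda|<ct^{1/2+\epsilon}$, and the probability that either distribution is outside that region goes to $0$ exponentially fast.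
   Context: $\lambda$ denotes the position at time $t$ and $|\lambda|$ its Euclidean norm (the radius); $c>0$ and $\epsilon>0$ are constants. The Bessel process with parameter $d$ is the radial part of $d$-dimensional standard Brownian motion (started at the origin). The starting point $\eta$ is fixed as $t\to\infty$.
   Formalization: The ratio's rate O(t^{ε-1/2}) is stated only for 0<ε<1/2, since for ε≥1/2 the ratio does not converge uniformly to 1 on the region; the tail claim is kept for all ε>0, with ''exponentially fast'' meaning at most exp(-a t^{2ε}) for some a>0 and all large t. *)

(* Defs.v *)
From HB Require Import structures.
From mathcomp Require Import all_boot all_order all_algebra.
From mathcomp Require Import all_classical all_reals all_analysis.

Set Implicit Arguments.
Unset Strict Implicit.
Unset Printing Implicit Defensive.

Import Order.TTheory GRing.Theory Num.Theory.
Import numFieldNormedType.Exports.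

Local Open Scope classical_set_scope.
Local Open Scope ring_scope.

(* The library norm `|x| on 'rV[R]_n is the sup norm. *)
Definition enorm (R : realType) (n : nat) (x : 'rV[R]_n) : R :=
  Num.sqrt (\sum_(i < n) x 0 i ^+ 2).

Definition chamberB (R : realType) (n : nat) : set 'rV[R]_n :=
  [set x | (forall i j : 'I_n, (i < j)%N -> x 0 j < x 0 i) /\
           (forall i : 'I_n, 0 < x 0 i)].

(* The sets A i may be the whole line, so this is the product rule for every
   subfamily. *)
Definition mutually_independent d (T : measurableType d) (R : realType)
    (P : probability T R) (I : finType) (X : I -> T -> R) : Prop :=
  forall A : I -> set R, (forall i, measurable (A i)) ->
    fine (P (\bigcap_(i in [set: I]) (X i @^-1` A i))) =
    \prod_(i : I) fine (P (X i @^-1` A i)).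

Definition location d (T : measurableType d) (R : realType)
    (P : probability T R) (n : nat) (B : 'I_n -> R -> {RV P >-> R})
    (t : R) (w : T) : 'rV[R]_n :=
  \row_(i < n) B i t w.

Definition radial_part d (T : measurableType d) (R : realType)
    (P : probability T R) (n : nat) (B : 'I_n -> R -> {RV P >-> R})
    (t : R) (w : T) : R :=
  enorm (location B t w).

(* Standard n-dimensional Brownian motion indexed by time t >= 0 (B i t is
   unconstrained for t < 0).  The increments are required to be independent
   jointly over the coordinates i and the successive time intervals k, which is
   independence of increments together with independence of the coordinates. *)
Definition brownian_motion d (T : measurableType d) (R : realType)
    (P : probability T R) (n : nat) (eta : 'rV[R]_n)
    (B : 'I_n -> R -> {RV P >-> R}) : Prop :=
  [/\ forall w, location B 0 w = eta,
      forall i w, {within `[0, +oo[, continuous (fun t => B i t w)},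
      forall i s t, 0 <= s -> s < t -> forall A : set R, measurable A ->
        P ((fun w => B i t w - B i s w) @^-1` A) =
        normal_prob 0 (Num.sqrt (t - s)) A
    & forall (m : nat) (s : nat -> R), 0 <= s 0%N ->
        (forall k, (k < m)%N -> s k < s k.+1) ->
        mutually_independent P (fun (ik : 'I_n * 'I_m) w =>
          B ik.1 (s ik.2.+1) w - B ik.1 (s ik.2) w) ].

(* The event that no wall of the chamber has been hit up to time t; it is
   measurable since the paths are continuous and the chamber is open. *)
Definition no_wall_hit d (T : measurableType d) (R : realType)
    (P : probability T R) (n : nat) (B : 'I_n -> R -> {RV P >-> R})
    (t : R) : set T :=
  [set w | forall s, 0 <= s <= t -> chamberB (location B s w)].

(* cond_prob P S E is the probability of E given S. *)
Definition cond_prob d (T : measurableType d) (R : realType)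
    (P : probability T R) (S E : set T) : \bar R :=
  (fine (P (E `&` S)) / fine (P S))%:E.

Definition is_density (R : realType) (nu : set R -> \bar R) (f : R -> R)
    : Prop :=
  [/\ measurable_fun setT f, forall r, 0 <= f r
    & forall A : set R, measurable A ->
        nu A = (\int[lebesgue_measure]_(r in A) (f r)%:E)%E ].

(* Main.v *)
Require Import Defs.
From HB Require Import structures.
From mathcomp Require Import all_boot all_order all_algebra fingroup perm.
From mathcomp Require Import all_classical all_reals all_analysis.
From mathcomp Require Import measurable_realfun ring lra zify.

Set Implicit Arguments.
Unset Strict Implicit.
Unset Printing Implicit Defensive.

Import Order.TTheory GRing.Theory Num.Theory.
Import numFieldNormedType.Exports.

Local Open Scope classical_set_scope.
Local Open Scope ring_scope.

(** Let V(x) = det(x_j^(2i+1)) be the alternating polynomial of B_n, homogeneous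
of degree n^2.  Reflecting the path at the first wall it hits shows that an
antisymmetric function of B_t averages to zero over the paths that have hit a
wall, so that P(|B_t| in A, no wall hit) = E[1_A(|B_t|) sgn(V(eta) V(B_t))].
Writing the law of B_t as an exponential tilt of a standard Gaussian vector Z
and averaging over the Weyl group turns this into

  exp(-|eta|^2/2t) / n! * E[1_A(sqrt t |Z|) sgn(V(eta) V(Z)) det(sinh(eta_i Z_j / sqrt t))].

The determinant is a constant multiple of V(Z / sqrt t) up to a relative error
O(max_j |Z_j| / sqrt t), that is, O(t^(epsilon-1/2)) inside the region.  Since V
is homogeneous of degree n^2, weighting the law of |Z| by |V(Z)| gives, up to a
constant, the radial law in dimension n + n^2.  Outside the region both laws have
Gaussian tails, which remain negligible after conditioning because the survival
probability decays only polynomially. *)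

(** * Densities, product laws and changes of measure *)

(** Stopping a path at its first wall would call for the strong Markov property. The reflection is
    therefore performed on finite time grids, where it only permutes and negates independent
    increments with a common centred normal law. A grid path does not stop exactly on a wall, so the
    test function has to be Lipschitz, and a wall counts as hit once its linear form drops to
    [delta]. The mesh tends to 0 before [delta] does, and the indicator times the sign is reached
    last, through Lipschitz approximations. On a surviving path V(eta) V(B_t) > 0, which is why the
    survival event can be exchanged for the sign. The Gaussian vectors are built from the given
    motions at time 1. Inside the region the estimate concerns masses of arbitrary measurable sets
    [A], with an error relative to the free mass of [A]; this is strong enough to compare arbitrary
    versions of the densities almost everywhere. The survival probability, by which one divides,
    comes out of the same estimate applied to the whole region, together with the two tails. *)

Section density_measure.
Context d (T : measurableType d) (R : realType).
Variables (mu : {measure set T -> \bar R}) (w : T -> R).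

(** The proofs of nonnegativity and measurability are arguments so that the term itself can carry a
    canonical measure structure. *)
Definition density_measure of (forall x, 0 <= w x) & measurable_fun setT w :=
  fun A : set T => (\int[mu]_(x in A) (w x)%:E)%E.

Hypotheses (w0 : forall x, 0 <= w x) (mw : measurable_fun setT w).

Let nu := density_measure w0 mw.

Let nu0 : nu set0 = 0%E. Proof. by rewrite /nu /density_measure integral_set0. Qed.

Let nu_ge0 A : (0 <= nu A)%E.
Proof. by apply: integral_ge0 => x _; rewrite lee_fin. Qed.

Let nu_sigma_additive : semi_sigma_additive nu.
Proof.
move=> A mA tA mUA; rewrite /nu /density_measure ge0_integral_bigcup//; last 2 first.
- exact/measurable_EFinP/measurable_funTS.
- by move=> x _; rewrite lee_fin.
apply: is_cvg_ereal_nneg_natsum_cond => n _ _; apply: integral_ge0 => x _.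
by rewrite lee_fin.
Qed.

HB.instance Definition _ :=
  isMeasure.Build _ _ _ nu nu0 nu_ge0 nu_sigma_additive.

Import HBNNSimple.
Local Open Scope ereal_scope.

(** Monotone convergence along the simple approximations [h n] of [f], on both sides; for a simple
    function the identity is the definition of the measure on each level set. *)
Lemma ge0_integral_density_measure (f : T -> \bar R) :
  (forall x, 0 <= f x) -> measurable_fun setT f ->
  \int[density_measure w0 mw]_x f x = \int[mu]_x (f x * (w x)%:E).
Proof.
move=> f0 mf; rewrite -/nu.
pose h := nnsfun_approx measurableT mf.
have mh n : measurable_fun setT (EFin \o h n).
  by apply/measurable_EFinP; exact/measurable_funP.
have nd x a b : (a <= b)%N -> (EFin \o h a) x <= (EFin \o h b) x.
  by move=> ab; rewrite lee_fin; exact/lefP/nd_nnsfun_approx.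
have fE x : f x = lim ((EFin \o h n) x @[n --> \oo]).
  by apply/esym/cvg_lim => //; exact: cvg_nnsfun_approx.
have mw' : measurable_fun setT (EFin \o w) by exact/measurable_EFinP.
have -> : \int[nu]_x f x = lim (\int[nu]_x (EFin \o h n) x @[n --> \oo]).
  under eq_integral => x _ do rewrite fE.
  apply: monotone_convergence => //.
  - by move=> n x _ /=; rewrite lee_fin.
  - by move=> x _ a b ab; exact: nd.
have -> : \int[mu]_x (f x * (w x)%:E) =
    lim (\int[mu]_x ((EFin \o h n) x * (w x)%:E) @[n --> \oo]).
  have fg x : f x * (w x)%:E = lim ((EFin \o h n) x * (w x)%:E @[n --> \oo]).
    by apply/esym/cvg_lim => //; apply: cvgeZr => //; exact: cvg_nnsfun_approx.
  under eq_integral => x _ do rewrite fg.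
  apply: monotone_convergence => //.
  - by move=> n; exact: emeasurable_funM.
  - by move=> n x _ /=; rewrite mule_ge0 ?lee_fin.
  - by move=> x _ a b ab /=; rewrite lee_wpmul2r ?lee_fin// -lee_fin; exact: nd.
apply: congr_lim; apply/funext => n.
transitivity (\int[nu]_x (\sum_(y \in range (h n)) (y * \1_(h n @^-1` [set y]) x)%:E)).
  by apply: eq_integral => t _; rewrite /= fimfunE -fsumEFin.
rewrite ge0_integral_fsum//; last 2 first.
- by move=> y; apply/measurable_EFinP; exact: measurable_funM.
- by move=> m y _; exact: nnfun_muleindic_ge0.
transitivity (\int[mu]_x (\sum_(y \in range (h n))
    (y * \1_(h n @^-1` [set y]) x)%:E * (w x)%:E)); last first.
  apply: eq_integral => x _ /=; rewrite -ge0_mule_fsuml => [|y]; last exact: nnfun_muleindic_ge0.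
  by rewrite fsumEFin // -(fimfunE _ x).
rewrite ge0_integral_fsum//; last 2 first.
- move=> y; apply: emeasurable_funM => //; apply/measurable_EFinP; exact: measurable_funM.
- by move=> m y _; rewrite mule_ge0 ?lee_fin// -lee_fin nnfun_muleindic_ge0.
apply: eq_fsbigr => r rhn.
have r0 : (0 <= r)%R by move: rhn; rewrite inE => -[t _ <-].
under eq_integral do rewrite EFinM.
rewrite integralZl_indic_nnsfun // integral_indic//= setIT.
under [RHS]eq_integral do rewrite EFinM -muleA.
rewrite ge0_integralZl//.
- congr (_ * _); rewrite /nu /density_measure integral_mkcond; apply: eq_integral => x _.
  by rewrite patchE indicE; case: ifP => xA; rewrite ?mul1e ?mul0e.
- by apply: emeasurable_funM => //; exact/measurable_EFinP.
- by move=> t _; rewrite mule_ge0 ?lee_fin.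
Qed.

End density_measure.

Definition pushm d d' (T1 : measurableType d) (T2 : measurableType d')
    (R : realType) (m : {measure set T1 -> \bar R}) (f : T1 -> T2)
    (mf : measurable_fun setT f) : {measure set T2 -> \bar R} :=
  @measure_function_pushforward__canonical__measure_function_Measure
    _ _ _ _ _ m f mf.

Lemma ge0_integral_pushm d d' (T1 : measurableType d) (T2 : measurableType d')
    (R : realType) (m : {measure set T1 -> \bar R}) (f : T1 -> T2)
    (mf : measurable_fun setT f) (g : T2 -> \bar R) :
  measurable_fun setT g -> (forall y, (0 <= g y)%E) ->
  (\int[pushm m mf]_y g y = \int[m]_x g (f x))%E.
Proof. by move=> mg g0; rewrite ge0_integral_pushforward. Qed.

Section joint.
Context (R : realType) (I : finType).

(** Tuples carry the product sigma-algebra, so families indexed by [I] are transported to tuples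
    along the enumeration of [I]. *)
Definition tuple_fun (v : #|I|.-tuple R) : I -> R := fun i => tnth v (enum_rank i).

Definition joint d (T : measurableType d) (X : I -> T -> R) (w : T) : #|I|.-tuple R :=
  [tuple X (enum_val j) w | j < #|I|].

Lemma jointK d (T : measurableType d) (X : I -> T -> R) w :
  tuple_fun (joint X w) = X^~ w.
Proof. by apply/funext => i; rewrite /tuple_fun tnth_mktuple enum_rankK. Qed.

Lemma measurable_joint d (T : measurableType d) (X : I -> T -> R) :
  (forall i, measurable_fun setT (X i)) -> measurable_fun setT (joint X).
Proof.
move=> mX; apply/measurable_fun_tnthP => j.
by rewrite (_ : _ \o _ = X (enum_val j))//; apply/funext => w /=; rewrite tnth_mktuple.
Qed.

(* Measurability of a function on [R^I], transported from the product sigma-algebra of tuples. *)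
Definition pt_measurable d (U : measurableType d) (F : (I -> R) -> U) :=
  measurable_fun setT (F \o tuple_fun).

Lemma pt_measurable_coord i : pt_measurable (fun x : I -> R => x i : R).
Proof. exact: measurable_tnth. Qed.

Lemma pt_measurable_comp d (U : measurableType d) (F : (I -> R) -> U)
    d' (T : measurableType d') (X : I -> T -> R) :
  pt_measurable F -> (forall i, measurable_fun setT (X i)) ->
  measurable_fun setT (fun w => F (X^~ w)).
Proof.
move=> mF mX; have := measurableT_comp mF (measurable_joint mX).
by congr (measurable_fun _ _); apply/funext => w /=; rewrite jointK.
Qed.

End joint.

Section indep_prod.
Context d (T : measurableType d) (R : realType) (P : probability T R).
Variables (I : finType) (X : I -> T -> R).
Hypotheses (mX : forall i, measurable_fun setT (X i)).
Hypothesis iX : mutually_independent P X.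
Variables (f : I -> R -> R) (e : I -> R).
Hypotheses (f0 : forall i x, 0 <= f i x) (mf : forall i, measurable_fun setT (f i)).
Hypothesis fe : forall i, (\int[P]_w (f i (X i w))%:E = (e i)%:E)%E.

Let mXA i A : measurable A -> measurable (X i @^-1` A).
Proof. by move=> mA; rewrite -[_ @^-1` _]setTI; exact: mX. Qed.

Let e0 i : 0 <= e i.
Proof. by rewrite -lee_fin -fe; apply: integral_ge0 => x _; rewrite lee_fin. Qed.

Let mixed (s : seq I) (A : I -> set R) i (x : R) : R := if i \in s then f i x else \1_(A i) x.
Let mixede (s : seq I) (A : I -> set R) i : R := if i \in s then e i else fine (P (X i @^-1` A i)).

(** The coordinates in [s] carry the functions [f i], the others indicators, and one coordinate [a]
    is switched at a time. With the other factors fixed, both sides are measures in the set [A a];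
    they agree on every measurable set by the induction hypothesis, hence give [f a] the same
    integral. *)
Let indep_mixed s A : uniq s -> (forall i, measurable (A i)) ->
  (\int[P]_w (\prod_i mixed s A i (X i w))%:E = (\prod_i mixede s A i)%:E)%E.
Proof.
elim: s A => [|a s IHs] A /=.
  move=> _ mA.
  have mcap : measurable (\bigcap_(i in [set: I]) X i @^-1` A i).
    by apply: fin_bigcap_measurable => // i _; exact: mXA.
  transitivity (\int[P]_w (\1_(\bigcap_(i in [set: I]) X i @^-1` A i) w)%:E)%E.
    apply: eq_integral => w _; congr EFin; rewrite indicE.
    case: (boolP (w \in _)) => [|/negP wA].
      rewrite inE => wA; apply: big1 => i _; rewrite /mixed/= indicE mem_set//.
      exact: wA.
    have [i iA] : exists i, ~ A i (X i w).
      by apply/existsNP => H; apply: wA; rewrite inE => i _; exact: H.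
    by rewrite (bigD1 i)//= /mixed/= indicE memNset// mul0r.
  rewrite integral_indic// setIT /mixede/=.
  by rewrite -iX// fineK// fin_num_measure.
move=> /andP[aNs us] mA.
pose W w := \prod_(i | i != a) mixed s A i (X i w).
pose c := \prod_(i | i != a) mixede s A i.
have mix0 i x : 0 <= mixed s A i x by rewrite /mixed; case: ifP.
have W0 w : 0 <= W w by exact: prodr_ge0.
have c0 : 0 <= c by apply: prodr_ge0 => i _; rewrite /mixede; case: ifP => // _; exact/fine_ge0/measure_ge0.
have mmix i : measurable_fun setT (fun w => mixed s A i (X i w)).
  rewrite /mixed; case: (i \in s); first exact: measurableT_comp.
  apply: measurableT_comp => //; exact: measurable_indic.
have mW : measurable_fun setT W.
  rewrite (_ : W = fun w => \prod_(i <- [seq i <- index_enum I | i != a]) mixed s A i (X i w)).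
    exact: measurable_prod.
  by apply/funext => w; rewrite big_filter.
pose m1 := pushm (density_measure P W0 mW) (mX a).
pose m2 := mscale (NngNum c0) (pushm P (mX a)).
have m12 D : measurable D -> m1 D = m2 D.
  move=> mD; rewrite /m1 /m2 /mscale /= /pushforward/= /density_measure.
  pose A' i := if i == a then D else A i.
  have mA' i : measurable (A' i) by rewrite /A'; case: ifP.
  have := IHs A' us mA'.
  rewrite (bigD1 a)//= [mixede _ _ a]/mixede (negbTE aNs) /A' eqxx.
  rewrite (eq_bigr (mixede s A)) -/c; last by move=> i /negbTE ia; rewrite /mixede ia.
  rewrite EFinM fineK ?fin_num_measure//; last exact: mXA.
  rewrite muleC => <-; rewrite integral_mkcond; apply: eq_integral => w _.
  rewrite (bigD1 a)//= {1}/mixed (negbTE aNs) eqxx.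
  rewrite (eq_bigr (fun i => mixed s A i (X i w))) -/(W w); last first.
    by move=> i /negbTE ia; rewrite /mixed ia.
  rewrite patchE indicE; have [wD|wD] := boolP (w \in X a @^-1` D).
    by rewrite mem_set ?mul1r//; rewrite inE in wD.
  by rewrite memNset ?mul0r//; move: wD; rewrite notin_setE.
have mfa : measurable_fun setT (EFin \o f a) by exact/measurable_EFinP.
transitivity (\int[P]_w ((f a (X a w))%:E * (W w)%:E))%E.
  apply: eq_integral => w _; rewrite (bigD1 a)//= -EFinM {1}/mixed in_cons eqxx/=.
  congr (_ * _)%:E; apply: eq_bigr => i /negbTE ia.
  by rewrite /mixed in_cons ia.
rewrite -(ge0_integral_density_measure P W0 mW)//; last 2 first.
- by move=> x; rewrite lee_fin.
- exact/measurable_EFinP/measurableT_comp.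
transitivity (\int[m1]_x (f a x)%:E)%E.
  by rewrite ge0_integral_pushm// => x; rewrite lee_fin.
transitivity (\int[m2]_x (f a x)%:E)%E.
  by apply: eq_measure_integral => D mD _; rewrite m12.
rewrite ge0_integral_mscale//; last by move=> x _; rewrite lee_fin.
rewrite ge0_integral_pushm//; last by move=> x; rewrite lee_fin.
rewrite /= fe -EFinM mulrC (bigD1 a)//= {1}/mixede in_cons eqxx/=.
congr (_ * _)%:E; apply: eq_bigr => i /negbTE ia.
by rewrite /mixede in_cons ia.
Qed.

Lemma indep_prod : (\int[P]_w (\prod_i f i (X i w))%:E = (\prod_i e i)%:E)%E.
Proof.
have := @indep_mixed (enum I) (fun=> setT) (enum_uniq I) (fun=> measurableT).
under eq_integral do under eq_bigr do rewrite /mixed mem_enum /=.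
by under eq_bigr do rewrite /mixede mem_enum /=.
Qed.

End indep_prod.

Section rectangles.
Context (R : realType) (I : finType).

Definition rectangles : set (set (#|I|.-tuple R)) :=
  [set S | exists2 A : I -> set R, (forall i, measurable (A i)) &
     S = [set v | forall i, A i (tuple_fun v i)]].

Lemma rectangles_measurable : rectangles `<=` measurable.
Proof.
move=> _ [A mA ->].
rewrite (_ : mkset _ = \bigcap_(i in [set: I]) ((fun v => tuple_fun v i) @^-1` A i)).
  apply: fin_bigcap_measurable => // i _; rewrite -[_ @^-1` _]setTI.
  exact: measurable_tnth.
by apply/seteqP; split=> v /= H; [move=> i _; exact: H | move=> i; exact: H].
Qed.

Lemma measurable_rectangles : (measurable : set (set (#|I|.-tuple R))) = <<s rectangles >>.
Proof.
apply/seteqP; split; last first.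
  apply: smallest_sub; last exact: rectangles_measurable.
  exact: sigma_algebra_measurable.
apply: sub_sigma_algebra2 => S /=.
rewrite -bigcup_seq => -[j /= _] -[A mA <-].
exists (fun i => if i == enum_val j then A else setT).
  by move=> i; case: ifP.
rewrite setTI; apply/seteqP; split=> v /=.
  move=> vA i; case: eqVneq => // ->.
  by rewrite /tuple_fun enum_valK.
by move=> /(_ (enum_val j)); rewrite eqxx /tuple_fun enum_valK.
Qed.

Lemma rectangles_setI : setI_closed rectangles.
Proof.
move=> _ _ [A mA ->] [B mB ->]; exists (fun i => A i `&` B i).
  by move=> i; exact: measurableI.
apply/seteqP; split=> v /=; first by move=> [HA HB] i; split; [exact: HA|exact: HB].
by move=> H; split=> i; have [] := H i.
Qed.

End rectangles.

Section tilt.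
Context (R : realType) (I : finType).
Context d (T : measurableType d) (P : probability T R) (X : I -> T -> R).
Context d' (T' : measurableType d') (Q : probability T' R) (Y : I -> T' -> R).
Variable rho : I -> R -> R.
Hypotheses (mX : forall i, measurable_fun setT (X i)).
Hypotheses (mY : forall i, measurable_fun setT (Y i)).
Hypotheses (iX : mutually_independent P X) (iY : mutually_independent Q Y).
Hypotheses (rho0 : forall i x, 0 <= rho i x).
Hypotheses (mrho : forall i, measurable_fun setT (rho i)).
Hypothesis XY : forall i (A : set R), measurable A ->
  Q (Y i @^-1` A) = (\int[P]_(w in X i @^-1` A) (rho i (X i w))%:E)%E.

Let mYA i A : measurable A -> measurable (Y i @^-1` A).
Proof. by move=> mA; rewrite -[_ @^-1` _]setTI; exact: mY. Qed.

(** Both sides integrate [F] against measures on tuples. By independence and [indep_prod] these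
    agree on rectangles, a generating pi-system, hence everywhere. *)
Lemma tilt (F : (I -> R) -> \bar R) :
  (forall x, (0 <= F x)%E) -> pt_measurable F ->
  (\int[Q]_w F (Y^~ w) = \int[P]_w (F (X^~ w) * (\prod_i rho i (X i w))%:E))%E.
Proof.
move=> F0 mF.
pose W w := \prod_i rho i (X i w).
have W0 w : 0 <= W w by exact: prodr_ge0.
have mW : measurable_fun setT W.
  by apply: measurable_prod => i _; exact: measurableT_comp.
pose m1 := pushm Q (measurable_joint mY).
pose m2 := pushm (density_measure P W0 mW) (measurable_joint mX).
have m12 S : measurable S -> m1 S = m2 S.
  apply: (@measure_unique _ _ _ (@rectangles R I) (fun=> setT)).
  - exact: measurable_rectangles.
  - exact: rectangles_setI.
  - by move=> _; exists (fun=> setT) => //; apply/seteqP; split.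
  - by rewrite bigcup_const.
  - move=> _ [A mA ->]; rewrite /m1 /m2 /= /pushforward /density_measure.
    rewrite (_ : joint Y @^-1` _ = \bigcap_(i in [set: I]) Y i @^-1` A i); last first.
      apply/seteqP; split=> w /=; first by move=> H i _; have := H i; rewrite jointK.
      by move=> H i; rewrite jointK; exact: H.
    rewrite -[LHS]fineK; last first.
      by apply: fin_num_measure; apply: fin_bigcap_measurable => // i _; exact: mYA.
    rewrite iY// -(@indep_prod _ _ _ P _ X mX iX (fun i x => \1_(A i) x * rho i x)); last first.
    + move=> i; rewrite fineK ?fin_num_measure//; last exact: mYA.
      rewrite XY// [RHS]integral_mkcond; apply: eq_integral => w _.
      rewrite patchE indicE; have [wA|wA] := boolP (w \in X i @^-1` A i).
        by rewrite mem_set ?mul1r//; rewrite inE in wA.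
      by rewrite memNset ?mul0r//; move: wA; rewrite notin_setE.
    + by move=> i; apply: measurable_funM => //; exact: measurable_indic.
    + by move=> i x; rewrite mulr_ge0.
    rewrite [RHS]integral_mkcond; apply: eq_integral => w _; rewrite patchE.
    case: (boolP (w \in _)) => [|/negP wA].
      rewrite inE/= => wA; congr EFin; apply: eq_bigr => i _.
      by have := wA i; rewrite jointK indicE => /mem_set ->; rewrite mul1r.
    have [i iA] : exists i, ~ A i (X i w).
      by apply/existsNP => H; apply: wA; rewrite inE => i /=; rewrite jointK; exact: H.
    by rewrite (bigD1 i)//= indicE memNset// !mul0r.
  - by move=> _; rewrite /m1 /= /pushforward preimage_setT probability_setT ltry.
transitivity (\int[m1]_v F (tuple_fun v))%E.
  by rewrite ge0_integral_pushm//; apply: eq_integral => w _; rewrite jointK.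
transitivity (\int[m2]_v F (tuple_fun v))%E.
  by apply: eq_measure_integral => S mS _; rewrite m12.
rewrite ge0_integral_pushm// ge0_integral_density_measure//; last first.
  exact: measurableT_comp mF (measurable_joint mX).
by apply: eq_integral => w _; rewrite jointK.
Qed.

End tilt.

(** The tilt with density 1, applied separately to the positive and negative parts, so that the
    identity holds for signed [F] without any integrability. *)
Lemma eq_law_integral (R : realType) (I : finType)
    d (T : measurableType d) (P : probability T R) (X : I -> T -> R)
    d' (T' : measurableType d') (Q : probability T' R) (Y : I -> T' -> R) :
  (forall i, measurable_fun setT (X i)) -> (forall i, measurable_fun setT (Y i)) ->
  mutually_independent P X -> mutually_independent Q Y ->
  (forall i (A : set R), measurable A -> Q (Y i @^-1` A) = P (X i @^-1` A)) ->
  forall F : (I -> R) -> \bar R, pt_measurable F ->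
  (\int[Q]_w F (Y^~ w) = \int[P]_w F (X^~ w))%E.
Proof.
move=> mX mY iX iY XY.
have ge0_case F : (forall x, (0 <= F x)%E) -> pt_measurable F ->
    (\int[Q]_w F (Y^~ w) = \int[P]_w F (X^~ w))%E.
  move=> F0 mF; rewrite (@tilt _ _ _ _ P X _ _ Q Y (fun _ => cst 1))//.
    by apply: eq_integral => w _; rewrite big1// mule1.
  move=> i A mA; rewrite XY// (integral_cst _ _ 1) ?mul1e//.
  by rewrite -[_ @^-1` _]setTI; exact: mX.
move=> F mF; rewrite integralE [RHS]integralE.
congr (_ - _)%E.
  under eq_integral do rewrite funeposE.
  under [RHS]eq_integral do rewrite funeposE.
  apply: (ge0_case (fun x => maxe (F x) 0%E)) => [x|]; first by rewrite le_max lexx orbT.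
  exact: measurable_maxe.
under eq_integral do rewrite funenegE.
under [RHS]eq_integral do rewrite funenegE.
apply: (ge0_case (fun x => maxe (- F x)%E 0%E)) => [x|]; first by rewrite le_max lexx orbT.
by apply: measurable_maxe => //; exact: measurableT_comp.
Qed.

(** Serves twice: for the reflected increments of a path and for the Weyl group acting on a Gaussian
    vector. *)
Lemma indep_signed_perm (R : realType) (I : finType)
    d (T : measurableType d) (P : probability T R) (X : I -> T -> R)
    (s : {perm I}) (e : I -> bool) :
  mutually_independent P X ->
  mutually_independent P (fun i w => (-1) ^+ e i * X (s i) w).
Proof.
move=> iX A mA.
pose A' i := [set x : R | A (s^-1 i)%g ((-1) ^+ e (s^-1 i)%g * x)].
have mA' i : measurable (A' i).
  rewrite /A' -[mkset _]setTI.
  exact: (@measurable_funM _ _ _ setT (cst ((-1) ^+ e (s^-1 i)%g)) id).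
rewrite (_ : \bigcap_(i in _) _ = \bigcap_(i in [set: I]) X i @^-1` A' i); last first.
  apply/seteqP; split=> w /= H i _ /=.
    by have := H (s^-1 i)%g Logic.I; rewrite /= permKV.
  by have := H (s i) Logic.I; rewrite /A'/= permK.
rewrite iX// (reindex_inj (@perm_inj _ s))/=; apply: eq_bigr => i _.
by rewrite /A' permK.
Qed.

Lemma lebesgue_measure_affine (R : realType) (b c : R) (A : set R) : 0 < b ->
  measurable A ->
  (lebesgue_measure ((fun x => (b * x + c)%R) @^-1` A) = (b^-1)%R%:E * lebesgue_measure A)%E.
Proof.
move=> b0 mA.
have mf : measurable_fun setT (fun x : R => b * x + c).
  by apply: measurable_funD => //; exact: measurable_funM.
pose m : {measure set (measurableTypeR R) -> \bar R} :=
  mscale (NngNum (ltW b0)) (@pushm _ _ (measurableTypeR R) (measurableTypeR R) R lebesgue_measure _ mf).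
suff -> : lebesgue_measure A = m A.
  by rewrite /m /mscale/= muleA -EFinM mulVf ?gt_eqF// mul1e.
suff H X : ocitv X -> lebesgue_measure X = m X by exact: (lebesgue_measure_unique H).
move=> [[x y] _ <-].
transitivity (b%:E * lebesgue_measure ((fun x => (b * x + c)%R) @^-1` `]x, y]))%E => //.
rewrite (_ : _ @^-1` _ = `](x - c) / b, (y - c) / b]%classic); last first.
  apply/seteqP; split=> z /=; rewrite !in_itv/= ltr_pdivrMr// ler_pdivlMr//.
    by rewrite ltrBlDr lerBrDr mulrC.
  by rewrite ltrBlDr lerBrDr mulrC.
rewrite !lebesgue_measure_itv/= !lte_fin ltr_pM2r ?invr_gt0// ltrD2r.
case: ifPn => _; last by rewrite mule0.
by rewrite -!EFinB -EFinM -mulrBl mulrCA divff ?gt_eqF// mulr1 opprB addrA subrK.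
Qed.

Lemma ge0_integral_affine (R : realType) (b c : R) (f : R -> \bar R) : 0 < b ->
  (forall x, (0 <= f x)%E) -> measurable_fun setT f ->
  (\int[lebesgue_measure]_x f (b * x + c)%R = (b^-1)%R%:E * \int[lebesgue_measure]_x f x)%E.
Proof.
move=> b0 f0 mf.
have mh : measurable_fun setT (fun x : R => b * x + c).
  by apply: measurable_funD => //; exact: measurable_funM.
have b0' : 0 <= b^-1 by rewrite invr_ge0 ltW.
transitivity (\int[@pushm _ _ (measurableTypeR R) (measurableTypeR R) R lebesgue_measure _ mh]_x f x)%E.
  by rewrite ge0_integral_pushm.
transitivity (\int[mscale (NngNum b0') (@lebesgue_measure R)]_x f x)%E; last first.
  by rewrite ge0_integral_mscale.
apply: eq_measure_integral => A mA _.
exact: lebesgue_measure_affine.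
Qed.

(** * Gaussian vectors and their radial laws *)

Lemma normal_peakM (R : realType) (b s : R) : 0 < b ->
  normal_peak (b * s) = b^-1 * normal_peak s.
Proof.
move=> b0; rewrite /normal_peak -invfM; congr (_^-1).
rewrite (_ : (b * s) ^+ 2 * pi *+ 2 = b ^+ 2 * (s ^+ 2 * pi *+ 2)).
  by rewrite sqrtrM ?sqr_ge0// sqrtr_sqr gtr0_norm.
by rewrite exprMn -mulrA mulrnAr.
Qed.

Lemma normal_prob_affine (R : realType) (b c m s : R) (A : set R) :
  0 < b -> 0 < s -> measurable A ->
  normal_prob m s ((fun x => b * x + c) @^-1` A) = normal_prob (b * m + c) (b * s) A.
Proof.
move=> b0 s0 mA; rewrite /normal_prob integral_mkcond [RHS]integral_mkcond.
have pdfE x : normal_pdf m s x = b * normal_pdf (b * m + c) (b * s) (b * x + c).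
  rewrite !normal_pdfE ?gt_eqF ?mulr_gt0// mulrA; congr (_ * _).
    by rewrite normal_peakM// mulVKf// gt_eqF.
  rewrite /normal_fun; congr expR.

  by field; rewrite !gt_eqF.
pose g := ((fun x => (normal_pdf (b * m + c) (b * s) x)%:E) \_ A)%E.
have g0 x : (0 <= g x)%E.
  by rewrite /g patchE; case: ifP => // _; rewrite lee_fin normal_pdf_ge0.
have mg : measurable_fun setT g.
  apply/(measurable_restrictT _ _).1 => //.
  by apply/measurable_funTS/measurable_EFinP; exact: measurable_normal_pdf.
transitivity (b%:E * \int[lebesgue_measure]_x g (b * x + c)%R)%E.
  rewrite -ge0_integralZl//; last 2 first.
  - apply: (@measurableT_comp _ _ _ _ _ _ g) => //.
    by apply: measurable_funD => //; exact: measurable_funM.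
  - by rewrite lee_fin ltW.
  apply: eq_integral => x _; rewrite /g !patchE.
  have -> : (x \in (fun x0 : R => b * x0 + c) @^-1` A) = (b * x + c \in A).
    by apply/idP/idP; rewrite !inE.
  by case: ifP => _; rewrite ?mule0// -EFinM -pdfE.
by rewrite ge0_integral_affine// muleA -EFinM divff ?mul1e ?gt_eqF.
Qed.

Lemma normal_probN (R : realType) (s : R) (A : set R) : s != 0 -> measurable A ->
  normal_prob 0 s (-%R @^-1` A) = normal_prob 0 s A.
Proof.
move=> s0 mA; rewrite /normal_prob integral_mkcond [RHS]integral_mkcond.
pose g := ((fun x => (normal_pdf 0 s x)%:E) \_ A)%E.
have g0 x : (0 <= g x)%E.
  by rewrite /g patchE; case: ifP => // _; rewrite lee_fin normal_pdf_ge0.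
have mg : measurable_fun setT g.
  apply/(measurable_restrictT _ _).1 => //.
  by apply/measurable_funTS/measurable_EFinP; exact: measurable_normal_pdf.
have mN : measurable_fun setT (-%R : measurableTypeR R -> measurableTypeR R).
  exact: oppr_measurable.
transitivity (\int[pushm lebesgue_measure mN]_x g x)%E; last first.
  apply: eq_measure_integral => D mD _; exact: lebesgue_measureN.
rewrite (ge0_integral_pushm _ mN mg g0); apply: eq_integral => x _; rewrite /g !patchE.
have -> : (x \in -%R @^-1` A) = (- x \in A) by apply/idP/idP; rewrite !inE.
case: ifP => // _; congr EFin; rewrite !normal_pdfE//; congr (_ * _).
by rewrite /normal_fun !subr0 sqrrN.
Qed.

Definition has_normal_law d (T : measurableType d) (R : realType)
    (P : probability T R) (X : T -> R) (m s : R) :=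
  forall A : set R, measurable A -> P (X @^-1` A) = normal_prob m s A.

Lemma ge0_integral_normal_law d (T : measurableType d) (R : realType)
    (P : probability T R) (X : T -> R) (m s : R) (f : R -> \bar R) :
  measurable_fun setT X -> has_normal_law P X m s ->
  (forall x, 0 <= f x)%E -> measurable_fun setT f ->
  (\int[P]_w f (X w) = \int[lebesgue_measure]_x (f x * (normal_pdf m s x)%:E))%E.
Proof.
move=> mX lX f0 mf.
have pdf0 := @normal_pdf_ge0 R m s.
have mpdf : measurable_fun setT (normal_pdf m s) by exact: measurable_normal_pdf.
rewrite -(@ge0_integral_density_measure _ (measurableTypeR R) _ lebesgue_measure _ pdf0 mpdf)//.
transitivity (\int[@pushm _ _ _ (measurableTypeR R) _ P _ mX]_x f x)%E.
  by rewrite ge0_integral_pushm.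
by apply: eq_measure_integral => A mA _; exact: lX.
Qed.

Definition normal_ratio (R : realType) (m s x : R) :=
  normal_pdf m s x / normal_pdf 0 1 x.

Lemma normal_pdf01_gt0 (R : realType) (m s x : R) : s != 0 -> 0 < normal_pdf m s x.
Proof.
by move=> s0; rewrite normal_pdfE// mulr_gt0// ?normal_peak_gt0// expR_gt0.
Qed.

Lemma normal_ratio_ge0 (R : realType) (m s x : R) : 0 <= normal_ratio m s x.
Proof. by rewrite divr_ge0// normal_pdf_ge0. Qed.

Lemma normal_ratio_mean (R : realType) (m x : R) :
  normal_ratio m 1 x = expR (m * x - m ^+ 2 / 2).
Proof.
rewrite /normal_ratio !normal_pdfE ?oner_eq0// invfM mulrACA.
rewrite divff ?gt_eqF ?normal_peak_gt0 ?oner_eq0// mul1r /normal_fun -expRN -expRD.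
by congr expR; rewrite expr1n subr0; field.
Qed.

Lemma normal_ratio_sd (R : realType) (s x : R) : 0 < s ->
  normal_ratio 0 s x = s^-1 * expR (x ^+ 2 / 2 - (x / s) ^+ 2 / 2).
Proof.
move=> s0; rewrite /normal_ratio !normal_pdfE ?oner_eq0 ?gt_eqF// invfM mulrACA.
congr (_ * _).
  by rewrite -{1}[s]mulr1 normal_peakM// mulfK// gt_eqF// normal_peak_gt0// oner_eq0.
rewrite /normal_fun -expRN -expRD; congr expR; rewrite expr1n !subr0.
by field; rewrite gt_eqF.
Qed.

Lemma measurable_normal_ratio (R : realType) (m s : R) : s != 0 ->
  measurable_fun setT (normal_ratio m s).
Proof.
move=> s0.
  rewrite (_ : normal_ratio m s = fun x => normal_pdf m s x *
    ((normal_peak 1)^-1 * expR (x ^+ 2 / 2))).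
    apply: measurable_funM; first exact: measurable_normal_pdf.
    apply: measurable_funM => //; apply: measurableT_comp => //.
    by apply: measurable_funM => //; exact: measurable_funX.
  apply/funext => x; rewrite /normal_ratio [normal_pdf 0 1]normal_pdfE ?oner_eq0// invfM.
  by rewrite -expRN expr1n subr0 mulNr opprK.
Qed.

(** Two cases are used below: a shift of the mean with [s = 1] (the Cameron-Martin formula) and a
    dilation with [m = 0]. *)
Lemma gauss_tilt (R : realType) (I : finType)
    d (T : measurableType d) (P : probability T R) (X : I -> T -> R)
    d' (T' : measurableType d') (Q : probability T' R) (Y : I -> T' -> R)
    (m : I -> R) (s : R) (F : (I -> R) -> \bar R) :
  0 < s ->
  (forall i, measurable_fun setT (X i)) -> (forall i, measurable_fun setT (Y i)) ->
  mutually_independent P X -> mutually_independent Q Y ->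
  (forall i, has_normal_law P (X i) 0 1) -> (forall i, has_normal_law Q (Y i) (m i) s) ->
  (forall x, (0 <= F x)%E) -> pt_measurable F ->
  (\int[Q]_w F (Y^~ w) =
   \int[P]_w (F (X^~ w) * (\prod_i normal_ratio (m i) s (X i w))%:E))%E.
Proof.
move=> s0 mX mY iX iY lX lY F0 mF.
apply: (@tilt _ _ _ _ P X _ _ Q Y (fun i => normal_ratio (m i) s)) => //.
- by move=> i x; exact: normal_ratio_ge0.
- by move=> i; apply: measurable_normal_ratio; rewrite gt_eqF.
move=> i A mA; rewrite lY// integral_mkcond.
pose g := ((fun x => (normal_ratio (m i) s x)%:E) \_ A)%E.
transitivity (\int[P]_w g (X i w))%E; last first.
  apply: eq_integral => w _; rewrite /g !patchE.
  by have -> : (w \in X i @^-1` A) = (X i w \in A) by apply/idP/idP; rewrite !inE.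
rewrite (ge0_integral_normal_law (mX i) (lX i)); last 2 first.
- by move=> x; rewrite /g patchE; case: ifP => // _; rewrite lee_fin normal_ratio_ge0.
- apply/(measurable_restrictT _ _).1 => //.
  by apply/measurable_funTS/measurable_EFinP; apply: measurable_normal_ratio; exact: lt0r_neq0.
rewrite /normal_prob integral_mkcond; apply: eq_integral => x _.
rewrite /g !patchE; case: ifP => _; rewrite ?mul0e// -EFinM /normal_ratio divfK//.
by rewrite gt_eqF// normal_pdf01_gt0// oner_eq0.
Qed.

Definition pnorm (R : realType) (I : finType) (x : I -> R) : R :=
  Num.sqrt (\sum_i x i ^+ 2).

Lemma pnorm_ge0 (R : realType) (I : finType) (x : I -> R) : 0 <= pnorm x.
Proof. exact: sqrtr_ge0. Qed.

Lemma sqr_pnorm (R : realType) (I : finType) (x : I -> R) :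
  pnorm x ^+ 2 = \sum_i x i ^+ 2.
Proof. by rewrite sqr_sqrtr// sumr_ge0// => i _; rewrite sqr_ge0. Qed.

Lemma coord_le_pnorm (R : realType) (I : finType) (x : I -> R) i : `|x i| <= pnorm x.
Proof.
rewrite -(@ler_pXn2r _ 2)// ?nnegrE ?pnorm_ge0// real_normK ?num_real//.
by rewrite sqr_pnorm (bigD1 i)//= lerDl sumr_ge0// => j _; exact: sqr_ge0.
Qed.

Lemma pnormZ (R : realType) (I : finType) (r : R) (x : I -> R) :
  pnorm (fun i => r * x i) = `|r| * pnorm x.
Proof.
rewrite /pnorm; under eq_bigr do rewrite exprMn.
by rewrite -mulr_sumr sqrtrM ?sqr_ge0// sqrtr_sqr.
Qed.

Lemma pt_measurable_pnorm (R : realType) (I : finType) :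
  pt_measurable (fun x : I -> R => pnorm x : R).
Proof.
apply: (@measurableT_comp _ _ _ _ _ _ (Num.sqrt : R -> R)).
  by apply: continuous_measurable_fun; exact: sqrt_continuous.
apply: measurable_sum => i; apply: measurable_funX.
exact: pt_measurable_coord.
Qed.

Definition std_gaussian (R : realType) (I : finType) d (T : measurableType d)
    (P : probability T R) (Z : I -> T -> R) :=
  [/\ forall i, measurable_fun setT (Z i), mutually_independent P Z &
      forall i, has_normal_law P (Z i) 0 1].

Lemma std_gaussian_scale (R : realType) (I : finType) d (T : measurableType d)
    (P : probability T R) (Z : I -> T -> R) (r : R) (F : (I -> R) -> \bar R) :
  0 < r -> std_gaussian P Z -> (forall x, (0 <= F x)%E) -> pt_measurable F ->
  (\int[P]_w F (fun i => r * Z i w)%R =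
   \int[P]_w (F (Z^~ w) *
     (r^-1 ^+ #|I| * expR (pnorm (Z^~ w) ^+ 2 / 2 - (pnorm (Z^~ w) / r) ^+ 2 / 2))%:E))%E.
Proof.
move=> r0 [mZ iZ lZ] F0 mF.
pose Y i w := r * Z i w.
have mY i : measurable_fun setT (Y i) by exact: measurable_funM.
have preY i (A : set R) : Y i @^-1` A = Z i @^-1` ((fun x => r * x + 0) @^-1` A).
  by apply/seteqP; split=> w /=; rewrite addr0.
have mr (A : set R) : measurable A -> measurable ((fun x => r * x + 0) @^-1` A).
  move=> mA; rewrite -[_ @^-1` _]setTI.
  by apply: measurable_funD => //; exact: measurable_funM.
have iY : mutually_independent P Y.
  move=> A mA.
  transitivity (fine (P (\bigcap_(i in [set: I]) Z i @^-1` ((fun x => r * x + 0) @^-1` A i)))).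
    by congr (fine (P _)); apply: eq_bigcapr => i _.
  by rewrite iZ; [apply: eq_bigr => i _; rewrite preY|move=> i; exact: mr].
have lY i : has_normal_law P (Y i) 0 r.
  move=> A mA; rewrite preY lZ; last exact: mr.
  rewrite (normal_prob_affine 0 0 r0 ltr01 mA).
  by rewrite mulr0 mulr1 addr0.
rewrite (@gauss_tilt _ _ _ _ P Z _ _ P Y (fun=> 0) r F)//.
apply: eq_integral => w _; congr (_ * _%:E)%E.
under eq_bigr do rewrite normal_ratio_sd//.
rewrite big_split/= prodr_const; congr (_ * _).
rewrite -expR_sum; congr expR.
rewrite exprMn sqr_pnorm sumrB -mulr_suml; congr (_ - _).
by rewrite -mulr_suml; congr (_ / 2); rewrite mulr_suml; apply: eq_bigr => i _; rewrite exprMn.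
Qed.

(** Normalised so that []0, r[] has mass r^N, which leaves out the area of the sphere. *)
Definition radial_weight (R : realType) (N : nat) (s : R) : R :=
  \1_(`]0, +oo[) s * (N%:R * s ^+ N.-1).

Lemma radial_weight_ge0 (R : realType) N (s : R) : 0 <= radial_weight N s.
Proof.
rewrite /radial_weight indicE; case: (boolP (s \in _)) => [|_]; last by rewrite mul0r.
by rewrite inE/= in_itv/= andbT mul1r => s0; rewrite mulr_ge0// exprn_ge0 ?ltW.
Qed.

Lemma measurable_radial_weight (R : realType) N :
  measurable_fun setT (@radial_weight R N).
Proof.
by apply: measurable_funM => //; exact: measurable_funM.
Qed.

Lemma integral_radial_weight (R : realType) N (r : R) : (0 < N)%N ->
  (\int[lebesgue_measure]_(s in `]-oo, r[) (radial_weight N s)%:E =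
   (Num.max 0 r ^+ N)%:E)%E.
Proof.
move=> N0; have [r0|r0] := leP r 0.
  rewrite integral_mkcond (eq_integral (cst 0%E)) ?integral0 ?expr0n ?gtn_eqF// => s _.
  rewrite patchE; case: ifPn => //; rewrite inE/= in_itv/= => sr.
  rewrite /radial_weight indicE memNset ?mul0r//= in_itv/= andbT; apply/negP; rewrite -leNgt.
  by rewrite ltW// (lt_le_trans sr).
pose q (s : R) := N%:R * s ^+ N.-1.
have mq : measurable_fun setT q by exact: measurable_funM.
transitivity (\int[lebesgue_measure]_(s in `[0%R, r]) (q s)%:E)%E.
  rewrite -integral_itv_bndo_bndc; last first.
    exact/measurable_EFinP/measurable_funTS.
  rewrite -integral_itv_obnd_cbnd; last first.
    exact/measurable_EFinP/measurable_funTS.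
  rewrite integral_mkcond [RHS]integral_mkcond; apply: eq_integral => s _.
  rewrite !patchE !mem_setE !in_itv/=.
  case: (ltP s r) => sr; last by rewrite andbF.
  rewrite andbT /radial_weight indicE mem_setE in_itv/= andbT.
  by case: ifP; rewrite ?mul1r ?mul0r.
rewrite (@continuous_FTC2 _ _ (fun s : R => s ^+ N) 0 r)//.
- by rewrite expr0n gtn_eqF// sube0.
- apply: continuous_subspaceT => x; apply: cvgM; first exact: cvg_cst.
  exact: exprn_continuous.
- split.
  + by move=> x _; exact: exprn_derivable.
  + by apply: cvg_at_right_filter; exact: exprn_continuous.
  + by apply: cvg_at_left_filter; exact: exprn_continuous.
- by move=> x _; rewrite exp_derive1.
Qed.

Lemma measure_unique_ray (R : realType)
    (m1 m2 : {measure set (measurableTypeR R) -> \bar R}) :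
  (forall r, m1 `]-oo, r[%classic = m2 `]-oo, r[%classic) ->
  (forall r, (m1 `]-oo, r[%classic < +oo)%E) ->
  forall A, measurable A -> m1 A = m2 A.
Proof.
move=> m12 m1oo A mA.
pose G : set (set (measurableTypeR R)) := @RGenInftyO.G R.
pose g (n : nat) : set (measurableTypeR R) := `]-oo, n%:R[%classic.
have mG : measurable = <<s G >> by exact: RGenInftyO.measurableE.
have GI : setI_closed G.
  move=> _ _ [x ->] [y ->]; exists (Num.min x y).
  by apply/seteqP; split=> z /=; rewrite !in_itv/= lt_min => /andP.
have Gg n : G (g n) by exists n%:R.
have gT : \bigcup_n g n = setT.
  apply/seteqP; split=> // x _; exists (Num.truncn `|x|).+1 => //=.
  by rewrite /g/= in_itv/= (le_lt_trans (ler_norm x))// truncnS_gt.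
apply: (measure_unique G g mG GI Gg gT) => //; last by move=> n; exact: m1oo.
by move=> _ [r ->]; exact: m12.
Qed.

(* Comparing [Z] with [r Z] shows that [r |-> E[h(Z) e^(|Z|^2/2); |Z| < r]] is
   homogeneous of degree [#|I| + k], which determines the radial law without
   polar coordinates. *)
Section polar.
Context (R : realType) (I : finType) d (T : measurableType d).
Variables (P : probability T R) (Z : I -> T -> R) (h : (I -> R) -> R) (k : nat).
Hypothesis stdZ : std_gaussian P Z.
Hypotheses (h0 : forall x, 0 <= h x) (mh : pt_measurable h).
Hypothesis hZ : forall r x, 0 < r -> h (fun i => r * x i) = r ^+ k * h x.
Variable b : R.
Hypothesis hb : forall x, pnorm x < 1 -> h x <= b.
Hypothesis dim_gt0 : (0 < #|I| + k)%N.

Let W w := h (Z^~ w) * expR (pnorm (Z^~ w) ^+ 2 / 2).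
Let W0 w : 0 <= W w. Proof. by rewrite mulr_ge0// expR_ge0. Qed.
Let mZ i : measurable_fun setT (Z i). Proof. by case: stdZ. Qed.
Let mnZ : measurable_fun setT (fun w => pnorm (Z^~ w)).
Proof. exact: (pt_measurable_comp (@pt_measurable_pnorm R I) mZ). Qed.
Let mW : measurable_fun setT W.
Proof.
apply: measurable_funM; first exact: (pt_measurable_comp mh mZ).
apply: measurableT_comp => //; apply: measurable_funM => //.
exact: measurable_funX.
Qed.

Let mball r : measurable ((fun w => pnorm (Z^~ w)) @^-1` `]-oo, r[).
Proof. by rewrite -[_ @^-1` _]setTI; exact: mnZ. Qed.

Let mass r := (\int[P]_(w in (fun w => pnorm (Z^~ w)) @^-1` `]-oo, r[) (W w)%:E)%E.

Let massE r : 0 < r -> mass r = ((r ^+ (#|I| + k))%:E * mass 1%R)%E.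
Proof.
move=> r0.
(* The exponential in [F] is chosen so that at [r Z] it becomes exp(|Z|^2/2), giving r^k times the
   mass of the unit ball, while at [Z] it cancels the r-dependent half of the Gaussian tilt, giving
   r^(-#|I|) times the mass of the ball of radius r. *)
pose F (x : I -> R) : \bar R :=
  (\1_(`]-oo, r[) (pnorm x) * (h x * expR ((pnorm x / r) ^+ 2 / 2)))%:E.
have mF : pt_measurable F.
  apply/measurable_EFinP; apply: measurable_funM.
    by apply: measurableT_comp => //; exact: pt_measurable_pnorm.
  apply: measurable_funM => //; apply: measurableT_comp => //.
  apply: measurable_funM => //; apply: measurable_funX; apply: measurable_funM => //.
  exact: pt_measurable_pnorm.
have F0 x : (0 <= F x)%E by rewrite lee_fin !mulr_ge0// expR_ge0.
have memE s (w : T) : (w \in (fun w => pnorm (Z^~ w)) @^-1` `]-oo, s[) = (pnorm (Z^~ w) < s).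
  by apply/idP/idP; rewrite !inE/= in_itv.
have := std_gaussian_scale r0 stdZ F0 mF.
have -> : (\int[P]_w F (fun i => r * Z i w)%R = (r ^+ k)%:E * mass 1%R)%E.
  rewrite /mass [in RHS]integral_mkcond -ge0_integralZl//; last 3 first.
  - by apply/(measurable_restrictT _ _).1; [exact: mball|exact/measurable_funTS/measurable_EFinP].
  - by move=> w _; rewrite patchE; case: ifP => // _; rewrite lee_fin.
  - by rewrite lee_fin exprn_ge0// ltW.
  apply: eq_integral => w _; rewrite /F patchE memE pnormZ gtr0_norm//.
  rewrite indicE mem_setE in_itv/= -ltr_pdivlMl// mulVf ?gt_eqF//.
  case: ifP => _; last by rewrite mul0r mule0.
  by rewrite mul1r hZ// -mulrA -EFinM (mulrC r (pnorm _)) mulfK// gt_eqF.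
have -> : (\int[P]_w (F (Z^~ w) *
     (r^-1 ^+ #|I| * expR (pnorm (Z^~ w) ^+ 2 / 2 - (pnorm (Z^~ w) / r) ^+ 2 / 2))%:E)
   = (r^-1 ^+ #|I|)%:E * mass r)%E.
  rewrite /mass [in RHS]integral_mkcond -ge0_integralZl//; last 3 first.
  - by apply/(measurable_restrictT _ _).1; [exact: mball|exact/measurable_funTS/measurable_EFinP].
  - by move=> w _; rewrite patchE; case: ifP => // _; rewrite lee_fin.
  - by rewrite lee_fin exprn_ge0// invr_ge0 ltW.
  apply: eq_integral => w _; rewrite /F patchE memE indicE mem_setE in_itv/=.
  case: ifP => _; last by rewrite mul0r mul0e mule0.
  rewrite mul1r -!EFinM; congr EFin; rewrite expRB /W.
  by rewrite [LHS]mulrACA mulrCA [X in X = _]mulrC mulrA; field; rewrite gt_eqF ?expR_gt0.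
rewrite exprVn => H.
rewrite exprD EFinM -muleA H muleA -EFinM divff ?mul1e//.
by rewrite gt_eqF// exprn_gt0.
Qed.

(** The bound [hb] on the unit ball enters here; by homogeneity all balls then have finite mass, as
    the uniqueness of measures on rays demands. *)
Let mass1_fin : (mass 1%R < +oo)%E.
Proof.
have mA := mball 1.
apply: (@le_lt_trans _ _ (\int[P]_(w in (fun w => pnorm (Z^~ w)) @^-1` `]-oo, 1%R[)
    (cst (b * expR 2^-1)%:E w))%E); last first.
  by rewrite integral_cst// ltey_eq fin_numM// fin_num_measure.
apply: ge0_le_integral => //.
- by move=> w _; rewrite lee_fin.
- exact/measurable_funTS/measurable_EFinP.
- move=> w /=; rewrite in_itv/= => Z1; rewrite lee_fin /W.
  apply: ler_pM => //; first exact: hb.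
  rewrite ler_expR ler_piMl ?invr_ge0// exprn_ile1 ?pnorm_ge0//.
  exact: ltW.
Qed.

Lemma polar : exists2 m : R, 0 <= m & forall F : R -> \bar R,
  (forall s, 0 <= F s)%E -> measurable_fun setT F ->
  (\int[P]_w (F (pnorm (Z^~ w)) * (h (Z^~ w))%:E) =
   \int[lebesgue_measure]_s (F s * (expR (- (s ^+ 2 / 2)) * (m * radial_weight (#|I| + k) s))%:E))%E.
Proof.
have mass0 : (0 <= mass 1%R)%E by apply: integral_ge0 => w _; rewrite lee_fin.
exists (fine (mass 1%R)); first exact: fine_ge0.
set m := fine _ => F F0 mF.
have mE : mass 1%R = m%:E by rewrite fineK// ge0_fin_numE.
have m0 : 0 <= m by exact: fine_ge0.
pose w' s := m * radial_weight (#|I| + k) s : R.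
have w'0 s : 0 <= w' s by rewrite mulr_ge0// radial_weight_ge0.
have mw' : measurable_fun setT w'.
  by apply: measurable_funM => //; exact: measurable_radial_weight.
pose mu := @pushm _ _ _ (measurableTypeR R) _ (density_measure P W0 mW) _ mnZ.
pose nu : {measure set (measurableTypeR R) -> \bar R} :=
  density_measure (@lebesgue_measure R) w'0 mw'.
have massNE r : r <= 0 -> mass r = 0%E.
  move=> r0; rewrite /mass (_ : _ @^-1` _ = set0) ?integral_set0//.
  apply/seteqP; split=> // w /=; rewrite in_itv/= => H.
  by have := lt_le_trans H r0; rewrite ltNge pnorm_ge0.
have munu A : measurable A -> mu A = nu A.
  apply: measure_unique_ray => [r|r]; last first.
    change (mass r < +oo)%E.
    have [r0|r0] := leP r 0; first by rewrite massNE.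
    by rewrite massE// mE ltry.
  transitivity (mass r) => //.
  transitivity (m%:E * \int[lebesgue_measure]_(s in `]-oo, r[) (radial_weight (#|I| + k) s)%:E)%E.
    rewrite integral_radial_weight//; have [r0|r0] := leP r 0.
      by rewrite massNE// expr0n gtn_eqF// mule0.
    by rewrite massE// mE muleC.
  rewrite -ge0_integralZl//; last by move=> s _; rewrite lee_fin radial_weight_ge0.
  by apply/measurable_EFinP; apply: measurable_funTS; exact: measurable_radial_weight.
(* The factor exp(-s^2/2) undoes the weight exp(|Z|^2/2) that was built into [W] to obtain
   homogeneity. *)
pose G s := (F s * (expR (- (s ^+ 2 / 2)))%:E)%E.
have G0 s : (0 <= G s)%E by rewrite mule_ge0// lee_fin expR_ge0.
have mG : measurable_fun setT G.
  apply: emeasurable_funM => //; apply/measurable_EFinP; apply: measurableT_comp => //.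
  apply: measurableT_comp => //; apply: measurable_funM => //; exact: measurable_funX.
transitivity (\int[mu]_s G s)%E.
  rewrite ge0_integral_pushm// ge0_integral_density_measure//; last first.
    exact: measurableT_comp mG mnZ.
  apply: eq_integral => w _; rewrite /G /W -muleA -EFinM; congr (_ * _%:E)%E.
  by rewrite mulrCA -expRD addNr expR0 mulr1.
transitivity (\int[nu]_s G s)%E.
  by apply: eq_measure_integral => A mA _; exact: munu.
rewrite ge0_integral_density_measure//; apply: eq_integral => s _.
by rewrite /G -muleA -EFinM.
Qed.

End polar.

(** * The sinh determinant *)

Section newton.
Context (R : realType).
Implicit Types (u : nat -> R) (x y : R).

Definition psum (K : nat) u x := \sum_(k < K) u k * x ^+ k.

(* If [u] vanishes from [K] on, these are the coefficients of [(psum K u x - psum K u y) / (x - y)]. *)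
Definition divdiff (K : nat) y u (k : nat) := psum K (fun m => u (k.+1 + m)%N) y.

Lemma divdiff_rec K y u k : (forall m, (K <= m)%N -> u m = 0) ->
  divdiff K y u k = u k.+1 + y * divdiff K y u k.+1.
Proof.
move=> uK; rewrite /divdiff /psum; case: K uK => [|K] uK.
  by rewrite !big_ord0 uK// mulr0 addr0.
rewrite big_ord_recl /= addn0 expr0 mulr1; congr (_ + _).
rewrite big_ord_recr/= uK ?mul0r ?addr0; last by lia.
rewrite mulr_sumr; apply: eq_bigr => i _.
by rewrite /bump/= add1n addnS addSn exprS mulrCA.
Qed.

Lemma psum_rec K y u : (forall m, (K <= m)%N -> u m = 0) ->
  psum K u y = u 0%N + y * divdiff K y u 0.
Proof.
move=> uK; rewrite /divdiff /psum; case: K uK => [|K] uK.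
  by rewrite !big_ord0 uK// mulr0 addr0.
rewrite big_ord_recl /= expr0 mulr1; congr (_ + _).
rewrite big_ord_recr/= uK ?mul0r ?addr0; last by lia.
rewrite mulr_sumr; apply: eq_bigr => i _.
by rewrite /bump/= add1n exprS mulrCA.
Qed.

Lemma divdiff_supp K y u : (forall m, (K <= m)%N -> u m = 0) ->
  forall m, (K <= m)%N -> divdiff K y u m = 0.
Proof.
move=> uK m Km; apply: big1 => i _; rewrite uK ?mul0r//; lia.
Qed.

Lemma psumB K x y u : (forall m, (K <= m)%N -> u m = 0) ->
  psum K u x = psum K u y + (x - y) * psum K (divdiff K y u) x.
Proof.
move=> uK.
(* A version for partial sums with an explicit boundary term, which vanishes at [n = K]. *)
have H n : psum K u y + (x - y) * psum n (divdiff K y u) x =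
    psum n u x + (u n + y * divdiff K y u n) * x ^+ n.
  elim: n => [|n IHn].
    by rewrite /psum !big_ord0 mulr0 addr0 add0r expr0 mulr1; exact: psum_rec.
  rewrite {2 3}/psum !big_ord_recr/= -!/(psum _ _ _) mulrDr addrA IHn.
  by rewrite -divdiff_rec// exprS; ring.
by rewrite H uK// divdiff_supp// mulr0 addr0 mul0r addr0.
Qed.

(** Geometric series of ratio 1/2. The bound does not depend on [K], so the truncation can be
    removed at the end. *)
Lemma psum_bound K u x M : (forall k, `|u k| <= M) -> `|x| <= 2^-1 ->
  `|psum K u x| <= 2 * M.
Proof.
move=> uM x2; have M0 : 0 <= M by exact: le_trans (uM 0%N).
suff : `|psum K u x| <= 2 * M * (1 - 2^-1 ^+ K).
  move=> /le_trans; apply; rewrite ler_piMr ?mulr_ge0// gerBl exprn_ge0.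
rewrite /psum; elim: K => [|K IHK].
  by rewrite big_ord0 normr0 expr0 subrr mulr0.
rewrite big_ord_recr/= (le_trans (ler_normD _ _))//.
apply: (le_trans (lerD IHK (_ : _ <= M * 2^-1 ^+ K))).
  by rewrite normrM normrX; apply: ler_pM; rewrite ?exprn_ge0 ?lerXn2r ?nnegrE ?invr_ge0.
by rewrite exprS; lra.
Qed.

Lemma divdiff_bound K y u M : (forall k, `|u k| <= M) -> `|y| <= 2^-1 ->
  forall k, `|divdiff K y u k| <= 2 * M.
Proof. by move=> uM y2 k; exact: psum_bound. Qed.

Fixpoint divdiffs (K : nat) (z : nat -> R) u (j : nat) : nat -> R :=
  if j is j'.+1 then divdiff K (z j') (divdiffs K z u j') else u.

Lemma divdiffs_supp K z u j : (forall m, (K <= m)%N -> u m = 0) ->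
  forall m, (K <= m)%N -> divdiffs K z u j m = 0.
Proof. by move=> uK; elim: j => //= j IHj; exact: divdiff_supp. Qed.

(** Newton's interpolation formula with remainder. At any of the nodes [z 0, ..., z (m-1)] the
    remainder vanishes, so that the factorisation of the determinant below is exact. *)
Lemma newton K z u m x : (forall m, (K <= m)%N -> u m = 0) ->
  psum K u x =
  \sum_(k < m) psum K (divdiffs K z u k) (z k) * \prod_(l < k) (x - z l) +
  psum K (divdiffs K z u m) x * \prod_(l < m) (x - z l).
Proof.
move=> uK; elim: m => [|m IHm]; first by rewrite !big_ord0 add0r mulr1.
rewrite IHm !big_ord_recr/= -addrA; congr (_ + _).
rewrite (psumB x (z m) (divdiffs_supp z m uK)) mulrDl; congr (_ + _).
by ring.
Qed.

Lemma divdiffs_bound K z u M j : (forall k, `|u k| <= M) ->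
  (forall l, `|z l| <= 2^-1) -> forall k, `|divdiffs K z u j k| <= 2 ^+ j * M.
Proof.
move=> uM z2; elim: j => [|j IHj] k /=; first by rewrite expr0 mul1r.
by rewrite exprS -mulrA; exact: divdiff_bound.
Qed.

(** With all nodes at 0, taking a divided difference just shifts the coefficients; each of the [j]
    steps adds an error proportional to the size of its node. *)
Lemma divdiffs_near K z u M e j : (forall m, (K <= m)%N -> u m = 0) ->
  (forall k, `|u k| <= M) -> e <= 2^-1 -> (forall l, `|z l| <= e) ->
  forall k, `|divdiffs K z u j k - u (k + j)%N| <= j%:R * 2 ^+ j * M * e.
Proof.
move=> uK uM e2 ze.
have M0 : 0 <= M by exact: le_trans (uM 0%N).
have e0 : 0 <= e by exact: le_trans (ze 0%N).
have z2 l : `|z l| <= 2^-1 by exact: le_trans e2.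
elim: j => [|j IHj] k /=; first by rewrite addn0 subrr normr0 !mul0r.
rewrite divdiff_rec; last exact: divdiffs_supp.
rewrite addrAC (le_trans (ler_normD _ _))//.
have := divdiff_bound K (@divdiffs_bound K z u M j uM z2) (z2 j) k.+1.
have := IHj k.+1; rewrite addnS addSn => H1 H2.
apply: (le_trans (lerD H1 (_ : _ <= e * (2 * (2 ^+ j * M))))).
  by rewrite normrM; exact: ler_pM.
rewrite exprS -natr1; have : 0 <= 2 ^+ j * M * e by rewrite !mulr_ge0 ?exprn_ge0.
have : 0 <= j%:R * (2 ^+ j * M * e) by rewrite !mulr_ge0 ?exprn_ge0.
nra.
Qed.

(** The factor [j.+2] adds the [j] of [divdiffs_near] to the 2 of the geometric series bounding the
    terms beyond the constant one. *)
Lemma newton_coef_near K z u M e j : (forall m, (K <= m)%N -> u m = 0) ->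
  (forall k, `|u k| <= M) -> e <= 2^-1 -> (forall l, `|z l| <= e) ->
  `|psum K (divdiffs K z u j) (z j) - u j| <= (j.+2)%:R * 2 ^+ j * M * e.
Proof.
move=> uK uM e2 ze.
have M0 : 0 <= M by exact: le_trans (uM 0%N).
have e0 : 0 <= e by exact: le_trans (ze 0%N).
have z2 l : `|z l| <= 2^-1 by exact: le_trans e2.
have dK := divdiffs_supp z j uK.
rewrite (psum_rec _ dK) addrAC (le_trans (ler_normD _ _))//.
have := divdiffs_near j uK uM e2 ze 0%N; rewrite add0n => H1.
apply: (le_trans (lerD H1 (_ : _ <= e * (2 * (2 ^+ j * M))))).
  by rewrite normrM; apply: ler_pM => //; exact: divdiff_bound (@divdiffs_bound K z u M j uM z2) _ _.
by rewrite -(addn2 j) natrD; lra.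
Qed.

Lemma prod_near n (a b : 'I_n -> R) M e : 1 <= M ->
  (forall i, `|a i| <= M) -> (forall i, `|b i| <= M) -> (forall i, `|a i - b i| <= e) ->
  `|\prod_i a i - \prod_i b i| <= n%:R * M ^+ n * e.
Proof.
move=> M1; elim: n a b => [|n IHn] a b aM bM ab.
  by rewrite !big_ord0 subrr normr0 !mul0r.
have M0 : 0 <= M by exact: le_trans M1.
have e0 : 0 <= e by exact: le_trans (ab ord0).
rewrite !big_ord_recl.
set A := \prod_(i < n) _; set B := \prod_(i < n) _.
rewrite (_ : _ - _ = a ord0 * (A - B) + (a ord0 - b ord0) * B); last by ring.
rewrite (le_trans (ler_normD _ _))// !normrM.
have AB : `|A - B| <= n%:R * M ^+ n * e by apply: IHn.
have BM : `|B| <= M ^+ n.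
  rewrite normr_prod -[n in M ^+ n]card_ord -prodr_const.
  by apply: ler_prod => i _; rewrite normr_ge0/=.
apply: (le_trans (lerD (ler_pM _ _ (aM ord0) AB) (ler_pM _ _ (ab ord0) BM))) => //.
have : 0 <= M ^+ n * e by rewrite mulr_ge0// exprn_ge0.
rewrite exprS -natr1 => H.
suff : e * M ^+ n <= M * M ^+ n * e by lra.
by rewrite mulrC -mulrA ler_peMl.
Qed.

Lemma det_near n M : 1 <= M -> exists2 C : R, 0 <= C &
  forall (A B : 'M[R]_n) e, (forall i j, `|A i j| <= M) -> (forall i j, `|B i j| <= M) ->
  (forall i j, `|A i j - B i j| <= e) -> `|\det A - \det B| <= C * e.
Proof.
move=> M1; exists (\sum_(s : 'S_n) n%:R * M ^+ n).
  by apply: sumr_ge0 => s _; rewrite mulr_ge0// exprn_ge0// (le_trans _ M1).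
move=> A B e AM BM AB; rewrite /determinant -sumrB mulr_suml.
apply: le_trans (ler_norm_sum _ _ _) _; apply: ler_sum => s _.
rewrite -mulrBr normrM normrX normrN1 expr1n mul1r.
exact: prod_near.
Qed.

End newton.

Section sinh_det.
Context (R : realType).

Definition sinhR (x : R) := (expR x - expR (- x)) / 2.

Definition sinh_coeff (a : R) (k : nat) := a ^+ (k.*2).+1 / ((k.*2).+1)`!%:R.

(** The recursion for divided differences is stated for finitely supported coefficients, hence the
    truncation. *)
Definition sinh_trunc (K : nat) (a : R) (k : nat) := if (k < K)%N then sinh_coeff a k else 0.

Lemma sinh_psumE (a y : R) K :
  y * psum K (sinh_trunc K a) (y ^+ 2) =
  (series (exp_coeff (a * y)) (K.*2) - series (exp_coeff (- (a * y))) (K.*2)) / 2.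
Proof.
rewrite /psum (eq_bigr (fun k : 'I_K => sinh_coeff a k * (y ^+ 2) ^+ k)); last first.
  by move=> k _; rewrite /sinh_trunc ltn_ord.
elim: K => [|K IHK]; first by rewrite /series/= !big_geq// big_ord0 mulr0 subrr mul0r.
rewrite big_ord_recr/= mulrDr IHK doubleS /series/= !big_nat_recr//=.
have odd2K : (-1 : R) ^+ K.*2 = 1 by rewrite -mul2n exprM sqrrN !expr1n.
have -> : exp_coeff (- (a * y)) K.*2 = exp_coeff (a * y) K.*2.
  by rewrite /exp_coeff/= exprNn odd2K mul1r.
have -> : exp_coeff (- (a * y)) K.*2.+1 = - exp_coeff (a * y) K.*2.+1.
  by rewrite /exp_coeff/= exprNn [(-1) ^+ _]exprS odd2K mulr1 mulN1r mulNr.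
have -> : y * (sinh_coeff a K * (y ^+ 2) ^+ K) = exp_coeff (a * y) K.*2.+1.
  rewrite /sinh_coeff /exp_coeff/= -exprM mul2n exprMn [y ^+ (K.*2).+1]exprS.
  by move: (a ^+ _) (y ^+ _) (_^-1) => A Y f; ring.
lra.
Qed.

Lemma cvg_sinh_psum (a y : R) :
  y * psum K (sinh_trunc K a) (y ^+ 2) @[K --> \oo] --> sinhR (a * y).
Proof.
under eq_cvg do rewrite sinh_psumE.
have dbl : (K.*2 @[K --> \oo] --> \oo)%classic.
  move=> S [N _ NS]; exists N => // K /= NK; apply: NS => /=.
  by rewrite -addnn (leq_trans NK)// leq_addr.
apply: cvgMl; apply: cvgB.
  exact: (cvg_comp _ _ dbl (is_cvg_series_exp_coeff (a * y))).
exact: (cvg_comp _ _ dbl (is_cvg_series_exp_coeff (- (a * y)))).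
Qed.

Lemma sinh_coeff_bound (a : R) k : `|sinh_coeff a k| <= expR `|a|.
Proof.
rewrite /sinh_coeff normrM normrX normfV [X in _ / X]ger0_norm//.
apply: le_trans (expR_ge1Dxn k.*2 (normr_ge0 a)).
by rewrite lerDr.
Qed.

(** The polynomial V, which [odd_alternantE] shows to be the product of the positive roots of B_n up
    to sign. *)
Definition odd_alternant n (x : 'I_n -> R) : R :=
  \det (\matrix_(i < n, j < n) x j ^+ (i.*2).+1).

Lemma odd_alternantE n (x : 'I_n -> R) :
  odd_alternant x = (\prod_(i < n) \prod_(j < n | (i < j)%N) (x j ^+ 2 - x i ^+ 2)) * \prod_i x i.
Proof.
rewrite /odd_alternant (_ : \matrix_(_, _) _ =
    Vandermonde n (\row_j (x j ^+ 2)) *m diag_mx (\row_j x j)); last first.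
  by apply/matrixP => i j; rewrite mul_mx_diag !mxE exprS mulrC -exprM mul2n.
rewrite det_mulmx det_Vandermonde det_diag; congr (_ * _).
  by apply: eq_bigr => i _; apply: eq_bigr => j _; rewrite !mxE.
by apply: eq_bigr => i _; rewrite mxE.
Qed.

Definition sinh_mx n (a x : 'I_n -> R) := \matrix_(i < n, j < n) sinhR (a i * x j).

(** The determinant of the first n Taylor coefficients [sinh_coeff (a i) k], that is, the factor in
    front of V(x) in the leading term of det(sinh(a_i x_j)) as x tends to 0. *)
Definition sinh_const n (a : 'I_n -> R) : R :=
  odd_alternant a * \prod_(k < n) (((k.*2).+1)`!%:R)^-1.

(* The truncated entries are odd polynomials in [x j]; expanding them in the Newton
   basis at the squares [x j ^+ 2] makes [odd_alternant x] an exact factor of the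
   determinant, with a cofactor close to [sinh_const a]. *)
Let trunc_mx n (a x : 'I_n -> R) K :=
  \matrix_(i < n, j < n) (x j * psum K (sinh_trunc K (a i)) (x j ^+ 2)).

Lemma trunc_det_near n (a : 'I_n -> R) : exists2 C : R, 0 <= C &
  forall K (x : 'I_n -> R) e, (n <= K)%N -> 0 <= e -> e <= 2^-1 -> (forall j, `|x j| <= e) ->
  `|\det (trunc_mx a x K) - sinh_const a * odd_alternant x| <= C * e * `|odd_alternant x|.
Proof.
pose M : R := \sum_i expR `|a i|.
have M0 : 0 <= M by apply: sumr_ge0 => i _; exact: expR_ge0.
have uM K i k : `|sinh_trunc K (a i) k| <= M.
  rewrite /sinh_trunc; case: ifP => _; last by rewrite normr0.
  apply: le_trans (sinh_coeff_bound _ _) _.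
  by rewrite /M (bigD1 i)//= lerDl sumr_ge0// => j _; exact: expR_ge0.
pose D : R := n.+2%:R * 2 ^+ n * M.
have D0 : 0 <= D by rewrite !mulr_ge0// exprn_ge0.
pose M' : R := 1 + M + D.
have M'1 : 1 <= M' by rewrite /M' -addrA lerDl addr_ge0.
have [C1 C10 C1P] := @det_near R n M' M'1.
exists (C1 * D); first by rewrite mulr_ge0.
move=> K x e nK e0 e2 xe.
(* The nodes are the squares of the [x j], padded with 0 because [divdiffs] takes an infinite
   sequence of nodes. *)
pose z l := if insub l is Some j then (x j : R) ^+ 2 else 0.
have zE (j : 'I_n) : z j = x j ^+ 2 by rewrite /z valK.
have ze l : `|z l| <= e.
  rewrite /z; case: insubP => [j _ _|_]; last by rewrite normr0.
  rewrite normrX expr2; apply: le_trans (ler_pM _ _ (xe j) (xe j)) _ => //.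
  by rewrite ler_piMr// (le_trans e2)// invf_le1//; lra.
have uK i m : (K <= m)%N -> sinh_trunc K (a i) m = 0.
  by rewrite /sinh_trunc ltnNge => ->.
pose w := \matrix_(i < n, k < n) psum K (divdiffs K z (sinh_trunc K (a i)) k) (z k).
pose t := \matrix_(k < n, j < n) \prod_(l < k) (z j - z l).
(* Newton coefficients, times the Newton basis at the nodes, times the diagonal of the [x j]. The
   basis matrix is triangular, since a basis polynomial vanishes at all earlier nodes, and its
   determinant is the Vandermonde product of the squares. *)
have -> : trunc_mx a x K = w *m t *m diag_mx (\row_j x j).
  apply/matrixP => i j; rewrite mul_mx_diag !mxE mulrC; congr (_ * _).
  rewrite (newton z n _ (uK i)) (bigD1 j)//= -zE.
  rewrite [X in _ + X](_ : _ = 0) ?addr0; last first.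
    by rewrite (bigD1 j)//= subrr mul0r mulr0.
  by rewrite -(bigD1 j (P := predT))//=; apply: eq_bigr => k _; rewrite !mxE.
have dt : \det t * \prod_i x i = odd_alternant x.
  rewrite odd_alternantE; congr (_ * _); rewrite -det_tr det_trig; last first.
    apply/is_trig_mxP => i j ij; rewrite !mxE (bigD1 (Ordinal ij))//=.
    by rewrite subrr mul0r.
  rewrite (exchange_big_dep predT)//=; apply: eq_bigr => j _; rewrite !mxE.
  rewrite (big_ord_widen _ (fun l => z j - z l) (ltnW (ltn_ord j))).
  by apply: eq_bigr => l _; rewrite !zE.
rewrite !det_mulmx det_diag -mulrA (_ : \prod_i _ 0 i = \prod_i x i); last first.
  by apply: eq_bigr => i _; rewrite mxE.
rewrite dt -mulrBl normrM ler_wpM2r//.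
pose u := \matrix_(i < n, k < n) sinh_coeff (a i) k.
have -> : sinh_const a = \det u.
  rewrite /sinh_const /odd_alternant.
  have -> : u = (\matrix_(i < n, j < n) a j ^+ (i.*2).+1)^T *m
      diag_mx (\row_k (((k.*2).+1)`!%:R)^-1).
    by apply/matrixP => i k; rewrite mul_mx_diag !mxE.
  rewrite det_mulmx det_tr det_diag; congr (_ * _).
  by apply: eq_bigr => k _; rewrite mxE.
rewrite -mulrA.
have uw i k : `|w i k - u i k| <= D * e.
  rewrite !mxE.
  have := newton_coef_near k (uK i) (uM K i) e2 ze.
  rewrite /sinh_trunc (leq_trans (ltn_ord k) nK) => /le_trans; apply.
  rewrite ler_wpM2r// /D ler_wpM2r//; apply: ler_pM => //.
    by rewrite ler_nat !ltnS ltnW.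
  by rewrite ler_weXn2l ?ler1n// ltnW.
have uM' i k : `|u i k| <= M.
  rewrite mxE; have := uM k.+1 i k; by rewrite /sinh_trunc ltnSn.
apply: C1P => // i k.
  rewrite -[w i k](subrK (u i k)) (le_trans (ler_normD _ _))// /M'.
  have : D * e <= D by rewrite ler_piMr//; lra.
  have := uw i k; have := uM' i k; lra.
by apply: le_trans (uM' i k) _; rewrite /M'; lra.
Qed.

(** The constant of [trunc_det_near] is independent of [K], so the estimate passes to the limit: for
    every [d > 0] some [K] makes the truncation change the determinant by at most [d]. *)
Lemma sinh_det_near n (a : 'I_n -> R) : exists2 C : R, 0 <= C &
  forall (x : 'I_n -> R) e, 0 <= e -> e <= 2^-1 -> (forall j, `|x j| <= e) ->
  `|\det (sinh_mx a x) - sinh_const a * odd_alternant x| <= C * e * `|odd_alternant x|.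
Proof.
have [C C0 CP] := trunc_det_near a; exists C => // x e e0 e2 xe.
pose M : R := 1 + \sum_i \sum_j (`|sinhR (a i * x j)| + 1).
have entry i j : `|sinhR (a i * x j)| + 1 <= M.
  have p k l : 0 <= `|sinhR (a k * x l)| + 1 by rewrite addr_ge0.
  rewrite /M (bigD1 i)//= (bigD1 j)//=.
  set t := _ + 1; set s1 := \sum_(_ | _) _; set s2 := \sum_(_ | _) _.
  have : 0 <= s1 by exact: sumr_ge0.
  suff : 0 <= s2 by lra.
  by apply: sumr_ge0 => k _; exact: sumr_ge0.
have M1 : 1 <= M.
  by rewrite /M lerDl; apply: sumr_ge0 => i _; apply: sumr_ge0 => j _; rewrite addr_ge0.
have [C1 C10 C1P] := @det_near R n M M1.
apply/ler_addgt0Pl => d d0.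
pose dd : R := Num.min 1 (d / (C1 + 1)).
have dd0 : 0 < dd by rewrite lt_min ltr01 divr_gt0// ltr_wpDl.
have H : \forall K \near \oo, forall i j, `|trunc_mx a x K i j - sinh_mx a x i j| < dd.
  apply: filter_forall => i; apply: filter_forall => j.
  have /cvgrPdist_lt /(_ _ dd0) := @cvg_sinh_psum (a i) (x j).
  by apply: filterS => K; rewrite !mxE distrC.
have [N _ /(_ (maxn n N) (leq_maxr n N))/= {}H] := H.
have nK := leq_maxl n N; set K := maxn n N in H nK.
rewrite -[\det (sinh_mx a x)](subrK (\det (trunc_mx a x K))) -addrA.
apply: le_trans (ler_normD _ _) _; apply: lerD; last exact: CP.
rewrite distrC; apply: le_trans (C1P _ _ dd _ _ _) _.
- move=> i j; rewrite -[trunc_mx a x K i j](subrK (sinh_mx a x i j)).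
  rewrite (le_trans (ler_normD _ _))//; apply: le_trans (entry i j).
  rewrite addrC; apply: lerD; first by rewrite mxE.
  by rewrite (le_trans (ltW (H i j)))// /dd ge_min lexx.
- by move=> i j; rewrite mxE (le_trans _ (entry i j))// lerDl.
- by move=> i j; exact: ltW.
apply: (@le_trans _ _ (C1 * (d / (C1 + 1)))).
  by rewrite ler_wpM2l// /dd ge_min lexx orbT.
rewrite mulrCA; apply: ler_piMr; first exact: ltW.
by rewrite ler_pdivrMr ?mul1r ?lerDl// ltr_wpDl.
Qed.

End sinh_det.

(** * Reflection at the walls *)

(** Heine-Cantor, from the near-covering form of compactness. *)
Lemma segment_unif_continuous (R : realType) (f : R -> R) (a b e : R) :
  {within `[a, b], continuous f} -> 0 < e ->
  exists2 d, 0 < d & forall x y, a <= x <= b -> a <= y <= b -> `|x - y| < d -> `|f x - f y| < e.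
Proof.
move=> cf e0.
have /compact_near_coveringP ncov := @segment_compact R a b.
pose Pd (d : R) (x : R) := forall y, a <= y <= b -> `|x - y| < d -> a <= x <= b -> `|f x - f y| < e.
have e2 : 0 < e / 2 by rewrite divr_gt0.
have H : \forall d \near 0^'+, `[a, b]%classic `<=` Pd d.
  apply: ncov => x /=; rewrite in_itv/= => xab.
  have /subspace_continuousP /(_ x) := cf.
  rewrite /= in_itv/= xab => /(_ isT) /cvgrPdist_lt /(_ (e / 2) e2) H.
  have /nbhs_ballP[r /= r0 rH] : nbhs x [set x' | a <= x' <= b -> `|f x - f x'| < e / 2].
    by move: H; rewrite near_withinE; apply: filterS => x' /=; rewrite in_itv.
  near=> x' d => y yab /= x'y x'ab.
  have xx' : `|x - x'| < r / 2.
    by near: x'; apply: (nbhsx_ballx x (r / 2)); rewrite divr_gt0.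
  have dr : d < r / 2 by near: d; apply: nbhs_right_lt; rewrite divr_gt0.
  have fx' : `|f x - f x'| < e / 2.
    apply: rH => //; rewrite /ball/= (lt_le_trans xx')// ler_pdivrMr// ler_peMr ?ltW//.
    by rewrite ltr1n.
  have fy : `|f x - f y| < e / 2.
    apply: rH => //; rewrite /ball/= -(subrK x' x) -addrA (le_lt_trans (ler_normD _ _))//.
    by rewrite (splitr r) ltrD// (lt_trans x'y).
  rewrite -(subrK (f x) (f x')) -addrA (le_lt_trans (ler_normD _ _))//.
  by rewrite (splitr e) ltrD// distrC.
have [d [d0 Hd]] : exists d : R, 0 < d /\ `[a, b]%classic `<=` Pd d.
  near (0 : R)^'+ => d; exists d; split; first by near: d; exact: nbhs_right_gt.
  by near: d.
exists d => // x y xab yab xy.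
by apply: (Hd x) => //=; rewrite in_itv.
Unshelve. all: by end_near. Qed.

Lemma bounded_cvg_Rintegral (R : realType) d (T : measurableType d)
    (P : probability T R) (f : nat -> T -> R) (g : T -> R) (M : R) :
  (forall k, measurable_fun setT (f k)) -> (forall k w, `|f k w| <= M) ->
  (forall w, f ^~ w @ \oo --> g w) ->
  measurable_fun setT g /\
  \int[P]_w f k w @[k --> \oo] --> \int[P]_w g w.
Proof.
move=> mf fM fg.
have mg : measurable_fun setT g.
  by apply: (@measurable_fun_cvg _ _ _ setT f) => // w _; exact: fg.
split=> //.
have [] := @dominated_convergence _ _ _ P setT measurableT (fun k w => (f k w)%:E)
  (EFin \o g) (cst M%:E).
- by move=> k; exact/measurable_EFinP.
- exact/measurable_EFinP.
- by apply: aeW => w _; apply: cvg_EFin; [exact: nearW|exact: fg].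
- exact: finite_measure_integrable_cst.
- by apply: aeW => w k _; rewrite lee_fin.
move=> gi _.
have -> : (\int[P]_x (EFin \o g) x)%E = (\int[P]_w g w)%:E.
  by rewrite /Rintegral fineK//; exact: integrable_fin_num.
by move=> /fine_cvgP[_].
Qed.

Lemma bounded_integrable (R : realType) d (T : measurableType d)
    (P : probability T R) (f : T -> R) (M : R) :
  measurable_fun setT f -> (forall w, `|f w| <= M) -> P.-integrable setT (EFin \o f).
Proof.
move=> mf fM; apply: (@le_integrable _ _ _ P setT measurableT _ (cst M%:E)).
- exact/measurable_EFinP.
- by move=> w _ /=; rewrite lee_fin (le_trans (fM w))// ler_norm.
- exact: finite_measure_integrable_cst.
Qed.

(** For 0-1 values this splits the event that some [h q] is 1 according to the first such index. *)
Lemma sum_first_hit (R : comPzRingType) (h : nat -> R) Q :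
  \sum_(q < Q) h q * \prod_(q' < q) (1 - h q') = 1 - \prod_(q < Q) (1 - h q).
Proof.
elim: Q => [|Q IHQ]; first by rewrite !big_ord0 subrr.
by rewrite !big_ord_recr/= IHQ; ring.
Qed.

Lemma Rintegral_probability_cst (R : realType) d (T : measurableType d)
    (P : probability T R) (r : R) : \int[P]_w r = r.
Proof.
transitivity (r * fine (P setT)); first exact: (Rintegral_cst P measurableT).
by rewrite probability_setT mulr1.
Qed.

Section walls.
Context (R : realType) (n : nat).
Implicit Types (v : 'I_n * 'I_n) (x y : 'I_n -> R).

(* The wall [(i, i)] is [x_i = 0]; the walls [(i, j)] and [(j, i)] are [x_i = x_j]. *)
Definition wall_form v x : R :=
  if v.1 == v.2 then x v.1 else
  if (v.1 < v.2)%N then x v.1 - x v.2 else x v.2 - x v.1.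

Definition wall_sign v (k : 'I_n) : bool := (v.1 == v.2) && (k == v.1).

(** The two kinds of reflection share one formula: for a wall [(i, i)] the transposition is trivial
    and only the sign acts, for the other walls only the transposition does. *)
Definition wall_refl v x : 'I_n -> R :=
  fun k => (-1) ^+ wall_sign v k * x (tperm v.1 v.2 k).

Definition chamber x := forall v, 0 < wall_form v x.

Lemma wall_sign_tperm v k : wall_sign v (tperm v.1 v.2 k) = wall_sign v k.
Proof. by rewrite /wall_sign; case: eqP => //= ->; rewrite tperm1 perm1. Qed.

Lemma wall_refl_dist v x k : `|wall_refl v x k - x k| <= 2 * `|wall_form v x|.
Proof.
case: v => i j; rewrite /wall_refl /wall_form /wall_sign/=.
have [<-|ij]/= := eqVneq i j.
  rewrite tperm1 perm1; case: eqP => [->|_]; last first.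
    by rewrite expr0 mul1r subrr normr0 mulr_ge0.
  by rewrite expr1 mulN1r -opprD normrN -mulr2n normrMn mulr_natl.
rewrite expr0 mul1r.
have H : `|x i - x j| <= 2 * `|if (i < j)%N then x i - x j else x j - x i|.
  have -> : `|if (i < j)%N then x i - x j else x j - x i| = `|x i - x j|.
    by case: ifP => // _; rewrite distrC.
  by rewrite ler_peMl// ler1n.
case: tpermP => [->|->|_ _]; [by rewrite distrC|by []|].
by rewrite subrr normr0 mulr_ge0.
Qed.

Lemma wall_formB v x y : wall_form v (fun i => x i - y i) = wall_form v x - wall_form v y.
Proof. by rewrite /wall_form; case: ifP => // _; case: ifP => _; ring. Qed.

Lemma wall_form_le v x e : (forall i, `|x i| <= e) -> `|wall_form v x| <= 2 * e.
Proof.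
move=> xe; have e0 : 0 <= e by exact: le_trans (xe v.1).
rewrite /wall_form; case: ifP => _; first by rewrite (le_trans (xe _))// ler_peMl// ler1n.
by case: ifP => _; rewrite mulr_natl mulr2n (le_trans (ler_normB _ _))// lerD.
Qed.

Context (m : nat) (eta : 'I_n -> R).
Local Notation idx := ('I_n * 'I_m)%type.
Implicit Types (D : idx -> R) (l : nat).

Definition position D l : 'I_n -> R := fun i => eta i + \sum_(k < m | (k < l)%N) D (i, k).

Definition reflect_idx v l (ik : idx) : idx :=
  if (ik.2 < l)%N then ik else (tperm v.1 v.2 ik.1, ik.2).

Lemma reflect_idxK v l : involutive (reflect_idx v l).
Proof.
by move=> [i k]; rewrite /reflect_idx/=; case kl : (k < l)%N; rewrite /= kl// tpermK.
Qed.

Definition reflect_perm v l : {perm idx} := perm (inv_inj (reflect_idxK v l)).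

Definition reflect_sign v l (ik : idx) : bool := (l <= ik.2)%N && wall_sign v ik.1.

Definition reflect_path v l D : idx -> R :=
  fun ik => (-1) ^+ reflect_sign v l ik * D (reflect_perm v l ik).

Lemma position_reflect_before v l l' D : (l' <= l)%N ->
  position (reflect_path v l D) l' = position D l'.
Proof.
move=> l'l; apply/funext => i; congr (_ + _); apply: eq_bigr => k kl'.
rewrite /reflect_path /reflect_sign permE /reflect_idx/=.
by rewrite (leq_trans kl' l'l) leqNgt (leq_trans kl' l'l)/= expr0 mul1r.
Qed.

Lemma position_sub D l i : (l <= m)%N ->
  position D m i - position D l i = \sum_(k < m | (l <= k)%N) D (i, k).
Proof.
move=> lm; rewrite /position opprD addrACA subrr add0r.
rewrite (eq_bigl predT) => [|k]; last by rewrite ltn_ord.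
rewrite (bigID (fun k : 'I_m => (k < l)%N))/= addrAC subrr add0r.
by apply: eq_bigl => k; rewrite -leqNgt.
Qed.

(** Reflecting the increments from step [l] on leaves the point at step [l] in place, whereas the
    linear reflection moves it unless it lies on the wall. The inserted difference is this
    discrepancy, which is small when the path is near the wall at step [l]. *)
Lemma position_reflect_after v l D : (l <= m)%N ->
  position (reflect_path v l D) m = wall_refl v
    (fun k => position D m k + (wall_refl v (position D l) k - position D l k)).
Proof.
move=> lm; apply/funext => i.
rewrite -[LHS](subrK (position (reflect_path v l D) l i)) position_sub//.
rewrite (position_reflect_before v D (leqnn l)).
rewrite /wall_refl tpermK wall_sign_tperm mulrDr mulrBr mulrA -signr_addb addbb mul1r.
rewrite [RHS]addrCA -mulrBr [LHS]addrC position_sub//; congr (_ + _).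
rewrite mulr_sumr; apply: eq_bigr => k lk.
rewrite /reflect_path /reflect_sign permE /reflect_idx/= lk /=.
by rewrite ltnNge lk.
Qed.

End walls.

(** The form of [brownian_motion] used in the analysis, with plain families of functions in place of
    row vectors and bundled random variables. *)
Definition bm_process (R : realType) d (T : measurableType d) (P : probability T R)
    (n : nat) (X : 'I_n -> R -> T -> R) (eta : 'I_n -> R) : Prop :=
  [/\ forall i s, measurable_fun setT (X i s),
      forall i w, X i 0 w = eta i,
      forall i w, {within `[0, +oo[, continuous (fun s => X i s w)},
      forall i s t, 0 <= s -> s < t ->
        has_normal_law P (fun w => X i t w - X i s w) 0 (Num.sqrt (t - s))
    & forall (m : nat) (s : nat -> R), 0 <= s 0%N ->
        (forall k, (k < m)%N -> s k < s k.+1) ->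
        mutually_independent P (fun (ik : 'I_n * 'I_m) w =>
          X ik.1 (s ik.2.+1) w - X ik.1 (s ik.2) w) ].

(** * Brownian increments on a uniform time grid *)

Section grid.
Context (R : realType) d (T : measurableType d) (P : probability T R).
Context (n : nat) (X : 'I_n -> R -> T -> R) (eta : 'I_n -> R) (t : R).
Hypotheses (bmX : bm_process P X eta) (t0 : 0 < t).

Let mX i s : measurable_fun setT (X i s). Proof. by case: bmX. Qed.

Definition grid (m k : nat) : R := t * k%:R / m%:R.

Definition increments m (ik : 'I_n * 'I_m) (w : T) : R :=
  X ik.1 (grid m ik.2.+1) w - X ik.1 (grid m ik.2) w.

Lemma grid_ge0 m k : 0 <= grid m k.
Proof. by rewrite /grid divr_ge0// mulr_ge0// ltW. Qed.

Lemma grid_le m k : (k <= m)%N -> grid m k <= t.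
Proof.
move=> km; rewrite /grid; have [->|m0] := posnP m; first by rewrite invr0 mulr0 ltW.
by rewrite ler_pdivrMr ?ltr0n// ler_pM2l// ler_nat.
Qed.

Lemma gridS m k : grid m k.+1 - grid m k = t / m%:R.
Proof. by rewrite /grid -mulrBl -mulrBr -natrB// subSnn mulr1. Qed.

Lemma measurable_increments m ik : measurable_fun setT (@increments m ik).
Proof. exact: measurable_funB. Qed.

Lemma increments_indep m : (0 < m)%N -> mutually_independent P (@increments m).
Proof.
move=> m0; case: bmX => _ _ _ _; apply; first by rewrite grid_ge0.
by move=> k _; rewrite -subr_gt0 gridS divr_gt0// ltr0n.
Qed.

Lemma increments_law m ik : (0 < m)%N ->
  has_normal_law P (@increments m ik) 0 (Num.sqrt (t / m%:R)).
Proof.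
move=> m0; rewrite -(gridS m ik.2).
case: bmX => _ _ _ + _; apply; first exact: grid_ge0.
by rewrite -subr_gt0 gridS divr_gt0// ltr0n.
Qed.

Lemma position_increments m l w : (l <= m)%N ->
  position eta ((@increments m)^~ w) l = fun i => X i (grid m l) w.
Proof.
move=> lm; apply/funext => i; rewrite /position.
rewrite -(big_ord_widen m (fun k => X i (grid m k.+1) w - X i (grid m k) w))//.
rewrite -(big_mkord predT (fun k => X i (grid m k.+1) w - X i (grid m k) w)).
rewrite telescope_sumr// {2}/grid mulr0 mul0r.
by case: bmX => _ -> _ _ _; rewrite addrC subrK.
Qed.

(** The mesh is uniform, so all increments have the same centred normal law; together with
    independence this makes their joint law invariant under permutations and sign changes. *)
Lemma reflect_law v l m (F : ('I_n * 'I_m -> R) -> R) : (0 < m)%N -> pt_measurable F ->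
  \int[P]_w F (reflect_path v l ((@increments m)^~ w)) =
  \int[P]_w F ((@increments m)^~ w).
Proof.
move=> m0 mF; rewrite /Rintegral; congr fine.
pose Y ik w := (-1) ^+ reflect_sign v l ik * @increments m (reflect_perm m v l ik) w.
have sd0 : Num.sqrt (t / m%:R) != 0 by rewrite gt_eqF// sqrtr_gt0 divr_gt0// ltr0n.
apply: (@eq_law_integral _ _ _ _ P (@increments m) _ _ P Y _ _ _ _ _ (fun D => (F D)%:E)).
- by move=> ik; exact: measurable_increments.
- by move=> ik; apply: measurable_funM => //; exact: measurable_increments.
- exact: increments_indep.
- by apply: indep_signed_perm; exact: increments_indep.
- move=> ik A mA; rewrite (increments_law ik m0 mA) /Y.
  case: (reflect_sign v l ik); last first.
    rewrite expr0; under eq_fun do rewrite mul1r.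
    exact: increments_law.
  rewrite expr1; under eq_fun do rewrite mulN1r.
  have mNA : measurable (-%R @^-1` A : set R).
    by rewrite -[_ @^-1` _]setTI; exact: (@oppr_measurable R setT).
  by rewrite (increments_law (reflect_perm m v l ik) m0 mNA) normal_probN.
- exact/measurable_EFinP.
Qed.

End grid.

(** * Antisymmetric test functions average to zero over killed paths *)

Section killing.
Context (R : realType) d (T : measurableType d) (P : probability T R).
Context (n : nat) (X : 'I_n -> R -> T -> R) (eta : 'I_n -> R) (t : R).
Hypotheses (bmX : bm_process P X eta) (t0 : 0 < t) (n0 : (0 < n)%N).
Variables (Phi : ('I_n -> R) -> R) (M L : R).
Hypotheses (mPhi : pt_measurable Phi) (PhiM : forall x, `|Phi x| <= M).
Hypothesis PhiL : forall x y e, (forall k, `|x k - y k| <= e) -> `|Phi x - Phi y| <= L * e.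
Hypothesis PhiN : forall v x, Phi (wall_refl v x) = - Phi x.

Local Notation walls := (enum {: 'I_n * 'I_n}).
Let W := size walls.
Let v0 : 'I_n * 'I_n := (Ordinal n0, Ordinal n0).
Let wall q := nth v0 walls (q %% W).
Let level q := (q %/ W)%N.

Let W0 : (0 < W)%N.
Proof. by rewrite /W -cardE; apply/card_gt0P; exists v0. Qed.

Let wall_surj v l : exists2 q, (q < l.+1 * W)%N & (wall q = v /\ level q = l).
Proof.
have vW : (index v walls < W)%N by rewrite index_mem mem_enum.
exists (l * W + index v walls)%N; first by rewrite mulSn addnC ltn_add2r.
by rewrite /wall /level modnMDl modn_small// nth_index ?mem_enum// divnMDl// divn_small// addn0.
Qed.

Section fixed_grid.
(** The margin [delta] bridges grid and continuous time. Strict positivity at all grid times would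
    not exclude touching a wall in between, whereas a form above [delta > 0] at all dyadic times
    stays positive throughout by continuity. *)
Variables (m : nat) (delta : R).
Hypothesis m0 : (0 < m)%N.
Implicit Types D : 'I_n * 'I_m -> R.

Let pos D l := position eta D l.
(* [q] enumerates the pairs (time level, wall) in chronological order. *)
Definition hit q D : R := \1_(`]-oo, delta]%classic) (wall_form (wall q) (pos D (level q))).
Definition first_hit q D : R := hit q D * \prod_(q' < q) (1 - hit q' D).
Definition alive D : R := \prod_(q < m.+1 * W) (1 - hit q D).

Lemma hit01 q D : hit q D = 0 \/ hit q D = 1.
Proof. by rewrite /hit indicE; case: (_ \in _); [right|left]. Qed.

Lemma hit_eq0 q D : hit q D = 0 <-> delta < wall_form (wall q) (pos D (level q)).
Proof.
rewrite /hit indicE mem_setE in_itv/= ltNge.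
by case: (_ <= delta); split => //= /eqP; rewrite oner_eq0.
Qed.

Lemma prod_hit01 k D : \prod_(q < k) (1 - hit q D) = 0 \/ \prod_(q < k) (1 - hit q D) = 1.
Proof.
elim: k => [|k IHk]; first by rewrite big_ord0; right.
rewrite big_ord_recr/=; case: IHk => ->; first by rewrite mul0r; left.
by rewrite mul1r; case: (hit01 k D) => ->; rewrite ?subr0 ?subrr; [right|left].
Qed.

Lemma prod_hit_neq0 k D : \prod_(q < k) (1 - hit q D) != 0 <->
  (forall q, (q < k)%N -> hit q D = 0).
Proof.
split=> [/prodf_neq0 H q qk|H].
  have := H (Ordinal qk) isT; case: (hit01 q D) => /= ->//.
  by rewrite subrr eqxx.
by apply/prodf_neq0 => q _; rewrite H// subr0 oner_neq0.
Qed.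

Lemma first_hit_ge0 q D : 0 <= first_hit q D.
Proof.
by rewrite /first_hit; case: (prod_hit01 q D) => ->; rewrite ?mulr0 ?mulr1.
Qed.

Lemma sum_first_hitE D : \sum_(q < m.+1 * W) first_hit q D = 1 - alive D.
Proof. exact: (sum_first_hit (fun q => hit q D)). Qed.

Lemma first_hit_neq0 q D : first_hit q D != 0 ->
  wall_form (wall q) (pos D (level q)) <= delta /\
  forall q', (q' < q)%N -> delta < wall_form (wall q') (pos D (level q')).
Proof.
rewrite /first_hit mulf_eq0 negb_or => /andP[hq /prod_hit_neq0 H]; split.
  by rewrite leNgt; apply/negP => /hit_eq0 h0; rewrite h0 eqxx in hq.
by move=> q' q'q; apply/hit_eq0; exact: H.
Qed.

Lemma first_hit_reflect v q D :
  first_hit q (reflect_path v (level q) D) = first_hit q D.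
Proof.
have H q' : (q' <= q)%N -> hit q' (reflect_path v (level q) D) = hit q' D.
  by move=> q'q; rewrite /hit /pos position_reflect_before// leq_div2r.
rewrite /first_hit H//; congr (_ * _); apply: eq_bigr => q' _.
by rewrite H// ltnW.
Qed.

Lemma pt_measurable_position l i : pt_measurable (fun D => pos D l i : R).
Proof.
apply: measurable_funD => //=.
rewrite (_ : (fun _ => _) = fun x : #|{: 'I_n * 'I_m}|.-tuple R =>
  \sum_(k < m) if (k < l)%N then tuple_fun x (i, k) else 0).
  apply: measurable_sum => k; case: (k < l)%N => //; exact: pt_measurable_coord.
by apply/funext => x; rewrite big_mkcond.
Qed.

Lemma pt_measurable_wall v l : pt_measurable (fun D => wall_form v (pos D l) : R).
Proof.
rewrite /pt_measurable /wall_form /comp; case: (v.1 == v.2); first exact: pt_measurable_position.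
by case: (v.1 < v.2)%N; apply: measurable_funB; exact: pt_measurable_position.
Qed.

Lemma pt_measurable_hit q : pt_measurable (hit q).
Proof. by apply: measurableT_comp => //; exact: pt_measurable_wall. Qed.

Lemma pt_measurable_prod_hit k : pt_measurable (fun D => \prod_(q < k) (1 - hit q D) : R).
Proof.
apply: measurable_prod => q _; apply: measurable_funB => //; exact: pt_measurable_hit.
Qed.

Lemma pt_measurable_first_hit q : pt_measurable (first_hit q).
Proof.
by apply: measurable_funM; [exact: pt_measurable_hit|exact: pt_measurable_prod_hit].
Qed.

(* The end point of the path whose increments are reflected from time [level q] on
   is [wall_refl (wall q) (displaced q D)].  That path has the same law, because the
   increments are independent and symmetric: on a fixed grid this replaces the
   strong Markov property. *)
Definition displaced q D : 'I_n -> R := fun k =>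
  pos D m k + (wall_refl (wall q) (pos D (level q)) k - pos D (level q) k).

Lemma pt_measurable_Phi_pos : pt_measurable (fun D => Phi (pos D m)).
Proof.
exact: (@pt_measurable_comp _ _ _ _ Phi _ _ (fun i x => pos (tuple_fun x) m i) mPhi
  (pt_measurable_position m)).
Qed.

Lemma pt_measurable_Phi_displaced q : pt_measurable (fun D => Phi (displaced q D)).
Proof.
apply: (@pt_measurable_comp _ _ _ _ Phi _ _ (fun i x => displaced q (tuple_fun x) i) mPhi).
move=> i; apply: measurable_funD; first exact: pt_measurable_position.
apply: measurable_funB; last exact: pt_measurable_position.
by apply: measurable_funM => //; exact: pt_measurable_position.
Qed.

Let inc := @increments R d T n X t m.
Let minc ik : measurable_fun setT (inc ik). Proof. exact: (measurable_increments t bmX ik). Qed.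

(** The error made by treating the position at the first hit as if it lay on the wall; there the two
    arguments of [Phi] would coincide. *)
Definition defect D : R := \sum_(q < m.+1 * W) (Phi (pos D m) - Phi (displaced q D)) * first_hit q D.

Let first_hit_le1 q D : `|first_hit q D| <= 1.
Proof.
rewrite /first_hit; case: (prod_hit01 q D) => ->; rewrite ?mulr0 ?normr0//.
by rewrite mulr1; case: (hit01 q D) => ->; rewrite ?normr0 ?normr1.
Qed.

Let M0 : 0 <= M. Proof. exact: le_trans (PhiM eta). Qed.

(** The event that [q] is the first hit depends on the path only up to [level q], so it is unchanged
    by the reflection from that time on. Equality in law and antisymmetry of [Phi] then give
    E[Phi(end); q] = -E[Phi(displaced end); q], and summing over [q] gives the factor 2. *)
Lemma integral_defect :
  2 * \int[P]_w (Phi (pos (inc^~ w) m) * (1 - alive (inc^~ w))) = \int[P]_w defect (inc^~ w).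
Proof.
pose A q w := Phi (pos (inc^~ w) m) * first_hit q (inc^~ w).
pose B q w := Phi (displaced q (inc^~ w)) * first_hit q (inc^~ w).
have iA q : P.-integrable setT (EFin \o A q).
  apply: (@bounded_integrable _ _ _ _ _ M).
    apply: measurable_funM; first exact: (pt_measurable_comp pt_measurable_Phi_pos).
    exact: (pt_measurable_comp (pt_measurable_first_hit q)).
  by move=> w; rewrite normrM -[M]mulr1; exact: ler_pM.
have iB q : P.-integrable setT (EFin \o B q).
  apply: (@bounded_integrable _ _ _ _ _ M).
    apply: measurable_funM; first exact: (pt_measurable_comp (pt_measurable_Phi_displaced q)).
    exact: (pt_measurable_comp (pt_measurable_first_hit q)).
  by move=> w; rewrite normrM -[M]mulr1; exact: ler_pM.
have AB q : (q < m.+1 * W)%N -> \int[P]_w A q w = - \int[P]_w B q w.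
  move=> qQ; have qm : (level q <= m)%N by rewrite -ltnS ltn_divLR.
  rewrite -mulN1r -RintegralZl//.
  rewrite -(reflect_law bmX t0 (wall q) (level q) (F := fun D => Phi (pos D m) * first_hit q D))//; last first.
    apply: measurable_funM; first exact: pt_measurable_Phi_pos.
    exact: pt_measurable_first_hit.
  apply: eq_Rintegral => w _; rewrite first_hit_reflect /pos position_reflect_after//.
  by rewrite PhiN mulN1r mulNr.
have sumI (f : nat -> T -> R) k : (forall q, P.-integrable setT (EFin \o f q)) ->
    P.-integrable setT (fun w => (\sum_(q < k) f q w)%:E) /\
    \int[P]_w (\sum_(q < k) f q w) = \sum_(q < k) \int[P]_w f q w.
  move=> fi; elim: k => [|k [IHi IHk]].
    split; first by under eq_fun do rewrite big_ord0; exact: integrable0.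
    by rewrite big_ord0; under eq_Rintegral do rewrite big_ord0; rewrite Rintegral_cst// mul0r.
  split.
    rewrite (_ : (fun w => _) = ((fun w => (\sum_(q < k) f q w)%:E) \+ (EFin \o f k))%E).
      exact: integrableD.
    by apply/funext => w; rewrite big_ord_recr.
  rewrite big_ord_recr/= -IHk -RintegralD//.
  by apply: eq_Rintegral => w _; rewrite big_ord_recr.
transitivity (2 * \int[P]_w \sum_(q < m.+1 * W) A q w).
  by congr (_ * _); apply: eq_Rintegral => w _; rewrite -sum_first_hitE mulr_sumr.
rewrite (sumI A _ iA).2 mulr_sumr.
transitivity (\int[P]_w \sum_(q < m.+1 * W) (A q w - B q w)); last first.
  by apply: eq_Rintegral => w _; apply: eq_bigr => q _; rewrite mulrBl.
have iAB q : P.-integrable setT (EFin \o (fun w => A q w - B q w)).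
  exact: (integrableB measurableT (iA q) (iB q)).
rewrite (sumI (fun q w => A q w - B q w) _ iAB).2.
apply: eq_bigr => q _; rewrite RintegralB//.
have -> : \int[P]_w B q w = - \int[P]_w A q w by rewrite AB ?opprK.
by rewrite opprK -mulr2n mulr_natl.
Qed.

(** At most one [q] is the first hit, so the bound does not grow with the number of grid points. *)
Lemma defect_bound c D : 0 <= L -> (forall q, (q < m.+1 * W)%N -> first_hit q D != 0 ->
    `|wall_form (wall q) (pos D (level q))| <= c) ->
  0 <= c -> `|defect D| <= L * (2 * c).
Proof.
move=> L0 Hc c0; rewrite /defect (le_trans (ler_norm_sum _ _ _))//.
apply: (@le_trans _ _ (\sum_(q < m.+1 * W) L * (2 * c) * first_hit q D)).
  apply: ler_sum => q _; rewrite normrM (ger0_norm (first_hit_ge0 _ _)).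
  have [->|fq] := eqVneq (first_hit q D) 0; first by rewrite !mulr0.
  rewrite ler_wpM2r ?first_hit_ge0//; apply: PhiL => k.
  rewrite /displaced opprD addNKr -normrN opprK.
  by rewrite (le_trans (wall_refl_dist _ _ _))// ler_wpM2l// Hc.
rewrite -mulr_sumr sum_first_hitE ler_piMr ?mulr_ge0//.
by rewrite gerBl /alive; case: (prod_hit01 (m.+1 * W) D) => ->.
Qed.

Lemma defect_le D : `|defect D| <= 2 * M.
Proof.
rewrite /defect (le_trans (ler_norm_sum _ _ _))//.
apply: (@le_trans _ _ (\sum_(q < m.+1 * W) 2 * M * first_hit q D)).
  apply: ler_sum => q _; rewrite normrM (ger0_norm (first_hit_ge0 _ _)).
  rewrite ler_wpM2r ?first_hit_ge0// (le_trans (ler_normB _ _))//.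
  by rewrite mulr_natl mulr2n lerD.
rewrite -mulr_sumr sum_first_hitE ler_piMr ?mulr_ge0//.
by rewrite gerBl /alive; case: (prod_hit01 (m.+1 * W) D) => ->.
Qed.

Lemma pt_measurable_defect : pt_measurable defect.
Proof.
apply: measurable_sum => q; apply: measurable_funM; last exact: pt_measurable_first_hit.
apply: measurable_funB; [exact: pt_measurable_Phi_pos|exact: pt_measurable_Phi_displaced].
Qed.

Lemma alive_neq0 w : alive (inc^~ w) != 0 <->
  forall l v, (l <= m)%N -> delta < wall_form v (fun i => X i (grid t m l) w).
Proof.
split=> [/prod_hit_neq0 H l v lm|H].
  have [q qQ [<- lq]] := wall_surj v l.
  have /hit_eq0 : hit q (inc^~ w) = 0.
    by apply: H; rewrite (leq_trans qQ)// leq_mul2r ltnS lm orbT.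
  by rewrite lq /pos (position_increments t bmX w lm).
apply/prod_hit_neq0 => q qQ; apply/hit_eq0.
have qm : (level q <= m)%N by rewrite -ltnS ltn_divLR.
by rewrite /pos (position_increments t bmX w qm); exact: H.
Qed.

End fixed_grid.

Lemma fin_lower_bound (I : finType) (f : I -> R) : (forall i, 0 < f i) ->
  exists2 c, 0 < c & forall i, c <= f i.
Proof.
move=> f0; exists (\big[Num.min/1]_i f i); last by move=> i; exact: bigmin_le_cond.
by apply: (big_ind (fun x => 0 < x)) => // x y x0 y0; rewrite lt_min x0.
Qed.

Let grid_in m k : (k <= m)%N -> 0 <= grid t m k <= t.
Proof. by move=> km; rewrite (grid_ge0 t0) (grid_le t0 km). Qed.

Let X0 i w : X i 0 w = eta i. Proof. by case: bmX. Qed.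

Let path_continuous i w : {within `[0, t], continuous (fun s => X i s w)}.
Proof.
case: bmX => _ _ cX _ _; apply: continuous_subspaceW (cX i w).
by move=> s /=; rewrite !in_itv/= => /andP[->].
Qed.

Let path_unif w e : 0 < e -> exists2 d, 0 < d &
  forall i x y, 0 <= x <= t -> 0 <= y <= t -> `|x - y| < d -> `|X i x w - X i y w| < e.
Proof.
move=> e0.
have H i : exists dd, 0 < dd /\ forall x y, 0 <= x <= t -> 0 <= y <= t ->
    `|x - y| < dd -> `|X i x w - X i y w| < e.
  by have [dd dd0 Hd] := segment_unif_continuous (@path_continuous i w) e0; exists dd.
have [f fH] := choice H.
have [c c0 cf] := @fin_lower_bound _ f (fun i => (fH i).1).
exists c => // i x y xt yt xy; apply: (fH i).2 => //.
exact: lt_le_trans (cf i).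
Qed.

Let wall_path_continuous v w : {within `[0, t], continuous (fun s => wall_form v (fun i => X i s w))}.
Proof.
rewrite /wall_form; case: (v.1 == v.2); first exact: path_continuous.
by case: (v.1 < v.2)%N => s; apply: continuousB; exact: path_continuous.
Qed.

(** The first hit is not at level 0, as [eta] is beyond the margin. The same wall one level earlier
    has index [q - W] and was not hit, and on a fine grid the form moves by at most [e] in one step;
    so at the hit it lies between [delta - e] and [delta]. *)
Lemma defect_pathwise delta w e : 0 <= delta -> (forall v, delta < wall_form v eta) -> 0 < e ->
  exists N, forall m, (N <= m)%N -> (0 < m)%N -> forall q, (q < m.+1 * W)%N ->
    first_hit delta q ((@increments R d T n X t m)^~ w) != 0 ->
    `|wall_form (wall q) (position eta ((@increments R d T n X t m)^~ w) (level q))| <= delta + e.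
Proof.
move=> delta0 deltaeta e0.
have [dd dd0 Hd] := @path_unif w _ (divr_gt0 e0 (ltr0Sn R 1)).
exists (Num.truncn (t / dd)).+1 => m Nm m0 q qQ /first_hit_neq0[hq before].
have qm : (level q <= m)%N by rewrite -ltnS ltn_divLR.
have tm : t / m%:R < dd.
  rewrite ltr_pdivrMr ?ltr0n// mulrC -ltr_pdivrMr//.
  by rewrite (lt_le_trans (truncnS_gt _))// ler_nat.
move: hq; rewrite (position_increments t bmX w qm).
case lq : (level q) qm => [|l] qm.
  rewrite (_ : (fun i => _) = eta) ?leNgt ?deltaeta//.
  by apply/funext => i; rewrite /grid mulr0 mul0r X0.
move=> hq; rewrite ler_norml; apply/andP; split; last by rewrite (le_trans hq)// lerDl ltW.
have qW : (W <= q)%N by rewrite -(mul1n W) -leq_divRL// -/(level q) lq.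
have := before (q - W)%N; rewrite ltn_subrL W0 (leq_trans W0 qW) => /(_ isT).
have -> : wall (q - W) = wall q.
  by rewrite /wall -[in RHS](subnK qW) modnDr.
have -> : level (q - W) = l.
  by apply: succn_inj; rewrite -lq /level -[in RHS](subnK qW) divnDr// divnn W0 addn1.
rewrite (position_increments t bmX w (ltnW qm)) => hl.
have := @wall_form_le R n (wall q) (fun i => X i (grid t m l.+1) w - X i (grid t m l) w) (e / 2).
rewrite wall_formB => H.
have : `|wall_form (wall q) (fun i => X i (grid t m l.+1) w) -
         wall_form (wall q) (fun i => X i (grid t m l) w)| <= 2 * (e / 2).
  apply: H => i; apply: ltW; apply: (Hd _ _ _ (grid_in qm) (grid_in (ltnW qm))).
  by rewrite gridS gtr0_norm ?divr_gt0 ?ltr0n.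
rewrite mulrCA divff// mulr1 ler_norml => /andP[+ _].
lra.
Qed.

Definition survives : set T :=
  [set w | forall s, 0 <= s <= t -> chamber (fun i => X i s w)].

(** Dyadic grids are nested, so being alive on the grid is monotone in [N] and has a pointwise
    limit. *)
Let dyadic_alive delta N w : R := alive delta ((@increments R d T n X t (2 ^ N))^~ w).

Let expn0 N : (0 < 2 ^ N)%N. Proof. by rewrite expn_gt0. Qed.

Let grid_double N l : grid t (2 ^ N.+1) (2 * l) = grid t (2 ^ N) l.
Proof.
by rewrite /grid expnS !natrM mulrCA -mulf_div divff ?mul1r.
Qed.

Let dyadic_alive_neq0 delta N w : dyadic_alive delta N w != 0 <->
  forall l v, (l <= 2 ^ N)%N -> delta < wall_form v (fun i => X i (grid t (2 ^ N) l) w).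
Proof. exact: alive_neq0. Qed.

Let dyadic_alive_nested delta N w : dyadic_alive delta N.+1 w != 0 -> dyadic_alive delta N w != 0.
Proof.
move=> /dyadic_alive_neq0 H; apply/dyadic_alive_neq0 => l v lN.
by rewrite -grid_double; apply: H; rewrite expnS leq_mul2l lN orbT.
Qed.

Let alive_always delta w := forall N, dyadic_alive delta N w != 0.

Let alive01 delta N w : dyadic_alive delta N w = 0 \/ dyadic_alive delta N w = 1.
Proof. exact: prod_hit01. Qed.

Let alive_lim delta w : R := (`[< alive_always delta w >])%:R.

Let alive_cvg delta w : (dyadic_alive delta)^~ w @ \oo --> alive_lim delta w.
Proof.
rewrite /alive_lim; case: asboolP => [H|/existsNP[N HN]].
  rewrite (_ : (dyadic_alive delta)^~ w = cst 1); first exact: cvg_cst.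
  by apply/funext => N; case: (alive01 delta N w) (H N) => -> //; rewrite eqxx.
apply: cvg_near_cst; exists N => // N' /= NN'.
apply/eqP; apply: contra_notT HN; elim: N' NN' => [|N' IHN'].
  by rewrite leqn0 => /eqP ->.
rewrite leq_eqVlt => /orP[/eqP ->//|]; rewrite ltnS => /IHN' H /dyadic_alive_nested.
exact: H.
Qed.

(** On a surviving path the wall forms have a positive minimum over [[0, t]], which the margin
    eventually undercuts. Otherwise some form is at most 0 at a time [s], and by uniform continuity
    it is at most the margin at a close dyadic time, so the limit is 0 for every [k]. *)
Let alive_lim_cvg delta0 w : 0 < delta0 ->
  (fun k => alive_lim (delta0 / k.+1%:R) w) @ \oo --> (\1_survives w : R).
Proof.
move=> d0; rewrite indicE; have [/set_mem Sw|/negP Sw] := boolP (w \in survives).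
  have H v : exists c, 0 < c /\ forall s, 0 <= s <= t -> c <= wall_form v (fun i => X i s w).
    have [s st sP] := EVT_min (ltW t0) (@wall_path_continuous v w).
    exists (wall_form v (fun i => X i s w)); split; last by move=> s' s't; apply: sP; rewrite in_itv.
    by apply: Sw; rewrite in_itv/= in st.
  have [f fH] := choice H.
  have [c c0 cf] := @fin_lower_bound _ f (fun v => (fH v).1).
  apply: cvg_near_cst; exists (Num.truncn (delta0 / c)) => // k /= ck.
  rewrite /alive_lim asboolT// => N; apply/dyadic_alive_neq0 => l v lN.
  apply: lt_le_trans (le_trans (cf v) ((fH v).2 _ _)).
    rewrite ltr_pdivrMr ?ltr0n// mulrC -ltr_pdivrMr//.
    by rewrite (lt_le_trans (truncnS_gt _))// ler_nat ltnS.
  exact: grid_in.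
have {Sw}[s [v [st sv]]] : exists s v, 0 <= s <= t /\ wall_form v (fun i => X i s w) <= 0.
  apply: contra_notP Sw => H; rewrite inE => s st v; rewrite ltNge; apply/negP => sv.
  by apply: H; exists s, v.
rewrite (_ : (fun k => _) = cst 0); first exact: cvg_cst.
apply/funext => k; rewrite /alive_lim asboolF// => H.
have dk0 : 0 < delta0 / k.+1%:R by rewrite divr_gt0// ltr0n.
have [dd dd0 Hd] := @path_unif w _ (divr_gt0 dk0 (ltr0Sn R 1)).
have [N tN] : exists N, t / (2 ^ N)%:R < dd.
  exists (Num.truncn (t / dd)).+1; rewrite ltr_pdivrMr ?ltr0n// mulrC -ltr_pdivrMr//.
  by rewrite (lt_trans (truncnS_gt _))// ltr_nat ltn_expl.
have N0 : 0 < (2 ^ N)%:R :> R by rewrite ltr0n.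
pose x := s / t * (2 ^ N)%:R.
have x0 : 0 <= x.
  by apply: mulr_ge0; [apply: divr_ge0; [case/andP: st|exact: ltW]|exact: ltW].
have lx : (Num.truncn x <= 2 ^ N)%N.
  rewrite -(ler_nat R) (@le_trans _ _ x) ?truncn_le// /x ler_piMl ?(ltW N0)//.
  by rewrite ler_pdivrMr// mul1r; case/andP: st.
have sx : s = t * x / (2 ^ N)%:R.
  by rewrite /x mulrA mulfK ?gt_eqF// mulrC divfK ?gt_eqF.
have /dyadic_alive_neq0 /(_ (Num.truncn x) v lx) := H N.
have : `|wall_form v (fun i => X i (grid t (2 ^ N) (Num.truncn x)) w) -
         wall_form v (fun i => X i s w)| <= 2 * (delta0 / k.+1%:R / 2).
  rewrite -wall_formB; apply: wall_form_le => i; apply/ltW/Hd => //.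
    exact: grid_in.
  have tx : `|(Num.truncn x)%:R - x| <= 1.
    rewrite distrC ger0_norm ?subr_ge0 ?truncn_le//.
    by have := truncnS_gt x; rewrite -natr1; lra.
  rewrite [X in _ - X]sx /grid -mulrBl -mulrBr !normrM normfV (gtr0_norm t0) (gtr0_norm N0).
  apply: le_lt_trans tN; rewrite ler_pM2r ?invr_gt0//.
  by apply: ler_piMr tx; exact: ltW.
rewrite mulrCA divff// mulr1 ler_norml => /andP[_].
rewrite lerBlDr => h; rewrite ltNge => /negP; apply.
by rewrite (le_trans h)// gerDl.
Qed.

Hypothesis eta_chamber : chamber eta.

Let L0 : 0 <= L.
Proof.
have H (k : 'I_n) : `|eta k - eta k| <= 1 by rewrite subrr normr0.
by have := PhiL H; rewrite subrr normr0 mulr1.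
Qed.

Let M0 : 0 <= M. Proof. exact: le_trans (PhiM eta). Qed.

Let mPhiX : measurable_fun setT (fun w => Phi (fun i => X i t w)).
Proof. by apply: (pt_measurable_comp mPhi (X := fun i => X i t)) => i; case: bmX. Qed.

Let minc m ik : measurable_fun setT (@increments R d T n X t m ik).
Proof. exact: (measurable_increments t bmX ik). Qed.

Let measurable_dyadic_alive delta N : measurable_fun setT (dyadic_alive delta N).
Proof. exact: (pt_measurable_comp (@pt_measurable_prod_hit _ _ _) (@minc _)). Qed.

Let alive_bound delta N w : `|Phi (fun i => X i t w) * (1 - dyadic_alive delta N w)| <= M.
Proof.
case: (alive01 delta N w) => ->; first by rewrite subr0 mulr1.
by rewrite subrr mulr0 normr0.
Qed.

Let alive_integral_cvg delta :
  measurable_fun setT (alive_lim delta) /\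
  \int[P]_w (Phi (fun i => X i t w) * (1 - dyadic_alive delta N w)) @[N --> \oo] -->
  \int[P]_w (Phi (fun i => X i t w) * (1 - alive_lim delta w)).
Proof.
split.
  by apply: (@measurable_fun_cvg _ _ _ setT (dyadic_alive delta)) => // w _.
apply: (@bounded_cvg_Rintegral _ _ _ _ (fun N w => Phi (fun i => X i t w) * (1 - dyadic_alive delta N w)) _ M _ _ _).2 => //.
- by move=> N; apply: measurable_funM => //; exact: measurable_funB.
- move=> w; apply: cvgM; first exact: cvg_cst.
  by apply: cvgB; [exact: cvg_cst|exact: alive_cvg].
Qed.

(** [H N] is the excess of the defect over [2 L delta]. It tends to 0 on each path, at a rate that
    depends on the modulus of continuity of that path, so the passage to the limit goes through
    dominated convergence. *)
Let alive_lim_integral_bound delta : 0 <= delta -> (forall v, delta < wall_form v eta) ->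
  `|\int[P]_w (Phi (fun i => X i t w) * (1 - alive_lim delta w))| <= L * delta.
Proof.
move=> delta0 deltaeta.
pose G N w := defect delta ((@increments R d T n X t (2 ^ N))^~ w).
have GM N w : `|G N w| <= 2 * M by exact: defect_le.
have mG N : measurable_fun setT (G N).
  exact: (pt_measurable_comp (@pt_measurable_defect _ _) (@minc _)).
pose H N w := Num.max (`|G N w| - L * (2 * delta)) 0.
have mH N : measurable_fun setT (H N).
  apply: measurable_maxr => //; apply: measurable_funB => //.
  exact: measurableT_comp.
have H0 N w : 0 <= H N w by rewrite /H le_max lexx orbT.
have HM N w : `|H N w| <= 2 * M.
  rewrite ger0_norm// /H ge_max mulr_ge0// andbT.
  by rewrite (le_trans _ (GM N w))// gerBl !mulr_ge0.
have Hcvg w : H ^~ w @ \oo --> (0 : R).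
  apply/cvgrPdist_le => e e0.
  (* Chosen so that the extra error [L * (2 * e')] is at most [e]; adding 1 to [L] covers the case
     [L = 0]. *)
  have e'0 : 0 < e / (L + 1) / 2 by rewrite !divr_gt0// ltr_wpDl.
  have [N0 HN0] := @defect_pathwise delta w _ delta0 deltaeta e'0.
  exists N0 => // N /= N0N.
  have N0N' : (N0 <= 2 ^ N)%N by rewrite (leq_trans N0N)// ltnW// ltn_expl.
  rewrite sub0r normrN ger0_norm// /H ge_max (ltW e0) andbT.
  have := defect_bound (m := 2 ^ N) L0 (HN0 _ N0N' (expn0 N)).
  rewrite -/(G N w) => /(_ (addr_ge0 delta0 (ltW e'0))) Gb.
  rewrite lerBlDl (le_trans Gb)// mulrDr mulrDr lerD2l.
  rewrite (_ : L * (2 * _) = e * (L / (L + 1))).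
    by rewrite ler_piMr ?(ltW e0)// ler_pdivrMr ?mul1r ?lerDl// ltr_wpDl.
  by field; rewrite gt_eqF// ltr_wpDl.
have bnd N : `|\int[P]_w (Phi (fun i => X i t w) * (1 - dyadic_alive delta N w))| <=
    L * delta + 2^-1 * \int[P]_w H N w.
  have iG : P.-integrable setT (EFin \o G N) by exact: bounded_integrable (mG N) (GM N).
  have iH : P.-integrable setT (EFin \o H N) by exact: bounded_integrable (mH N) (HM N).
  have E : 2 * \int[P]_w (Phi (fun i => X i t w) * (1 - dyadic_alive delta N w)) = \int[P]_w G N w.
    rewrite -(integral_defect delta (expn0 N)); congr (_ * _).
    apply: eq_Rintegral => w _; rewrite (position_increments t bmX w (leqnn _)).
    by rewrite /grid mulfK// gt_eqF// ltr0n.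
  rewrite -(ler_pM2l (ltr0Sn R 1)) -[X in X * `|_|](ger0_norm (ler0n R 2)) -normrM E.
  apply: le_trans (le_normr_Rintegral _ _) _ => //.
  rewrite mulrDr (mulrA 2 2^-1) divff// mul1r.
  have iC : P.-integrable setT (EFin \o cst (2 * (L * delta))).
    exact: finite_measure_integrable_cst.
  have -> : 2 * (L * delta) = \int[P]_w (cst (2 * (L * delta)) w).
    by rewrite Rintegral_probability_cst.
  rewrite -RintegralD//; apply: le_Rintegral => //.
  - have : P.-integrable setT (abse \o (EFin \o G N)) by exact: integrable_abse.
    by [].
  - exact: (integrableD measurableT iC iH).
  by move=> w _; rewrite /H /= (mulrCA L) -lerBlDl le_max lexx.
have [mal cal] := alive_integral_cvg delta.
have [_ cH] := @bounded_cvg_Rintegral _ _ _ P H (cst 0) (2 * M) mH HM Hcvg.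
rewrite Rintegral_cst// mul0r in cH.
have cB : L * delta + 2^-1 * \int[P]_w H N w @[N --> \oo] --> L * delta + 2^-1 * 0.
  by apply: cvgD; [exact: cvg_cst|apply: cvgMr].
rewrite mulr0 addr0 in cB.
by apply: (ler_cvg_to (cvg_norm cal) cB); exact: nearW.
Qed.

(** The bound [L * delta] of the previous step is sent to 0 along a sequence of margins. *)
Lemma killed_integral : measurable survives /\
  \int[P]_w (Phi (fun i => X i t w) * (1 - \1_survives w)) = 0.
Proof.
have [delta0 d0 dP] := @fin_lower_bound _ (fun v => wall_form v eta) eta_chamber.
(* Halved because the margin has to be strictly below every wall form at [eta], also for [k = 0]. *)
pose dk k := (delta0 / 2) / k.+1%:R.
have d2 : 0 < delta0 / 2 by rewrite divr_gt0.
have dk_lt k v : dk k < wall_form v eta.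
  apply: lt_le_trans (dP v); rewrite /dk ltr_pdivrMr ?ltr0n// (@lt_le_trans _ _ delta0)//.
    by rewrite ltr_pdivrMr// ltr_pMr// ltr1n.
  by apply: ler_peMr; [exact: ltW|rewrite ler1n].
have dk_ge0 k : 0 <= dk k by rewrite /dk divr_ge0// ltW.
have mal k : measurable_fun setT (alive_lim (dk k)) := (alive_integral_cvg (dk k)).1.
have al_cvg w : (fun k => alive_lim (dk k) w) @ \oo --> (\1_survives w : R) by exact: alive_lim_cvg.
have mS : measurable_fun setT (\1_survives : T -> R).
  by apply: (@measurable_fun_cvg _ _ _ setT (fun k => alive_lim (dk k))) => // w _.
split.
  have := mS measurableT _ (measurable_set1 1); rewrite setTI.
  rewrite (_ : _ @^-1` _ = survives)//.
  apply/seteqP; split=> w /=; rewrite indicE.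
    by case: (boolP (w \in _)) => [/set_mem//|_] /eqP; rewrite eq_sym oner_eq0.
  by move=> /mem_set ->.
have [_ C] : measurable_fun setT (fun w => Phi (fun i => X i t w) * (1 - \1_survives w)) /\
    \int[P]_w (Phi (fun i => X i t w) * (1 - alive_lim (dk k) w)) @[k --> \oo] -->
    \int[P]_w (Phi (fun i => X i t w) * (1 - \1_survives w)).
  apply: (@bounded_cvg_Rintegral _ _ _ P _ _ M).
  - by move=> k; apply: measurable_funM => //; exact: measurable_funB.
  - move=> k w; rewrite normrM -[M]mulr1; apply: ler_pM => //.
    by rewrite /alive_lim; case: asboolP => _; rewrite ?subrr ?subr0 ?normr0 ?normr1.
  - move=> w; apply: cvgM; first exact: cvg_cst.
    by apply: cvgB; [exact: cvg_cst|exact: al_cvg].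
apply/eqP; rewrite -normr_le0.
have cB : L * dk k @[k --> \oo] --> L * 0.
  apply: cvgMr; rewrite /dk -[X in _ --> X](mulr0 (delta0 / 2)).
  by apply: cvgMr; exact: cvg_harmonic.
rewrite mulr0 in cB.
apply: (ler_cvg_to (cvg_norm C) cB).
by apply: nearW => k; exact: alive_lim_integral_bound.
Qed.

End killing.

(** * Survival in terms of a Gaussian vector *)

Section lipschitz_class.
Context (R : realType) (n : nat).
Implicit Types f g : ('I_n -> R) -> R.

(* The last clause is Lipschitz continuity for the sup norm. *)
Definition bounded_lipschitz f := pt_measurable f /\ exists M L : R,
  [/\ 0 <= L, forall x, `|f x| <= M & forall x y e, 0 <= e ->
      (forall k, `|x k - y k| <= e) -> `|f x - f y| <= L * e].

Lemma bounded_lipschitz_cst c : bounded_lipschitz (fun=> c).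
Proof.
split; first exact: measurable_cst.
by exists `|c|, 0; split => // x y e _ _; rewrite subrr normr0 mul0r.
Qed.

Lemma bounded_lipschitzD f g : bounded_lipschitz f -> bounded_lipschitz g ->
  bounded_lipschitz (fun x => f x + g x).
Proof.
move=> [mf [M [L [L0 fM fL]]]] [mg [M' [L' [L'0 gM gL]]]]; split.
  exact: measurable_funD.
exists (M + M'), (L + L'); split; first exact: addr_ge0.
  by move=> x; rewrite (le_trans (ler_normD _ _))// lerD.
move=> x y e e0 xy; rewrite opprD addrACA (le_trans (ler_normD _ _))// mulrDl.
by rewrite lerD// ?fL ?gL.
Qed.

Lemma bounded_lipschitzM f g : bounded_lipschitz f -> bounded_lipschitz g ->
  bounded_lipschitz (fun x => f x * g x).
Proof.
move=> [mf [M [L [L0 fM fL]]]] [mg [M' [L' [L'0 gM gL]]]]; split.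
  exact: measurable_funM.
have M0 : 0 <= M by exact: le_trans (fM (fun=> 0)).
have M'0 : 0 <= M' by exact: le_trans (gM (fun=> 0)).
exists (M * M'), (L * M' + M * L'); split; first by rewrite addr_ge0// mulr_ge0.
  by move=> x; rewrite normrM; exact: ler_pM.
move=> x y e e0 xy.
rewrite (_ : _ - _ = (f x - f y) * g x + f y * (g x - g y)); last by ring.
rewrite (le_trans (ler_normD _ _))// !normrM mulrDl -(mulrA M) (mulrAC L).
by apply: lerD; apply: ler_pM; rewrite ?fL ?gL.
Qed.

Lemma bounded_lipschitz_sum (I : Type) (s : seq I) (P : pred I) (f : I -> ('I_n -> R) -> R) :
  (forall i, bounded_lipschitz (f i)) -> bounded_lipschitz (fun x => \sum_(i <- s | P i) f i x).
Proof.
move=> fi; elim: s => [|i s IHs].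
  by under eq_fun do rewrite big_nil; exact: bounded_lipschitz_cst.
under eq_fun do rewrite big_cons.
by case: (P i) => //; exact: bounded_lipschitzD.
Qed.

Lemma bounded_lipschitz_prod (I : Type) (s : seq I) (P : pred I) (f : I -> ('I_n -> R) -> R) :
  (forall i, bounded_lipschitz (f i)) -> bounded_lipschitz (fun x => \prod_(i <- s | P i) f i x).
Proof.
move=> fi; elim: s => [|i s IHs].
  by under eq_fun do rewrite big_nil; exact: bounded_lipschitz_cst.
under eq_fun do rewrite big_cons.
by case: (P i) => //; exact: bounded_lipschitzM.
Qed.

Lemma bounded_lipschitzX f k : bounded_lipschitz f -> bounded_lipschitz (fun x => f x ^+ k).
Proof.
move=> fb; elim: k => [|k IHk].
  by under eq_fun do rewrite expr0; exact: bounded_lipschitz_cst.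
by under eq_fun do rewrite exprS; exact: bounded_lipschitzM.
Qed.

Definition clamp (a b u : R) := Num.max a (Num.min b u).

Lemma clamp_lipschitz a b u v : `|clamp a b u - clamp a b v| <= `|u - v|.
Proof.
rewrite /clamp; wlog uv : u v / u <= v.
  by move=> H; case: (leP u v) => [/H//|/ltW/H]; rewrite distrC (distrC v).
rewrite (distrC u) [X in _ <= X]ger0_norm ?subr_ge0// ler_norml.
by rewrite !minEle; do ?(case: ifPn; rewrite -?ltNge => ?); rewrite !maxEle; do ?(case: ifPn; rewrite -?ltNge => ?);
  apply/andP; split; lra.
Qed.

Lemma clamp_bound a b u : `|clamp a b u| <= `|a| + `|b|.
Proof.
rewrite /clamp; have := ler_norm a; have := ler_norm b.
have := ler_norm (- a); have := ler_norm (- b); rewrite !normrN ler_norml minEle => *.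
by do ?(case: ifPn; rewrite -?ltNge => ?); rewrite maxEle; do ?(case: ifPn; rewrite -?ltNge => ?);
  apply/andP; split; lra.
Qed.

Lemma measurable_clamp a b : measurable_fun setT (clamp a b).
Proof. by apply: measurable_maxr => //; exact: measurable_minr. Qed.

Lemma bounded_lipschitz_clamp a b f : bounded_lipschitz f ->
  bounded_lipschitz (fun x => clamp a b (f x)).
Proof.
move=> [mf [M [L [L0 fM fL]]]]; split.
  by apply: measurableT_comp => //; exact: measurable_clamp.
exists (`|a| + `|b|), L; split => // [x|x y e e0 xy]; first exact: clamp_bound.
by rewrite (le_trans (clamp_lipschitz _ _ _ _))// fL.
Qed.

Lemma bounded_lipschitz_coord a b i : bounded_lipschitz (fun x => clamp a b (x i)).
Proof.
split; first by apply: measurableT_comp; [exact: measurable_clamp|exact: pt_measurable_coord].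
exists (`|a| + `|b|), 1; split => // [x|x y e e0 xy]; first exact: clamp_bound.
by rewrite mul1r (le_trans (clamp_lipschitz _ _ _ _)).
Qed.

Lemma clamp_id a b u : a <= u <= b -> clamp a b u = u.
Proof.
move=> /andP[au ub]; rewrite /clamp !minEle.
by do ?(case: ifPn; rewrite -?ltNge => ?); rewrite !maxEle; do ?(case: ifPn; rewrite -?ltNge => ?); lra.
Qed.

Lemma clampN b u : 0 <= b -> clamp (- b) b (- u) = - clamp (- b) b u.
Proof.
move=> b0; rewrite /clamp !minEle.
by do ?(case: ifPn; rewrite -?ltNge => ?); rewrite !maxEle; do ?(case: ifPn; rewrite -?ltNge => ?); lra.
Qed.

Lemma clamp_ge a b u : a <= b -> b <= u -> clamp a b u = b.
Proof.
move=> ab bu; rewrite /clamp !minEle.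
by do ?(case: ifPn; rewrite -?ltNge => ?); rewrite !maxEle; do ?(case: ifPn; rewrite -?ltNge => ?); lra.
Qed.

Lemma clamp_le a b u : a <= b -> u <= a -> clamp a b u = a.
Proof.
move=> ab bu; rewrite /clamp !minEle.
by do ?(case: ifPn; rewrite -?ltNge => ?); rewrite !maxEle; do ?(case: ifPn; rewrite -?ltNge => ?); lra.
Qed.

End lipschitz_class.

Lemma odd_alternant_refl (R : realType) n (v : 'I_n * 'I_n) (x : 'I_n -> R) :
  odd_alternant (wall_refl v x) = - odd_alternant x.
Proof.
rewrite /odd_alternant.
have -> : \matrix_(i < n, j < n) wall_refl v x j ^+ (i.*2).+1 =
    (\matrix_(i < n, j < n) x j ^+ (i.*2).+1) *m perm_mx (tperm v.1 v.2) *m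
    diag_mx (\row_j (-1) ^+ wall_sign v j).
  apply/matrixP => i j; rewrite mul_mx_diag -{1}(tpermV v.1 v.2) -col_permE !mxE.
  rewrite /wall_refl exprMn mulrC; congr (_ * _).
  by case: (wall_sign v j); rewrite ?expr1n// expr1 exprS -mul2n exprM sqrrN !expr1n mulr1.
rewrite !det_mulmx det_perm det_diag odd_tperm /wall_sign.
under eq_bigr do rewrite mxE.
rewrite -mulrA -[RHS]mulrN1; congr (_ * _); have [->|ij] /= := eqVneq v.1 v.2.
  rewrite mul1r (bigD1 v.2)//= eqxx big1 ?mulr1// => j /negbTE ->.
  by rewrite expr0.
by rewrite big1 ?mulr1.
Qed.

(** In the chamber every factor [x j ^+ 2 - x i ^+ 2] with [i < j] is negative, so V has a constant
    sign there; taking a product of two values avoids computing it. *)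
Lemma odd_alternant_sign (R : realType) n (x y : 'I_n -> R) :
  chamber x -> chamber y -> 0 < odd_alternant x * odd_alternant y.
Proof.
have pos z : chamber z -> forall i, 0 < z i.
  by move=> /[swap] i /(_ (i, i)); rewrite /wall_form/= eqxx.
have dec z : chamber z -> forall i j : 'I_n, (i < j)%N -> z j < z i.
  move=> cz i j ij; have := cz (i, j); rewrite /wall_form/= ij.
  by rewrite (negbTE (_ : i != j)) ?subr_gt0// neq_ltn ij.
move=> cx cy; rewrite !odd_alternantE mulrACA; apply: mulr_gt0; last first.
  by apply: mulr_gt0; apply: prodr_gt0 => i _; exact: pos.
rewrite -big_split/=; apply: prodr_gt0 => i _; rewrite -big_split/=; apply: prodr_gt0 => j ij.
have sq z : chamber z -> z j ^+ 2 < z i ^+ 2.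
  by move=> cz; rewrite ltr_pXn2r ?nnegrE ?dec// ltW// pos.
by rewrite nmulr_rgt0 subr_lt0 sq.
Qed.

Lemma pt_measurable_odd_alternant (R : realType) n : pt_measurable (@odd_alternant R n).
Proof.
rewrite /pt_measurable /odd_alternant /determinant.
apply: measurable_sum => s; apply: measurable_funM => //.
apply: measurable_prod => i _ /=.
rewrite (_ : (fun _ => _) = fun v => tuple_fun v (s i) ^+ (i.*2).+1).
  by apply: measurable_funX; exact: pt_measurable_coord.
by apply/funext => v; rewrite mxE.
Qed.

Section survival_radial.
Context (R : realType) (n : nat).
Variable eta : 'I_n -> R.

(** Coordinates are clamped before they enter polynomials, which makes these bounded and Lipschitz;
    the clamping interval is symmetric so that [cut] commutes with the reflections. *)
Let cut (k : nat) (x : 'I_n -> R) : 'I_n -> R := fun i => clamp (- k%:R) k%:R (x i).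

(* Bounded Lipschitz antisymmetric approximation of
   [x |-> \1_(|x| < r) * sgn (V eta * V x)]. *)
Let test (r : R) (k : nat) (x : 'I_n -> R) : R :=
  clamp 0 1 (k%:R * (r ^+ 2 - \sum_i cut k x i ^+ 2)) *
  clamp (-1) 1 (k%:R * (odd_alternant eta * odd_alternant (cut k x))).

Let test_lipschitz r k : bounded_lipschitz (test r k).
Proof.
have cutb i : bounded_lipschitz (fun x => cut k x i) by exact: bounded_lipschitz_coord.
apply: bounded_lipschitzM; apply: bounded_lipschitz_clamp.
  apply: bounded_lipschitzM; first exact: bounded_lipschitz_cst.
  apply: bounded_lipschitzD; first exact: bounded_lipschitz_cst.
  under eq_fun do rewrite -mulN1r.
  apply: bounded_lipschitzM; first exact: bounded_lipschitz_cst.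
  by apply: bounded_lipschitz_sum => i; exact: bounded_lipschitzX.
apply: bounded_lipschitzM; first exact: bounded_lipschitz_cst.
apply: bounded_lipschitzM; first exact: bounded_lipschitz_cst.
rewrite /odd_alternant /determinant.
apply: bounded_lipschitz_sum => s; apply: bounded_lipschitzM; first exact: bounded_lipschitz_cst.
apply: bounded_lipschitz_prod => i.
by under eq_fun do rewrite mxE; exact: bounded_lipschitzX.
Qed.

Let cut_refl k v x : cut k (wall_refl v x) = wall_refl v (cut k x).
Proof.
apply/funext => i; rewrite /cut /wall_refl; case: (wall_sign v i); last by rewrite !mul1r.
by rewrite expr1 !mulN1r clampN.
Qed.

Lemma sum_sqr_refl v (x : 'I_n -> R) : \sum_i wall_refl v x i ^+ 2 = \sum_i x i ^+ 2.
Proof.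
rewrite [RHS](reindex_inj (@perm_inj _ (tperm v.1 v.2)))/=; apply: eq_bigr => i _.
by rewrite /wall_refl exprMn sqrr_sign mul1r.
Qed.

Let test_refl r k v x : test r k (wall_refl v x) = - test r k x.
Proof. by rewrite /test cut_refl sum_sqr_refl odd_alternant_refl !mulrN clampN// mulrN. Qed.

Let test_bound r k x : `|test r k x| <= 1.
Proof.
rewrite /test normrM -[leRHS]mulr1; apply: ler_pM => //.
  by rewrite (le_trans (clamp_bound _ _ _))// normr0 add0r normr1.
rewrite /clamp ler_norml minEle.
by do ?(case: ifPn; rewrite -?ltNge => ?); rewrite maxEle; do ?(case: ifPn; rewrite -?ltNge => ?);
  apply/andP; split; lra.
Qed.

Let big_mul (u c : R) : 0 < u -> \forall k \near \oo, c <= k%:R * u.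
Proof.
move=> u0; exists (Num.truncn (c / u)).+1 => // k /= ck.
by rewrite -ler_pdivrMr// (le_trans (ltW (truncnS_gt _)))// ler_nat.
Qed.

Definition alternant_sign (x : 'I_n -> R) : R := Num.sg (odd_alternant eta * odd_alternant x).

Let cut_id x : \forall k \near \oo, cut k x = x.
Proof.
exists (Num.truncn (\sum_i `|x i|)).+1 => // k /= xk; apply/funext => i; rewrite /cut clamp_id//.
rewrite -ler_norml (@le_trans _ _ (\sum_i `|x i|))//.
  by rewrite (bigD1 i)//= lerDl sumr_ge0.
by rewrite (le_trans (ltW (truncnS_gt _)))// ler_nat.
Qed.

Let clamp_sg (u : R) : \forall k \near \oo, clamp (-1) 1 (k%:R * u) = Num.sg u.
Proof.
have [u0|u0|->] := ltgtP u 0; last first.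
- by apply: nearW => k; rewrite mulr0 sgr0 clamp_id//; apply/andP; split; lra.
- have := @big_mul u 1 u0; apply: filterS => k ku; rewrite gtr0_sg// clamp_ge//; lra.
have u0' : 0 < - u by rewrite oppr_gt0.
have := @big_mul (- u) 1 u0'; apply: filterS => k ku; rewrite ltr0_sg// clamp_le//; lra.
Qed.

Let clamp_pos (u : R) : \forall k \near \oo, clamp 0 1 (k%:R * u) = (0 < u)%R%:R.
Proof.
have [u0|u0] := ltP 0 u; last first.
  apply: nearW => k; rewrite clamp_le// mulr_ge0_le0//.
have := @big_mul u 1 u0; apply: filterS => k ku; rewrite clamp_ge//.
Qed.

(** For fixed [x] the sequence is eventually constant. When |x| = r the first factor is 0 as soon as
    the cut is inactive, hence the open ray. *)
Let test_cvg r x : 0 < r ->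
  (test r)^~ x @ \oo --> \1_(`]-oo, r[%classic) (pnorm x) * alternant_sign x.
Proof.
move=> r0; apply: cvg_near_cst.
have H1 := cut_id x; have H2 := clamp_sg (odd_alternant eta * odd_alternant x).
have H3 := clamp_pos (r ^+ 2 - \sum_i x i ^+ 2).
near=> k; rewrite /test.
have -> : cut k x = x by near: k.
have -> : clamp (-1) 1 (k%:R * (odd_alternant eta * odd_alternant x)) = alternant_sign x by near: k.
have -> : clamp 0 1 (k%:R * (r ^+ 2 - \sum_i x i ^+ 2)) = (0 < r ^+ 2 - \sum_i x i ^+ 2)%R%:R by near: k.
rewrite indicE mem_setE in_itv/= -sqr_pnorm subr_gt0.
by rewrite ltr_pXn2r// nnegrE ?pnorm_ge0// ltW.
Unshelve. all: by end_near. Qed.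

Context d (T : measurableType d) (P : probability T R).
Variables (X : 'I_n -> R -> T -> R) (t : R).
Hypotheses (bmX : bm_process P X eta) (t0 : 0 < t) (n0 : (0 < n)%N).
Hypothesis eta_chamber : chamber eta.

Local Notation surv := (survives X t).
Let rad w := pnorm (fun i => X i t w).
Let sgX w := alternant_sign (fun i => X i t w).

Let mX i : measurable_fun setT (X i t). Proof. by case: bmX. Qed.

Let mrad : measurable_fun setT rad.
Proof. exact: (pt_measurable_comp (@pt_measurable_pnorm R _) mX). Qed.

Let test_killed r k : measurable surv /\
  \int[P]_w (test r k (fun i => X i t w) * (1 - \1_surv w)) = 0.
Proof.
have [mtest [M [L [L0 testM testL]]]] := test_lipschitz r k.
apply: (@killed_integral _ _ _ P n X eta t bmX t0 n0 (test r k) M L) => //.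
move=> x y e xy; apply: testL => //.
exact: le_trans (xy (Ordinal n0)).
Qed.

Lemma measurable_survives : measurable surv. Proof. exact: (test_killed 0 0).1. Qed.

Let msgX : measurable_fun setT sgX.
Proof.
rewrite /sgX /alternant_sign.
have mV : measurable_fun setT (fun w => odd_alternant eta * odd_alternant (fun i => X i t w)).
  by apply: measurable_funM => //; exact: (pt_measurable_comp (@pt_measurable_odd_alternant R n) mX).
rewrite (_ : (fun w => _) = fun w => \1_(`]0, +oo[%classic) (odd_alternant eta * odd_alternant (fun i => X i t w))
   - \1_(`]-oo, 0[%classic) (odd_alternant eta * odd_alternant (fun i => X i t w))).
  by apply: measurable_funB; apply: measurableT_comp.
apply/funext => w; rewrite !indicE !mem_setE !in_itv/= andbT.
by case: sgrP => _; rewrite ?subr0 ?sub0r.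
Qed.

Let sgX_bound w : `|sgX w| <= 1.
Proof. by rewrite /sgX /alternant_sign normr_sg; case: (_ != 0). Qed.

Let sg_surv w : surv w -> sgX w = 1.
Proof.
move=> Sw; rewrite /sgX /alternant_sign gtr0_sg// odd_alternant_sign//.
by apply: Sw; rewrite lexx ltW.
Qed.

Let mS := measurable_survives.

(** On survival the sign is 1, and off survival the signed integral is the limit of the vanishing
    integrals of [test_killed]. *)
Let ray_eq r : \int[P]_w (\1_(`]-oo, r[%classic) (rad w) * \1_surv w) =
  \int[P]_w (\1_(`]-oo, r[%classic) (rad w) * sgX w).
Proof.
have [r0|r0] := leP r 0.
  apply: eq_Rintegral => w _; rewrite indicE mem_setE in_itv/= ltNge (le_trans r0) ?pnorm_ge0//.
  by rewrite !mul0r.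
have mI : measurable_fun setT (fun w => \1_(`]-oo, r[%classic) (rad w) : R) by exact: measurableT_comp.
have mIS : measurable_fun setT (\1_surv : T -> R) by exact: measurable_indic.
have I1 w : `|\1_(`]-oo, r[%classic) (rad w) : R| <= 1.
  by rewrite indicE; case: (_ \in _); rewrite ?normr0 ?normr1.
have S1 w : `|\1_surv w : R| <= 1 by rewrite indicE; case: (_ \in _); rewrite ?normr0 ?normr1.
have S1' w : `|1 - \1_surv w : R| <= 1.
  by rewrite indicE; case: (_ \in _); rewrite ?subrr ?subr0 ?normr0 ?normr1.
have [_ C] : measurable_fun setT (fun w => \1_(`]-oo, r[%classic) (rad w) * sgX w * (1 - \1_surv w)) /\
   \int[P]_w (test r k (fun i => X i t w) * (1 - \1_surv w)) @[k --> \oo] -->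
   \int[P]_w (\1_(`]-oo, r[%classic) (rad w) * sgX w * (1 - \1_surv w)).
  apply: (@bounded_cvg_Rintegral _ _ _ P _ _ 1).
  - move=> k; apply: measurable_funM; last exact: measurable_funB.
    exact: (pt_measurable_comp (test_lipschitz r k).1 mX).
  - by move=> k w; rewrite normrM -[leRHS]mulr1; apply: ler_pM.
  - by move=> w; apply: cvgM; [exact: test_cvg|exact: cvg_cst].
have Z : \int[P]_w (\1_(`]-oo, r[%classic) (rad w) * sgX w * (1 - \1_surv w)) = 0.
  apply: (cvg_unique _ C) => //=; rewrite (_ : (fun k => _) = cst 0); first exact: cvg_cst.
  by apply/funext => k; rewrite (test_killed r k).2.
apply/esym/eqP; rewrite -subr_eq0 -RintegralB//.
- rewrite -[X in _ == X]Z; apply/eqP/eq_Rintegral => w _.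
  rewrite [\1_surv w]indicE; case: (boolP (w \in surv)) => [/set_mem/sg_surv ->|_]; last first.
    by rewrite mulr0 !subr0 mulr1.
  by rewrite !mulr1 !subrr mulr0.
- apply: (@bounded_integrable _ _ _ _ _ 1); first exact: measurable_funM.
  by move=> w; rewrite normrM -[leRHS]mulr1; apply: ler_pM.
- apply: (@bounded_integrable _ _ _ _ _ 1); first exact: measurable_funM.
  by move=> w; rewrite normrM -[leRHS]mulr1; apply: ler_pM.
Qed.

(** Open rays determine a measure, but the sign makes one side a signed measure. Moving the negative
    part of the sign across gives the two nonnegative weights [up] and [down], to which uniqueness
    applies. *)
Lemma survival_radial (A : set R) : measurable A ->
  \int[P]_w (\1_A (rad w) * \1_surv w) = \int[P]_w (\1_A (rad w) * sgX w).
Proof.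
move=> mA.
have mrad' : measurable_fun setT (rad : T -> measurableTypeR R) by exact: mrad.
pose up w : R := \1_surv w + Num.max 0 (- sgX w).
pose down w := Num.max 0 (sgX w).
have up0 w : 0 <= up w by rewrite /up addr_ge0// le_max lexx.
have down0 w : 0 <= down w by rewrite /down le_max lexx.
have mup : measurable_fun setT up.
  apply: measurable_funD; first exact: measurable_indic.
  by apply: measurable_maxr => //; exact: measurableT_comp.
have mdown : measurable_fun setT down by exact: measurable_maxr.
have updown w : up w - down w = \1_surv w - sgX w.
  rewrite /up /down -[in RHS](opprK (sgX w)) !maxEle.
  by do ?(case: ifPn; rewrite -?ltNge => ?); lra.
have upM w : `|up w| <= 2.
  rewrite ger0_norm// /up; have := sgX_bound w; rewrite ler_norml => /andP[h1 h2].
  have : (\1_surv w : R) <= 1 by rewrite indicE; case: (_ \in _).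
  by rewrite maxEle; do ?(case: ifPn; rewrite -?ltNge => ?); lra.
have downM w : `|down w| <= 2.
  rewrite ger0_norm// /down; have := sgX_bound w; rewrite ler_norml => /andP[h1 h2].
  by rewrite maxEle; do ?(case: ifPn; rewrite -?ltNge => ?); lra.
have I1 (B : set R) w : `|\1_B (rad w) : R| <= 1.
  by rewrite indicE; case: (_ \in _); rewrite ?normr0 ?normr1.
have mI (B : set R) : measurable B -> measurable_fun setT (fun w => \1_B (rad w) : R).
  by move=> mB; apply: measurableT_comp => //; exact: measurable_indic.
have intI (B : set R) (f : T -> R) (M : R) : measurable B -> measurable_fun setT f ->
    (forall w, `|f w| <= M) -> P.-integrable setT (EFin \o (fun w => \1_B (rad w) * f w)).
  move=> mB mf fM; apply: (@bounded_integrable _ _ _ _ _ M).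
    by apply: measurable_funM => //; exact: mI.
  by move=> w; rewrite normrM -[leRHS]mul1r; apply: ler_pM.
have S1 w : `|\1_surv w : R| <= 1 by rewrite indicE; case: (_ \in _); rewrite ?normr0 ?normr1.
have mS' : measurable_fun setT (\1_surv : T -> R) by exact: measurable_indic.
have key (B : set R) : measurable B ->
    (\int[P]_w (\1_B (rad w) * \1_surv w) = \int[P]_w (\1_B (rad w) * sgX w)) <->
    (\int[P]_w (\1_B (rad w) * up w) = \int[P]_w (\1_B (rad w) * down w)).
  move=> mB.
  have E : \int[P]_w (\1_B (rad w) * up w) - \int[P]_w (\1_B (rad w) * down w) =
      \int[P]_w (\1_B (rad w) * \1_surv w) - \int[P]_w (\1_B (rad w) * sgX w).
    rewrite -RintegralB//; [|exact: intI upM|exact: intI downM].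
    rewrite -RintegralB//; [|exact: intI S1|exact: intI sgX_bound].
    by apply: eq_Rintegral => w _; rewrite -!mulrBr updown.
  by split=> H; apply/eqP; rewrite -subr_eq0; [rewrite E H subrr|rewrite -E H subrr].
apply/key => //.
pose m1 : {measure set (measurableTypeR R) -> \bar R} := pushm (density_measure P up0 mup) mrad'.
pose m2 : {measure set (measurableTypeR R) -> \bar R} := pushm (density_measure P down0 mdown) mrad'.
have mE (f : T -> R) (f0 : forall w, 0 <= f w) (mf : measurable_fun setT f) (B : set R) (M : R) :
    measurable B -> (forall w, `|f w| <= M) ->
    pushm (density_measure P f0 mf) mrad' B = (\int[P]_w (\1_B (rad w) * f w))%:E.
  move=> mB fM; rewrite /Rintegral fineK; last first.
    by apply: integrable_fin_num => //; exact: intI fM.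
  transitivity (\int[P]_(w in rad @^-1` B) (f w)%:E)%E => //.
  rewrite [LHS]integral_mkcond; apply: eq_integral => w _; rewrite patchE indicE.
  have -> : (w \in rad @^-1` B) = (rad w \in B) by apply/idP/idP; rewrite !inE.
  by case: ifP; rewrite ?mul1r ?mul0r.
have H : m1 A = m2 A.
  apply: measure_unique_ray mA => r.
    rewrite /m1 /m2 (mE _ _ _ _ 2)// (mE _ _ _ _ 2)//; congr EFin.
    by apply/key => //; exact: ray_eq.
  by rewrite /m1 (mE _ _ _ _ 2)// ltry.
by move: H; rewrite /m1 /m2 (mE _ _ _ _ 2)// (mE _ _ _ _ 2)// => -[].
Qed.

End survival_radial.

(** * Gaussian averages over the Weyl group *)

Lemma indep_comp (R : realType) (I : finType) d (T : measurableType d)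
    (P : probability T R) (X : I -> T -> R) (g : I -> R -> R) :
  mutually_independent P X -> (forall i, measurable_fun setT (g i)) ->
  mutually_independent P (fun i w => g i (X i w)).
Proof.
move=> iX mg A mA; apply: (iX (fun i => g i @^-1` A i)) => i.
by rewrite -[_ @^-1` _]setTI; exact: mg.
Qed.

Lemma has_normal_law_affine d (T : measurableType d) (R : realType)
    (P : probability T R) (X : T -> R) (b c m s : R) : 0 < b -> 0 < s ->
  has_normal_law P X m s ->
  has_normal_law P (fun w => b * X w + c) (b * m + c) (b * s).
Proof.
move=> b0 s0 lX A mA; rewrite -(normal_prob_affine c m b0 s0 mA) -lX//.
rewrite -[_ @^-1` _]setTI; apply: measurable_funD => //; exact: measurable_funM.
Qed.

Lemma RintegralT_sum d (T : measurableType d) (R : realType) (P : probability T R)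
    (I : Type) (s : seq I) (f : I -> T -> R) :
  (forall i, P.-integrable setT (EFin \o f i)) ->
  P.-integrable setT (EFin \o (fun w => \sum_(i <- s) f i w)) /\
  \int[P]_w (\sum_(i <- s) f i w) = \sum_(i <- s) \int[P]_w f i w.
Proof.
move=> fi; elim: s => [|i s [IHi IHs]].
  rewrite big_nil (_ : (fun w => _) = cst 0); last by apply/funext => w; rewrite big_nil.
  by split; [exact: finite_measure_integrable_cst|exact: Rintegral_probability_cst].
rewrite (_ : (fun w => _) = (fun w => f i w + \sum_(j <- s) f j w)); last first.
  by apply/funext => w; rewrite big_cons.
split; last by rewrite RintegralD// IHs big_cons.
exact: (integrableD measurableT (fi i) IHi).
Qed.

Section gauss_real.
Context (R : realType) (I : finType).
Context d (T : measurableType d) (P : probability T R) (Z : I -> T -> R).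
Hypothesis stdZ : std_gaussian P Z.

Lemma gauss_tilt_real d' (T' : measurableType d') (Q : probability T' R) (Y : I -> T' -> R)
    (a : I -> R) (F : (I -> R) -> R) :
  (forall i, measurable_fun setT (Y i)) -> mutually_independent Q Y ->
  (forall i, has_normal_law Q (Y i) (a i) 1) -> pt_measurable F ->
  \int[Q]_w F (Y^~ w) =
  \int[P]_w (F (Z^~ w) * expR (\sum_i (a i * Z i w - a i ^+ 2 / 2))).
Proof.
move=> mY iY lY mF; have [mZ iZ lZ] := stdZ.
have key (G : (I -> R) -> R) : (forall x, 0 <= G x) -> pt_measurable G ->
    (\int[Q]_w (G (Y^~ w))%:E =
     \int[P]_w (G (Z^~ w) * expR (\sum_i (a i * Z i w - a i ^+ 2 / 2)))%:E)%E.
  move=> G0 mG; rewrite (@gauss_tilt _ _ _ _ P Z _ _ Q Y a 1 (EFin \o G)) ?ltr01//.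
  - apply: eq_integral => w _; rewrite -EFinM; congr (_ * _)%:E.
    by rewrite expR_sum; apply: eq_bigr => i _; rewrite normal_ratio_mean.
  - exact/measurable_EFinP.
rewrite /Rintegral integralE [in RHS]integralE; congr (fine (_ - _)).
  under eq_integral do rewrite funeposE -EFin_max.
  rewrite (key (fun x => Num.max (F x) 0)); last 2 first.
  - by move=> x; rewrite le_max lexx orbT.
  - exact: measurable_maxr.
  apply: eq_integral => w _; rewrite funeposE -EFin_max; congr EFin.
  by rewrite maxr_pMl ?expR_ge0// mul0r.
under eq_integral do rewrite funenegE -EFinN -EFin_max.
rewrite (key (fun x => Num.max (- F x) 0)); last 2 first.
- by move=> x; rewrite le_max lexx orbT.
- by apply: measurable_maxr => //; exact: measurableT_comp.
apply: eq_integral => w _; rewrite funenegE -EFinN -EFin_max; congr EFin.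
by rewrite maxr_pMl ?expR_ge0// mul0r mulNr.
Qed.

Lemma std_gaussian_signed_perm (s : {perm I}) (e : I -> bool) :
  std_gaussian P (fun i w => (-1) ^+ e i * Z (s i) w).
Proof.
have [mZ iZ lZ] := stdZ; split.
- by move=> i; exact: measurable_funM.
- exact: indep_signed_perm.
move=> i A mA; case: (e i); last first.
  by rewrite expr0; under eq_fun do rewrite mul1r; exact: lZ.
rewrite expr1; under eq_fun do rewrite mulN1r.
have mNA : measurable (-%R @^-1` A : set R).
  by rewrite -[_ @^-1` _]setTI; exact: (@oppr_measurable R setT).
by rewrite (lZ (s i) _ mNA) normal_probN// oner_neq0.
Qed.

Lemma std_gaussian_invariant d' (T' : measurableType d') (Q : probability T' R) (Y : I -> T' -> R)
   (F : (I -> R) -> R) :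
  std_gaussian Q Y -> pt_measurable F -> \int[Q]_w F (Y^~ w) = \int[P]_w F (Z^~ w).
Proof.
move=> [mY iY lY] mF; have [mZ iZ lZ] := stdZ; rewrite /Rintegral; congr fine.
apply: (@eq_law_integral _ _ _ _ P Z _ _ Q Y _ _ _ _ _ (EFin \o F)) => //.
- by move=> i A mA; rewrite lZ// lY.
- exact/measurable_EFinP.
Qed.

(** The shifted vector [Y] has total mass 1; its tilt identity for the constant function
    exp(|a|^2/2) reads E[exp(a.Z)] = exp(|a|^2/2). *)
Lemma exp_linear_integrable (a : I -> R) :
  P.-integrable setT (EFin \o (fun w => expR (\sum_i a i * Z i w))).
Proof.
have [mZ iZ lZ] := stdZ.
have mE : measurable_fun setT (fun w => expR (\sum_i a i * Z i w)).
  apply: measurableT_comp => //; apply: measurable_sum => i; exact: measurable_funM.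
apply/integrableP; split; first exact/measurable_EFinP.
under eq_integral do rewrite /= ger0_norm ?expR_ge0//.
pose Y i w := 1 * Z i w + a i.
have iY : mutually_independent P Y.
  apply: (indep_comp (g := fun i x => 1 * x + a i) iZ) => i.
  by apply: measurable_funD => //; exact: measurable_funM.
have mY i : measurable_fun setT (Y i).
  by apply: measurable_funD => //; exact: measurable_funM.
have lY i : has_normal_law P (Y i) (a i) 1.
  have := has_normal_law_affine (a i) ltr01 ltr01 (lZ i).
  by rewrite mulr0 add0r mulr1.
have := @gauss_tilt _ _ _ _ P Z _ _ P Y a 1 (cst (expR (\sum_i a i ^+ 2 / 2))%:E) ltr01 mZ mY iZ iY lZ lY.
move=> H; rewrite (_ : \int[P]_x _ = \int[P]_w (cst (expR (\sum_i a i ^+ 2 / 2))%:E w))%E.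
  by rewrite integral_cst//= probability_setT mule1 ltry.
rewrite H; last 2 first.
- by move=> x; rewrite lee_fin expR_ge0.
- exact: measurable_cst.
apply: eq_integral => w _; rewrite -EFinM; congr EFin.
under [X in _ * X]eq_bigr do rewrite normal_ratio_mean.
by rewrite -expR_sum -expRD sumrB addrC subrK.
Qed.

End gauss_real.

Section symmetrise.
Context (R : realType) (n : nat).
Context d (T : measurableType d) (P : probability T R) (Z : 'I_n -> T -> R).
Hypothesis stdZ : std_gaussian P Z.

Lemma odd_alternant_signed_perm (s : 'S_n) (e : 'I_n -> bool) (x : 'I_n -> R) :
  odd_alternant (fun i => (-1) ^+ e i * x (s i)) =
  (-1) ^+ s * (\prod_i (-1) ^+ e i) * odd_alternant x.
Proof.
rewrite /odd_alternant.
have -> : \matrix_(i < n, j < n) ((-1) ^+ e j * x (s j)) ^+ (i.*2).+1 =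
    (\matrix_(i < n, j < n) x j ^+ (i.*2).+1) *m perm_mx s^-1%g *m
    diag_mx (\row_j (-1) ^+ e j).
  apply/matrixP => i j; rewrite mul_mx_diag -col_permE !mxE.
  rewrite exprMn mulrC; congr (_ * _).
  by case: (e j); rewrite ?expr1n// expr1 exprS -mul2n exprM sqrrN !expr1n mulr1.
rewrite !det_mulmx det_perm det_diag odd_permV.
under eq_bigr do rewrite mxE.
by rewrite -mulrA mulrC.
Qed.

Variables (eta a : 'I_n -> R) (h : ('I_n -> R) -> R).
Hypotheses (mh : pt_measurable h) (h1 : forall x, `|h x| <= 1).
Hypothesis hinv : forall (s : 'S_n) (e : 'I_n -> bool) x,
  h (fun i => (-1) ^+ e i * x (s i)) = h x.

Let f x := h x * alternant_sign eta x * expR (\sum_i a i * x i).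

Lemma pt_measurable_alternant_sign : pt_measurable (@alternant_sign R n eta).
Proof.
rewrite /pt_measurable /alternant_sign.
have mV : measurable_fun setT (fun v => odd_alternant eta * odd_alternant (@tuple_fun R 'I_n v)).
  by apply: measurable_funM => //; exact: pt_measurable_odd_alternant.
rewrite (_ : _ \o _ = fun v => \1_(`]0, +oo[%classic) (odd_alternant eta * odd_alternant (tuple_fun v))
   - \1_(`]-oo, 0[%classic) (odd_alternant eta * odd_alternant (tuple_fun v))).
  by apply: measurable_funB; apply: measurableT_comp.
apply/funext => v; rewrite !indicE !mem_setE !in_itv/= andbT.
by case: sgrP => _; rewrite ?subr0 ?sub0r.
Qed.

Let mf : pt_measurable f.
Proof.
apply: measurable_funM; first by apply: measurable_funM => //; exact: pt_measurable_alternant_sign.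
apply: measurableT_comp => //; apply: measurable_sum => i.
by apply: measurable_funM => //; exact: pt_measurable_coord.
Qed.

Let fi (Y : 'I_n -> T -> R) : std_gaussian P Y -> P.-integrable setT (EFin \o (fun w => f (Y^~ w))).
Proof.
move=> sY; apply: (@le_integrable _ _ _ P setT measurableT _ _ _ _ (exp_linear_integrable sY a)).
  by apply/measurable_EFinP; apply: (pt_measurable_comp mf); case: sY.
move=> w _ /=; rewrite lee_fin /f !normrM -[leRHS]mul1r; apply: ler_pM => //.
rewrite -[1]mulr1; apply: ler_pM => //.
by rewrite /alternant_sign normr_sg; case: (_ != 0).
Qed.

Let K w := h (Z^~ w) * alternant_sign eta (Z^~ w) * \det (sinh_mx a (Z^~ w)).

(** Each of the 2^n n! signed permutations preserves the law of [Z] and the function [h], and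
    multiplies the sign of V by its character. Summed against the exponential, the sign choices
    factor into 2 sinh per coordinate, and the permutations give the Leibniz expansion of the
    determinant. *)
Lemma symmetrise : [/\ P.-integrable setT (EFin \o (fun w => f (Z^~ w))),
  P.-integrable setT (EFin \o K) &
  \int[P]_w f (Z^~ w) = (n`!%:R)^-1 * \int[P]_w K w].
Proof.
pose tr (se : 'S_n * {ffun 'I_n -> bool}) i w := (-1) ^+ se.2 i * Z (se.1 i) w.
have trE se : \int[P]_w f ((tr se)^~ w) = \int[P]_w f (Z^~ w).
  apply: (std_gaussian_invariant stdZ) => //.
  exact: (std_gaussian_signed_perm stdZ se.1 se.2).
have [Si S] := @RintegralT_sum _ _ _ P _ (index_enum _) (fun se w => f ((tr se)^~ w))
  (fun se => fi (std_gaussian_signed_perm stdZ se.1 se.2)).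
have two0 : (2 : R) ^+ n != 0 by rewrite expf_neq0.
have fact0 : (n`!%:R : R) != 0 by rewrite pnatr_eq0 -lt0n fact_gt0.
pose SF w := \sum_(se : 'S_n * {ffun 'I_n -> bool}) f ((tr se)^~ w).
have KE w : K w = (2 ^+ n)^-1 * SF w.
  suff <- : 2 ^+ n * K w = SF w.
    by rewrite mulKf.
  rewrite /K /SF.
  rewrite -(pair_bigA _ (fun s e => f ((tr (s, e))^~ w)))/=.
  have fE (s : 'S_n) (e : {ffun 'I_n -> bool}) : f ((tr (s, e))^~ w) =
      h (Z^~ w) * alternant_sign eta (Z^~ w) *
      ((-1) ^+ s * \prod_i ((-1) ^+ e i * expR ((-1) ^+ e i * (a i * Z (s i) w)))).
    rewrite /f (hinv s e (Z^~ w)) /alternant_sign (odd_alternant_signed_perm s e (Z^~ w)).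
    rewrite -!mulrA; congr (_ * _).
    rewrite big_split/= -expR_sum.
    rewrite (_ : \prod_i (-1) ^+ e i = (-1) ^+ (\sum_i e i)%N); last by rewrite expr_sum.
    rewrite !sgrM !sgrX !sgrN1.
    rewrite (_ : \sum_(i < n) a i * tr (s, e) i w = \sum_(i < n) (-1) ^+ e i * (a i * Z (s i) w)).
      by move: (Num.sg _) (Num.sg _) (expR _) ((-1) ^+ _) ((-1) ^+ _) => u v c1 c2 c3; ring.
    by apply: eq_bigr => i _; rewrite mulrCA.
  under eq_bigr do under eq_bigr do rewrite fE.
  under eq_bigr do rewrite -mulr_sumr.
  rewrite -mulr_sumr mulrCA; congr (_ * _); rewrite /determinant mulr_sumr.
  apply: eq_bigr => s _; rewrite -mulr_sumr mulrCA; congr (_ * _).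
  rewrite -(bigA_distr_bigA (fun i (b : bool) => (-1) ^+ b * expR ((-1) ^+ b * (a i * Z (s i) w)))).
  rewrite -[n in 2 ^+ n]card_ord -prodr_const -big_split/=; apply: eq_bigr => i _.
  rewrite mxE big_bool/= expr1 expr0 !mulN1r !mul1r /sinhR mulrC divfK//.
  by rewrite addrC.
have Ki : P.-integrable setT (EFin \o K).
  rewrite (_ : EFin \o K = fun w => (((2 ^+ n)^-1)%:E *
    (EFin \o SF) w)%E).
    exact: integrableZl.
  by apply/funext => w /=; rewrite KE EFinM.
split=> //; first exact: fi.
under [in RHS]eq_Rintegral do rewrite KE.
rewrite RintegralZl// S (eq_bigr (fun=> \int[P]_w f (Z^~ w))) => [|se _]; last exact: trE.
rewrite sumr_const card_prod card_Sn card_ffun card_bool card_ord -[\int[_]_(_ in _) _ *+ _]mulr_natl.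
by rewrite natrM natrX (mulrC n`!%:R) -!mulrA mulKf// mulKf.
Qed.

End symmetrise.

Lemma sum_odd n : (\sum_(i < n) (i.*2).+1 = n ^ 2)%N.
Proof. by elim: n => [|n IHn]; rewrite ?big_ord0// big_ord_recr/= IHn; lia. Qed.

Lemma odd_alternantZ (R : realType) n (r : R) (x : 'I_n -> R) :
  odd_alternant (fun i => r * x i) = r ^+ (n ^ 2) * odd_alternant x.
Proof.
rewrite /odd_alternant.
have -> : \matrix_(i < n, j < n) (r * x j) ^+ (i.*2).+1 =
    diag_mx (\row_i r ^+ (i.*2).+1) *m (\matrix_(i < n, j < n) x j ^+ (i.*2).+1).
  by apply/matrixP => i j; rewrite mul_diag_mx !mxE exprMn.
rewrite det_mulmx det_diag; congr (_ * _).
under eq_bigr do rewrite mxE.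
by rewrite -expr_sum sum_odd.
Qed.

Lemma alternant_signZ (R : realType) n (eta x : 'I_n -> R) (r : R) : 0 < r ->
  alternant_sign eta (fun i => r * x i) = alternant_sign eta x.
Proof.
move=> r0; rewrite /alternant_sign odd_alternantZ mulrCA sgrM gtr0_sg ?mul1r//.
exact: exprn_gt0.
Qed.

Lemma sinh_mxZ (R : realType) n (a x : 'I_n -> R) (r : R) :
  sinh_mx (fun i => a i * r) x = sinh_mx a (fun i => r * x i).
Proof. by apply/matrixP => i j; rewrite !mxE mulrA. Qed.

Lemma pnorm_signed_perm (R : realType) n (s : 'S_n) (e : 'I_n -> bool) (x : 'I_n -> R) :
  pnorm (fun i => (-1) ^+ e i * x (s i)) = pnorm x.
Proof.
rewrite /pnorm; congr Num.sqrt; rewrite [RHS](reindex_inj (@perm_inj _ s))/=.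
by apply: eq_bigr => i _; rewrite exprMn sqrr_sign mul1r.
Qed.

(** Independence of the coordinates at time [t] is the independence of increments for the single
    interval from 0 to [t]. *)
Lemma bm_scaled (R : realType) d (T : measurableType d) (P : probability T R)
    n (X : 'I_n -> R -> T -> R) (eta : 'I_n -> R) (t : R) :
  bm_process P X eta -> 0 < t ->
  [/\ forall i, measurable_fun setT (fun w => (Num.sqrt t)^-1 * X i t w),
      mutually_independent P (fun i w => (Num.sqrt t)^-1 * X i t w) &
      forall i, has_normal_law P (fun w => (Num.sqrt t)^-1 * X i t w) (eta i * (Num.sqrt t)^-1) 1].
Proof.
move=> [mX X0 _ lX iX] t0.
have s0 : 0 < Num.sqrt t by rewrite sqrtr_gt0.
have XE i w : (Num.sqrt t)^-1 * X i t w =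
    (Num.sqrt t)^-1 * (X i t w - X i 0 w) + eta i * (Num.sqrt t)^-1.
  by rewrite X0 mulrBr (mulrC (eta i)) subrK.
split.
- by move=> i; exact: measurable_funM.
- have tk k : (k < 1)%N -> t * k%:R < t * k.+1%:R by rewrite ltr_pM2l// ltr_nat.
  have tk0 : 0 <= t * 0%:R by rewrite mulr0.
  have H := iX 1%N (fun k => t * k%:R) tk0 tk.
  have {}H : mutually_independent P (fun i w => X i t w - X i 0 w).
    move=> A mA; have := H (fun ik => A ik.1) (fun ik => mA _).
    rewrite -(pair_bigA _ (fun (i : 'I_n) (k : 'I_1) => fine (P ((fun w => X i (t * k.+1%:R) w - X i (t * k%:R) w) @^-1` A i))))/=.
    under [in RHS]eq_bigr do rewrite big_ord1 mulr1 mulr0.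
    move=> <-; congr (fine (P _)); apply/seteqP; split=> w /= Hw.
      by move=> [i k] _ /=; rewrite ord1 mulr1 mulr0; exact: Hw.
    by move=> i _; have := Hw (i, ord0) I; rewrite /= mulr1 mulr0.
  have := indep_comp (g := fun i x => (Num.sqrt t)^-1 * x + eta i * (Num.sqrt t)^-1) H.
  under [in X in _ -> X]eq_fun do under eq_fun do rewrite XE.
  apply => i; apply: measurable_funD => //; exact: measurable_funM.
- move=> i; have := lX i 0 t (lexx _) t0; rewrite subr0 => l.
  have s0' : 0 < (Num.sqrt t)^-1 by rewrite invr_gt0.
  have := has_normal_law_affine (eta i * (Num.sqrt t)^-1) s0' s0 l.
  rewrite mulr0 add0r mulVf; last exact: lt0r_neq0.
  by under [in X in _ -> X]eq_fun do rewrite XE.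
Qed.

Section survival_gaussian.
Context (R : realType) (n : nat) (eta : 'I_n -> R).
Context d (T : measurableType d) (P : probability T R) (X : 'I_n -> R -> T -> R) (t : R).
Hypotheses (bmX : bm_process P X eta) (t0 : 0 < t) (n0 : (0 < n)%N).
Hypothesis eta_chamber : chamber eta.
Context d' (T' : measurableType d') (Q : probability T' R) (Z : 'I_n -> T' -> R).
Hypothesis stdZ : std_gaussian Q Z.
Variable A : set R.
Hypothesis mA : measurable A.

Let st := Num.sqrt t.
Let K w := \1_A (st * pnorm (Z^~ w)) * alternant_sign eta (Z^~ w) *
  \det (sinh_mx eta (fun i => st^-1 * Z i w)).

Lemma survival_gaussian : Q.-integrable setT (EFin \o K) /\
  \int[P]_w (\1_A (pnorm (fun i => X i t w)) * \1_(survives X t) w) =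
  expR (- (pnorm eta ^+ 2 / (2 * t))) / n`!%:R * \int[Q]_w K w.
Proof.
have st0 : 0 < st by rewrite sqrtr_gt0.
have st2 : st ^+ 2 = t by rewrite sqr_sqrtr// ltW.
pose h (x : 'I_n -> R) : R := \1_A (st * pnorm x).
have mh : pt_measurable h.
  apply: measurableT_comp; first exact: measurable_indic.
  by apply: measurable_funM => //; exact: pt_measurable_pnorm.
have h1 x : `|h x| <= 1 by rewrite /h indicE; case: (_ \in _); rewrite ?normr0 ?normr1.
have hinv (s : 'S_n) (e : 'I_n -> bool) x : h (fun i => (-1) ^+ e i * x (s i)) = h x.
  by rewrite /h pnorm_signed_perm.
pose a i := eta i * st^-1.
have [fi Ki KE] := symmetrise stdZ eta a mh h1 hinv.
have KK : K = fun w => h (Z^~ w) * alternant_sign eta (Z^~ w) * \det (sinh_mx a (Z^~ w)).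
  by apply/funext => w; rewrite /K /h /a sinh_mxZ.
rewrite KK; split=> //.
rewrite (survival_radial bmX t0 n0 eta_chamber mA).
have [mY iY lY] := bm_scaled bmX t0.
pose F x := h x * alternant_sign eta x.
have mF : pt_measurable F by apply: measurable_funM => //; exact: pt_measurable_alternant_sign.
transitivity (\int[P]_w F (fun i => st^-1 * X i t w)).
  apply: eq_Rintegral => w _; rewrite /F /h pnormZ alternant_signZ ?invr_gt0//.
  by rewrite gtr0_norm ?invr_gt0// mulVKf// gt_eqF.
rewrite (gauss_tilt_real stdZ mY iY lY mF).
transitivity (\int[Q]_w (expR (- (pnorm eta ^+ 2 / (2 * t))) *
   (h (Z^~ w) * alternant_sign eta (Z^~ w) * expR (\sum_i a i * Z i w)))).
  apply: eq_Rintegral => w _; rewrite [RHS]mulrCA -expRD; congr (_ * expR _).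
  rewrite sumrB addrC; congr (_ + _); rewrite sqr_pnorm -sumrN mulr_suml -sumrN.
  apply: eq_bigr => i _; congr (- _); rewrite /a exprMn exprVn st2.
  by field; rewrite gt_eqF.
by rewrite (RintegralZl _ measurableT fi) KE mulrA.
Qed.

End survival_gaussian.

(** * Comparison with the free radial law *)

(** The case [h = 1], [k = 0] of [polar]; [m] is positive because the total mass is 1. *)
Lemma radial_law (R : realType) (I : finType) d (T : measurableType d)
    (P : probability T R) (Z : I -> T -> R) : (0 < #|I|)%N -> std_gaussian P Z ->
  exists2 m : R, 0 < m & forall F : R -> \bar R,
  (forall s, 0 <= F s)%E -> measurable_fun setT F ->
  (\int[P]_w F (pnorm (Z^~ w)) =
   \int[lebesgue_measure]_s (F s * (expR (- (s ^+ 2 / 2)) * (m * radial_weight #|I| s))%:E))%E.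
Proof.
move=> I0 stdZ.
have h0 (x : I -> R) : (0 : R) <= (fun=> 1) x by [].
have mh : pt_measurable (fun _ : I -> R => 1 : R) by exact: measurable_cst.
have hom r (x : I -> R) : 0 < r -> (1 : R) = r ^+ 0 * 1 by rewrite expr0 mulr1.
have hb (x : I -> R) : pnorm x < 1 -> (1 : R) <= 1 by [].
have dim : (0 < #|I| + 0)%N by rewrite addn0.
have [m m0] := polar stdZ h0 mh hom hb dim.
rewrite addn0 => mP.
have mF F : (forall s, 0 <= F s)%E -> measurable_fun setT F ->
  (\int[P]_w F (pnorm (Z^~ w)) =
   \int[lebesgue_measure]_s (F s * (expR (- (s ^+ 2 / 2)) * (m * radial_weight #|I| s))%:E))%E.
  by move=> F0 mF; rewrite -mP//; apply: eq_integral => w _; rewrite mule1.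
exists m => //; rewrite lt_neqAle m0 andbT; apply/negP => /eqP m00.
have := mF (cst 1%E) (fun=> lee01) (measurable_cst _).
have -> : (\int[P]_w cst 1%E (pnorm (Z^~ w)) = 1)%E.
  by transitivity (1%E * P setT)%E; [exact: integral_cst|rewrite mul1e probability_setT].
rewrite (eq_integral (cst 0%E)); last by move=> s _; rewrite -m00 mul0r mulr0 mule0.
by rewrite integral0 => /eqP; rewrite onee_eq0.
Qed.

Lemma normal_prob_itv_gt0 (R : realType) (a b : R) : 0 <= a -> a < b ->
  (0 < normal_prob 0 1 `]a, b[)%E.
Proof.
move=> a0 ab; apply: (@lt_le_trans _ _ (\int[lebesgue_measure]_(x in `]a, b[) (normal_pdf 0 1 b)%:E)%E).
  rewrite integral_cst//= lebesgue_measure_itv/= lte_fin ab -EFinD -EFinM lte_fin.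
  by rewrite mulr_gt0 ?subr_gt0// normal_pdf01_gt0// oner_eq0.
apply: ge0_le_integral => //.
- by move=> x _; rewrite lee_fin normal_pdf_ge0.
- by apply/measurable_EFinP; apply: measurable_funTS; exact: measurable_normal_pdf.
move=> x /=; rewrite in_itv/= => /andP[ax xb]; rewrite lee_fin.
rewrite !normal_pdfE ?oner_eq0// ler_pM2l ?normal_peak_gt0 ?oner_eq0//.
rewrite /normal_fun !subr0 ler_expR expr1n !mulNr lerN2.
have x0 : 0 <= x by rewrite (le_trans a0)// ltW.
by rewrite ler_pM2r ?invr_gt0// ler_pXn2r// ?nnegrE ?ltW// (le_lt_trans x0).
Qed.

Lemma odd_alternant_bound (R : realType) n (x : 'I_n -> R) : pnorm x < 1 ->
  `|odd_alternant x| <= #|'S_n|%:R.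
Proof.
move=> x1; have xi i : `|x i| <= 1 := le_trans (coord_le_pnorm x i) (ltW x1).
rewrite /odd_alternant /determinant (le_trans (ler_norm_sum _ _ _))//.
rewrite -sum1_card natr_sum; apply: ler_sum => s _.
rewrite normrM normrX normrN1 expr1n mul1r normr_prod.
by apply: prodr_ile1 => i _; rewrite normr_ge0 mxE normrX exprn_ile1.
Qed.

(** Otherwise V(Z) would vanish almost surely, while independence gives positive probability to a
    box on which V has no zero. *)
Lemma std_gaussian_alternant_neq0 (R : realType) n d (T : measurableType d)
    (P : probability T R) (Z : 'I_n -> T -> R) : std_gaussian P Z ->
  (\int[P]_w `|odd_alternant (Z^~ w)|%:E != 0)%E.
Proof.
move=> [mZ iZ lZ]; apply/negP => /eqP int0.
have mV : measurable_fun setT (fun w => odd_alternant (Z^~ w)).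
  exact: (pt_measurable_comp (@pt_measurable_odd_alternant R n) mZ).
have := @ae_eq_integral_abs _ _ _ P setT measurableT (EFin \o (fun w => odd_alternant (Z^~ w))).
move=> /(_ _)[|+ _]; first exact/measurable_EFinP.
move=> /(_ int0) V0.
(* The product of the [J i] is a box inside the chamber. *)
pose J (i : 'I_n) : set R := `](n - i.+1)%:R, (n - i)%:R[%classic.
pose E := \bigcap_(i in [set: 'I_n]) (Z i @^-1` J i).
have mE : measurable E.
  by apply: fin_bigcap_measurable => // i _; rewrite -[_ @^-1` _]setTI; apply: mZ => //; exact: measurable_itv.
have PE : fine (P E) = \prod_i fine (P (Z i @^-1` J i)).
  by apply: iZ => i; exact: measurable_itv.
have : 0 < fine (P E).
  rewrite PE; apply: prodr_gt0 => i _.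
  rewrite lZ; last exact: measurable_itv.
  rewrite fine_gt0// normal_prob_itv_gt0//; last by rewrite ltr_nat ltn_sub2l.
  rewrite andTb; apply: le_lt_trans (ltry 1).
  exact: (@probability_le1 _ (measurableTypeR R) R (normal_prob 0 1) (J i) (measurable_itv _)).
suff -> : P E = 0%E by rewrite ltxx.
apply: (measure_negligible mE).
apply: negligibleS V0 => w Ew /= V0; have {}V0 := V0 Logic.I.
have cZ : chamber (Z^~ w).
  have Zi (i : 'I_n) : (n - i.+1)%:R < Z i w < (n - i)%:R by have := Ew i Logic.I; rewrite /J/= in_itv/=.
  have pos (i : 'I_n) : 0 < Z i w by have /andP[+ _] := Zi i; exact: le_lt_trans.
  have dec (i j : 'I_n) : (i < j)%N -> Z j w < Z i w.
    move=> ij; have /andP[+ _] := Zi i; have /andP[_ +] := Zi j => h1 h2.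
    by rewrite (lt_trans h1)// (le_lt_trans _ h2)// ler_nat leq_sub2l.
  move=> [i j]; rewrite /wall_form/=; case: eqVneq => // ij.
  case: ltnP => h; rewrite subr_gt0 dec// ltn_neqAle h andbT eq_sym.
  exact: ij.
by have := odd_alternant_sign cZ cZ; move: V0 => -[->]; rewrite mul0r ltxx.
Qed.

(** Both sides have a density proportional to the same radial weight, so the unknown normalisations
    [m] and [m'] only enter through their quotient. *)
Lemma alternant_radial_law (R : realType) n d (T : measurableType d)
    (P : probability T R) (Z : 'I_n -> T -> R)
    d' (T' : measurableType d') (Q : probability T' R) (W : 'I_(n * n.+1) -> T' -> R) :
  (0 < n)%N -> std_gaussian P Z -> std_gaussian Q W ->
  exists2 c : R, 0 < c & forall F : R -> \bar R,
  (forall s, 0 <= F s)%E -> measurable_fun setT F ->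
  (\int[P]_w (F (pnorm (Z^~ w)) * `|odd_alternant (Z^~ w)|%:E) =
   c%:E * \int[Q]_w F (pnorm (W^~ w)))%E.
Proof.
move=> n0 stdZ stdW.
have mabs : pt_measurable (fun x : 'I_n -> R => `|odd_alternant x|).
  by apply: measurableT_comp => //; exact: pt_measurable_odd_alternant.
have hom r (x : 'I_n -> R) : 0 < r -> `|odd_alternant (fun i => r * x i)| = r ^+ (n ^ 2) * `|odd_alternant x|.
  by move=> r0; rewrite odd_alternantZ normrM ger0_norm// exprn_ge0// ltW.
have dim : (0 < #|'I_n| + n ^ 2)%N by rewrite card_ord addn_gt0 n0.
have [m m0 mP] := polar stdZ (fun x => normr_ge0 (odd_alternant x)) mabs hom (@odd_alternant_bound R n) dim.
have dimE : (#|'I_n| + n ^ 2 = #|'I_(n * n.+1)|)%N by rewrite !card_ord; lia.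
have dim' : (0 < #|'I_(n * n.+1)|)%N by rewrite -dimE.
have [m' m'0 mP'] := radial_law dim' stdW.
exists (m / m').
  rewrite divr_gt0// lt_neqAle m0 andbT; apply/negP => /eqP m00.
  have /negP := std_gaussian_alternant_neq0 stdZ; apply; apply/eqP.
  have := mP (cst 1%E) (fun=> lee01) (measurable_cst _).
  under eq_integral do rewrite mul1e.
  move=> ->; rewrite -[RHS](@integral0 _ _ _ (@lebesgue_measure R) setT); apply: eq_integral => s _.
  by rewrite -m00 mul0r mulr0 mule0.
move=> F F0 mF; rewrite mP// mP'// dimE -ge0_integralZl//; last 3 first.
- apply: emeasurable_funM => //; apply/measurable_EFinP; apply: measurable_funM; last first.
    by apply: measurable_funM => //; exact: measurable_radial_weight.
  apply: measurableT_comp => //; apply: measurableT_comp => //.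
  by apply: measurable_funM => //; exact: measurable_funX.
- move=> s _; rewrite mule_ge0// lee_fin.
  by rewrite mulr_ge0 ?expR_ge0// mulr_ge0 ?radial_weight_ge0// ltW.
- by rewrite lee_fin divr_ge0// ltW.
apply: eq_integral => s _; rewrite muleCA -EFinM; congr (_ * _%:E)%E.
by rewrite [RHS]mulrCA; congr (_ * _); rewrite [RHS]mulrA divfK// gt_eqF.
Qed.

(** The chi density with [N] degrees of freedom; its constant is kept as the inverse of an integral,
    which spares the gamma function and depends on [N] alone. *)
Definition radial_pdf (R : realType) (N : nat) (s : R) : R :=
  (fine (\int[lebesgue_measure]_x (expR (- (x ^+ 2 / 2)) * radial_weight N x)%:E))^-1 *
  (expR (- (s ^+ 2 / 2)) * radial_weight N s).

Lemma measurable_radial_factor (R : realType) N :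
  measurable_fun setT (fun s : R => expR (- (s ^+ 2 / 2)) * radial_weight N s).
Proof.
apply: measurable_funM; last exact: measurable_radial_weight.
apply: measurableT_comp => //; apply: measurableT_comp => //.
by apply: measurable_funM => //; exact: measurable_funX.
Qed.

Lemma measurable_radial_pdf (R : realType) N : measurable_fun setT (@radial_pdf R N).
Proof. by apply: measurable_funM => //; exact: measurable_radial_factor. Qed.

Lemma radial_pdf_ge0 (R : realType) N (s : R) : 0 <= radial_pdf N s.
Proof.
rewrite mulr_ge0//; last by rewrite mulr_ge0 ?expR_ge0 ?radial_weight_ge0.
rewrite invr_ge0 fine_ge0//.
by apply: integral_ge0 => x _; rewrite lee_fin mulr_ge0 ?expR_ge0 ?radial_weight_ge0.
Qed.

Section std_gaussian_radial.
Context (R : realType) (I : finType) d (T : measurableType d).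
Variables (P : probability T R) (Z : I -> T -> R).
Hypotheses (I0 : (0 < #|I|)%N) (stdZ : std_gaussian P Z).

Let mass : exists2 m : R, 0 < m &
  m = (fine (\int[lebesgue_measure]_x (expR (- (x ^+ 2 / 2)) * radial_weight #|I| x)%:E))^-1 /\
  forall F : R -> \bar R, (forall s, 0 <= F s)%E -> measurable_fun setT F ->
  (\int[P]_w F (pnorm (Z^~ w)) =
   \int[lebesgue_measure]_s (F s * (expR (- (s ^+ 2 / 2)) * (m * radial_weight #|I| s))%:E))%E.
Proof.
have [m m0 mP] := radial_law I0 stdZ; exists m => //; split=> //.
have := mP (cst 1%E) (fun=> lee01) (measurable_cst _).
have -> : (\int[P]_w cst 1%E (pnorm (Z^~ w)) = 1)%E.
  by transitivity (1%E * P setT)%E; [exact: integral_cst|rewrite mul1e probability_setT].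
set J := (X in (fine X)^-1) => J1.
have J0 : (0 <= J)%E.
  by apply: integral_ge0 => x _; rewrite lee_fin mulr_ge0 ?expR_ge0 ?radial_weight_ge0.
have : (m%:E * J = 1)%E.
  rewrite J1 /J -ge0_integralZl//.
  - by apply: eq_integral => x _; rewrite mul1e -EFinM mulrCA.
  - by apply/measurable_EFinP; exact: measurable_radial_factor.
  - by move=> x _; rewrite lee_fin mulr_ge0 ?expR_ge0 ?radial_weight_ge0.
  - by rewrite lee_fin ltW.
case: J J0 => [r||]// _; last by rewrite gt0_muley// lte_fin.
by rewrite -EFinM mulrC => -[mr] /=; rewrite (mulr1_eq mr).
Qed.

Lemma std_gaussian_radial (F : R -> \bar R) :
  (forall s, 0 <= F s)%E -> measurable_fun setT F ->
  (\int[P]_w F (pnorm (Z^~ w)) =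
   \int[lebesgue_measure]_s (F s * (radial_pdf #|I| s)%:E))%E.
Proof.
move=> F0 mF; have [m m0 [mE mP]] := mass.
rewrite mP//; apply: eq_integral => s _; congr (_ * _%:E)%E.
by rewrite /radial_pdf -mE mulrCA.
Qed.

Lemma radial_pdf_gt0 (s : R) : 0 < s -> 0 < radial_pdf #|I| s.
Proof.
move=> s0; have [m m0 [mE _]] := mass.
rewrite /radial_pdf -mE mulr_gt0// mulr_gt0 ?expR_gt0// /radial_weight indicE.
by rewrite mem_set ?mul1r ?mulr_gt0 ?ltr0n ?exprn_gt0//= in_itv/= s0.
Qed.

Lemma radial_density (s : R) (A : set R) : 0 < s -> measurable A ->
  P ((fun w => s * pnorm (Z^~ w)) @^-1` A) =
  (\int[lebesgue_measure]_(r in A) (s^-1 * radial_pdf #|I| (s^-1 * r))%:E)%E.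
Proof.
move=> s0 mA; have [mZ _ _] := stdZ.
have mn : measurable_fun setT (fun w => s * pnorm (Z^~ w)).
  by apply: measurable_funM => //; exact: (pt_measurable_comp (@pt_measurable_pnorm R I) mZ).
have mE : measurable ((fun w => s * pnorm (Z^~ w)) @^-1` A).
  by rewrite -[_ @^-1` _]setTI; exact: mn.
have ms : measurable_fun setT (fun x : R => \1_A (s * x) : R).
  by apply: measurableT_comp; [exact: measurable_indic|exact: measurable_funM].
have ms' : measurable_fun setT (fun x : R => radial_pdf #|I| (s^-1 * x)).
  by apply: measurableT_comp; [exact: measurable_radial_pdf|exact: measurable_funM].
transitivity (\int[P]_w (\1_A (s * pnorm (Z^~ w)))%:E)%E.
  by rewrite -(setIT (_ @^-1` A)) -integral_indic.
rewrite (@std_gaussian_radial (fun x => (\1_A (s * x))%:E)); last exact/measurable_EFinP.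
  2: by move=> x; rewrite lee_fin.
pose f (r : R) : \bar R := (\1_A r * radial_pdf #|I| (s^-1 * r))%:E.
transitivity (\int[lebesgue_measure]_x f (s * x + 0)%R)%E.
  by apply: eq_integral => x _; rewrite /f addr0 mulKf ?gt_eqF// EFinM.
have f0 r : (0 <= f r)%E by rewrite lee_fin mulr_ge0// radial_pdf_ge0.
have mf : measurable_fun setT f.
  by apply/measurable_EFinP; apply: measurable_funM => //; exact: measurable_indic.
rewrite ge0_integral_affine// -ge0_integralZl//; last by rewrite lee_fin invr_ge0 ltW.
rewrite [RHS]integral_mkcond; apply: eq_integral => r _; rewrite patchE /f indicE.
by case: (r \in A); rewrite ?mul1r// mul0r mule0.
Qed.

End std_gaussian_radial.

Lemma Rintegral_near d (T : measurableType d) (R : realType) (P : probability T R)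
    (K F : T -> R) (k q : R) :
  P.-integrable setT (EFin \o K) -> P.-integrable setT (EFin \o F) ->
  (forall w, `|K w - k * F w| <= q * F w) ->
  `|\int[P]_w K w - k * \int[P]_w F w| <= q * \int[P]_w F w.
Proof.
move=> iK iF KF.
have ikF r : P.-integrable setT (EFin \o (fun w => r * F w)).
  by rewrite (_ : _ \o _ = fun w => r%:E * (F w)%:E)%E; [exact: integrableZl|].
have iD : P.-integrable setT (EFin \o (fun w => K w - k * F w)).
  rewrite (_ : _ \o _ = fun w => (K w)%:E - (k * F w)%:E)%E//.
  exact: (integrableB measurableT iK (ikF k)).
rewrite -!RintegralZl// -RintegralB//.
apply: (le_trans (le_normr_Rintegral measurableT iD)).
apply: le_Rintegral => //.
exact: integrable_norm.
Qed.

Section survival_mass.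
Context (R : realType) (n : nat) (eta : 'I_n -> R).
Context d (T : measurableType d) (P : probability T R) (X : 'I_n -> R -> T -> R).
Hypotheses (bmX : bm_process P X eta) (n0 : (0 < n)%N) (eta_chamber : chamber eta).
Context d' (T' : measurableType d') (P' : probability T' R) (Z : 'I_n -> T' -> R).
Hypothesis stdZ : std_gaussian P' Z.
Context d'' (T'' : measurableType d'') (Q : probability T'' R).
Variable W : 'I_(n * n.+1) -> T'' -> R.
Hypothesis stdW : std_gaussian Q W.

Definition survival_mass (t : R) (A : set R) : R :=
  fine (P ((fun w => pnorm (fun i => X i t w)) @^-1` A `&` survives X t)).

Definition free_mass (t : R) (A : set R) : R :=
  fine (Q ((fun w => Num.sqrt t * pnorm (W^~ w)) @^-1` A)).

Let mpX t : measurable_fun setT (fun w => pnorm (fun i => X i t w)).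
Proof.
have [mX _ _ _ _] := bmX.
exact: (pt_measurable_comp (@pt_measurable_pnorm R _) (fun i => mX i t)).
Qed.

Let msurv t : 0 < t -> measurable (survives X t).
Proof. by move=> t0; exact: (measurable_survives bmX t0 n0 eta_chamber). Qed.

Lemma survival_massE t A : 0 < t -> measurable A -> survival_mass t A =
  \int[P]_w (\1_A (pnorm (fun i => X i t w)) * \1_(survives X t) w).
Proof.
move=> t0 mA; rewrite /survival_mass /Rintegral; congr fine.
rewrite -[in LHS](setIT (_ `&` _)) -integral_indic//; last first.
  by apply: measurableI; [rewrite -[_ @^-1` _]setTI; exact: mpX|exact: msurv].
apply: eq_integral => w _; rewrite !indicE; congr _%:E.
by rewrite in_setI -mulnb natrM.
Qed.

(** By [survival_gaussian] the mass is an integral over the event that sqrt(t)|Z| lies in [A], and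
    this event is null. This is the absolute continuity needed for Radon-Nikodym. *)
Lemma survival_mass_null t A : 0 < t -> measurable A ->
  lebesgue_measure A = 0%E -> survival_mass t A = 0.
Proof.
move=> t0 mA A0; rewrite survival_massE//.
have [iK ->] := survival_gaussian bmX t0 n0 eta_chamber stdZ mA.
set K := (fun w => _ * _ * _) in iK *.
have In : (0 < #|'I_n|)%N by rewrite card_ord.
have st0 : 0 < Num.sqrt t by rewrite sqrtr_gt0.
have PA : P' ((fun w => Num.sqrt t * pnorm (Z^~ w)) @^-1` A) = 0%E.
  rewrite radial_density//; apply: null_set_integral => //.
  apply/measurable_EFinP; apply: measurable_funTS; apply: measurable_funM => //.
  by apply: measurableT_comp; [exact: measurable_radial_pdf|exact: measurable_funM].
suff K0 : (\int[P']_w (K w)%:E = 0)%E by rewrite /Rintegral K0 mulr0.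
transitivity (\int[P']_w cst 0%E w)%E; last exact: integral0.
apply: ae_eq_integral => //; first exact: (measurable_int _ iK).
exists ((fun w => Num.sqrt t * pnorm (Z^~ w)) @^-1` A); split=> //.
  have [mZ _ _] := stdZ; rewrite -[_ @^-1` _]setTI.
  have mp : measurable_fun setT (fun w => Num.sqrt t * pnorm (Z^~ w)).
    by apply: measurable_funM => //; exact: (pt_measurable_comp (@pt_measurable_pnorm R _) mZ).
  exact: mp.
move=> w /=; apply: contra_notP => nA _; rewrite /K indicE memNset//=.
by rewrite !mul0r.
Qed.

(** Here [a] is the leading-order survival probability, of order t^(-n^2/2). The condition
    [r <= e * t] on [A] says that |Z|/sqrt(t) is at most [e] on the event, the range of
    [sinh_det_near]. Dividing its constant by |[sinh_const eta]| makes the error relative. *)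
Lemma survival_mass_near : exists2 C : R, 0 <= C & exists2 b : R, 0 < b &
  forall (t e : R) (A : set R), 0 < t -> 0 <= e -> e <= 2^-1 -> measurable A -> (forall r, A r -> r <= e * t) ->
  forall a, a = expR (- (pnorm eta ^+ 2 / (2 * t))) * b * (Num.sqrt t)^-1 ^+ (n ^ 2) ->
  `|survival_mass t A - a * free_mass t A| <= C * e * (a * free_mass t A).
Proof.
have [c c0 cP] := alternant_radial_law n0 stdZ stdW.
have [C C0 CP] := sinh_det_near eta.
have kn0 : sinh_const eta != 0.
  rewrite /sinh_const mulf_neq0//; last first.
    by apply/prodf_neq0 => i _; rewrite invr_neq0// pnatr_eq0 -lt0n fact_gt0.
  by have := odd_alternant_sign eta_chamber eta_chamber; apply: contraTneq => ->; rewrite mul0r ltxx.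
pose k := sinh_const eta; have k0 : 0 < `|k| by rewrite normr_gt0.
have [mZ _ _] := stdZ.
exists (C / `|k|); first by rewrite divr_ge0.
exists (`|k| * c / n`!%:R); first by rewrite divr_gt0 ?mulr_gt0// ltr0n fact_gt0.
move=> t e A t0 e0 e2 mA Ae a aE.
rewrite survival_massE//.
have [iK ->] := survival_gaussian bmX t0 n0 eta_chamber stdZ mA.
set st := Num.sqrt t in iK aE *.
have st0 : 0 < st by rewrite sqrtr_gt0.
have st2 : st ^+ 2 = t by rewrite sqr_sqrtr// ltW.
pose F (w : T') : R := \1_A (st * pnorm (Z^~ w)) * `|odd_alternant (Z^~ w)|.
have F0 w : 0 <= F w by rewrite mulr_ge0.
have mFA : measurable_fun setT (fun s : R => \1_A (st * s) : R).
  by apply: measurableT_comp; [exact: measurable_indic|exact: measurable_funM].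
have intF : (\int[P']_w (F w)%:E = (c * free_mass t A)%:E)%E.
  have /= := cP (fun s => (\1_A (st * s))%:E) _ _.
  under eq_integral do rewrite -EFinM; move=> -> //; last exact/measurable_EFinP.
  have mE : measurable ((fun w => st * pnorm (W^~ w)) @^-1` A).
    have [mW _ _] := stdW; rewrite -[_ @^-1` _]setTI.
    have mp : measurable_fun setT (fun w => st * pnorm (W^~ w)).
      by apply: measurable_funM => //; exact: (pt_measurable_comp (@pt_measurable_pnorm R _) mW).
    exact: mp.
  rewrite EFinM; congr (_ * _)%E; rewrite /free_mass fineK ?fin_num_measure//.
  by rewrite -[in RHS](setIT (_ @^-1` A)) -integral_indic.
have mF : measurable_fun setT F.
  apply: measurable_funM.
    apply: (measurableT_comp mFA).
    exact: (pt_measurable_comp (@pt_measurable_pnorm R _) mZ).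
  apply: measurableT_comp => //.
  exact: (pt_measurable_comp (@pt_measurable_odd_alternant R n) mZ).
have iF : P'.-integrable setT (EFin \o F).
  apply/integrableP; split; first exact/measurable_EFinP.
  under eq_integral do rewrite /= ger0_norm//.
  by rewrite intF ltry.
have RF : \int[P']_w F w = c * free_mass t A by rewrite /Rintegral intF.
set K := (fun w => _ * _ * _) in iK *.
have KF w : `|K w - `|k| * st^-1 ^+ (n ^ 2) * F w| <= C * e * st^-1 ^+ (n ^ 2) * F w.
  rewrite /K /F indicE; case: (boolP (_ \in A)) => [|_]; last first.
    by rewrite !mul0r !mulr0 subr0 normr0.
  rewrite inE => /Ae Zt; rewrite !mul1r.
  have ze j : `|st^-1 * Z j w| <= e.
    rewrite normrM gtr0_norm ?invr_gt0// ler_pdivrMl//.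
    apply: (le_trans (coord_le_pnorm (Z^~ w) j)); rewrite -(ler_pM2l st0) (le_trans Zt)//.
    by rewrite -st2 expr2 mulrC mulrA.
  have := CP _ _ e0 e2 ze; rewrite odd_alternantZ normrM [`|_ ^+ _|]ger0_norm; last first.
    by rewrite exprn_ge0// invr_ge0 ltW.
  rewrite -/k; set D := \det _; set V := odd_alternant _; set q := st^-1 ^+ _ => Dk.
  (* [sinh_const eta] is V(eta) times a positive factor, so it may replace V(eta) inside the sign;
     the leading term then becomes |k| |V|. *)
  have -> : alternant_sign eta (Z^~ w) = Num.sg (k * V).
    rewrite /alternant_sign /k /sinh_const -/V mulrAC [RHS]sgrM.
    have /gtr0_sg -> : (0 : R) < \prod_(i < n) (i.*2.+1)`!%:R^-1.
      by apply: prodr_gt0 => i _; rewrite invr_gt0 ltr0n fact_gt0.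
    by rewrite mulr1.
  have sgk : `|k| * `|V| = Num.sg (k * V) * (k * V) by rewrite -normrM normrEsg.
  have -> : Num.sg (k * V) * D - `|k| * q * `|V| = Num.sg (k * V) * (D - k * (q * V)).
    by rewrite (mulrAC `|k|) sgk mulrBr -!mulrA (mulrC V q).
  rewrite normrM; apply: (@le_trans _ _ (1 * `|D - k * (q * V)|)).
    by rewrite ler_wpM2r// normr_sg; case: eqP.
  by rewrite mul1r (le_trans Dk)// mulrA.
have := Rintegral_near iK iF KF; rewrite RF.
move: (\int[P']_w K w) => IK H.
pose p := expR (- (pnorm eta ^+ 2 / (2 * t))) / n`!%:R.
have p0 : 0 < p by rewrite divr_gt0 ?expR_gt0// ltr0n fact_gt0.
have -> : a * free_mass t A = p * (`|k| * st^-1 ^+ (n ^ 2) * (c * free_mass t A)).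
  by rewrite aE /p; move: (expR _) (n`!%:R^-1) `|k| (st^-1 ^+ _) (free_mass _ _) => x1 x2 x3 x4 x5; ring.
rewrite -/p -mulrBr normrM gtr0_norm//.
have -> : C / `|k| * e * (p * (`|k| * st^-1 ^+ (n ^ 2) * (c * free_mass t A))) =
    p * (C * e * st^-1 ^+ (n ^ 2) * (c * free_mass t A)).
  move: (gt_eqF k0); move: `|k| (st^-1 ^+ _) (free_mass _ _) => x3 x4 x5 x30.
  by field; rewrite x30.
by rewrite ler_pM2l.
Qed.

End survival_mass.

(** * Gaussian tails against polynomial factors *)

(** Under the hypothesis (z - a)^2 >= (z - y)^2 + (y - a)^2 on [A], so the density centred at [a] is
    at most the exponential times the one centred at [y], whose mass is at most 1. The sign
    condition covers left and right tails at once. *)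
Lemma normal_prob_tail (R : realType) (a y : R) (A : set R) : measurable A ->
  (forall z, A z -> 0 <= (z - y) * (y - a)) ->
  (normal_prob a 1 A <= (expR (- ((y - a) ^+ 2 / 2)))%:E)%E.
Proof.
move=> mA Ay; rewrite /normal_prob.
apply: (@le_trans _ _ (\int[lebesgue_measure]_(z in A)
    ((expR (- ((y - a) ^+ 2 / 2)))%:E * (normal_pdf y 1 z)%:E))%E).
  apply: ge0_le_integral => //.
  - by move=> z _; rewrite lee_fin normal_pdf_ge0.
  - by apply/measurable_EFinP; apply: measurable_funTS; exact: measurable_normal_pdf.
  - apply: emeasurable_funM => //.
    by apply/measurable_EFinP; apply: measurable_funTS; exact: measurable_normal_pdf.
  move=> z Az; rewrite -EFinM lee_fin !normal_pdfE ?oner_eq0//.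
  rewrite mulrCA ler_wpM2l ?normal_peak_ge0//.
  rewrite /normal_fun expr1n -expRD ler_expR.
  by have := Ay z Az; nra.
rewrite ge0_integralZl//; last 2 first.
- by apply/measurable_EFinP; apply: measurable_funTS; exact: measurable_normal_pdf.
- by move=> z _; rewrite lee_fin normal_pdf_ge0.
rewrite -[leRHS]mule1 lee_wpmul2l ?lee_fin ?expR_ge0//.
exact: (@probability_le1 _ (measurableTypeR R) R (normal_prob y 1) A mA).
Qed.

Lemma measure_bigsetU_le d (T : measurableType d) (R : realType) (P : probability T R)
    (I : Type) (s : seq I) (A : I -> set T) : (forall i, measurable (A i)) ->
  (P (\big[setU/set0]_(i <- s) A i) <= \sum_(i <- s) P (A i))%E.
Proof.
move=> mA; elim: s => [|i s IH]; first by rewrite !big_nil measure0.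
rewrite !big_cons (le_trans (measureU2 _ _ _))//; first exact: bigsetU_measurable.
by rewrite leeD2l.
Qed.

(** If every coordinate is below rho/#|I| in absolute value, then the norm is below rho; a union
    bound over coordinates and signs finishes. The threshold rho/sqrt(#|I|) would be sharper, but
    this only affects the rate. *)
Lemma gaussian_tail (R : realType) (I : finType) d (T : measurableType d)
    (P : probability T R) (Y : I -> T -> R) (a : I -> R) (alpha rho : R) :
  (forall i, measurable_fun setT (Y i)) ->
  (forall i, has_normal_law P (Y i) (a i) 1) ->
  (0 < #|I|)%N -> (forall i, `|a i| <= alpha) -> alpha <= rho / #|I|%:R ->
  (P [set w | (rho <= pnorm (Y^~ w))%R] <=
   (#|I|%:R * (2 * expR (- ((rho / #|I|%:R - alpha) ^+ 2 / 2))))%:E)%E.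
Proof.
move=> mY lY I0 aa ar; set y := rho / _; set b := expR _.
have I0' : (0 : R) < #|I|%:R by rewrite ltr0n.
pose E i : set T := Y i @^-1` (`]-oo, (- y)%R] `|` `[y, +oo[).
have mE i : measurable (E i) by rewrite -[E i]setTI; apply: mY => //; exact: measurableU.
have [i0 _] : exists i0 : I, i0 \in I by apply/card_gt0P.
have y0 : 0 <= y by rewrite (le_trans _ ar)// (le_trans _ (aa i0)).
have rhoE : rho = #|I|%:R * y by rewrite mulrC divfK// gt_eqF.
have mn : measurable_fun setT (fun w => pnorm (Y^~ w)).
  exact: (pt_measurable_comp (@pt_measurable_pnorm R I) mY).
have sub : [set w | rho <= pnorm (Y^~ w)] `<=` \big[setU/set0]_(i : I) E i.
  move=> w /= rw; apply: contrapT => nE.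
  have Yy i : `|Y i w| < y.
    rewrite ltNge; apply/negP => yY; apply: nE.
    rewrite -bigcup_seq; exists i; first by rewrite /= mem_index_enum.
    move: yY; rewrite ler_normr => /orP[yY|yY]; [right|left].
      by rewrite /= in_itv/= yY.
    by rewrite /= in_itv/= lerNr.
  have y1 : 0 < y by rewrite (le_lt_trans _ (Yy i0)).
  have : pnorm (Y^~ w) ^+ 2 < rho ^+ 2.
    rewrite sqr_pnorm; apply: (@lt_le_trans _ _ (\sum_(i : I) y ^+ 2)).
      apply: ltr_sum; first by apply/hasP; exists i0 => //; rewrite mem_index_enum.
      by move=> i _; rewrite -real_normK ?num_real// ltr_pXn2r// nnegrE.
    rewrite sumr_const -[leLHS]mulr_natl rhoE [leRHS]exprMn.
    apply: ler_wpM2r; first exact: sqr_ge0.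
    by rewrite expr2; apply: (@ler_peMl _ #|I|%:R) => //; rewrite ler1n.
  rewrite ltr_pXn2r// ?nnegrE ?pnorm_ge0 ?(le_trans _ rw) ?pnorm_ge0//.
    by move=> h; have := le_lt_trans rw h; rewrite ltxx.
  by rewrite rhoE mulr_ge0.
apply: (@le_trans _ _ (P (\big[setU/set0]_(i : I) E i))).
  apply: le_measure => //; rewrite inE; last by apply: bigsetU_measurable.
  rewrite (_ : [set w | _] = setT `&` (fun w => pnorm (Y^~ w)) @^-1` `[rho, +oo[%classic).
    exact: (mn measurableT _ (measurable_itv _)).
  by rewrite setTI; apply/seteqP; split=> w /=; rewrite in_itv/= andbT.
apply: (le_trans (measure_bigsetU_le P _ mE)).
have ay : alpha <= y by [].
have gauss_le u v : y - alpha <= u -> v ^+ 2 = u ^+ 2 -> expR (- (v ^+ 2 / 2)) <= b.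
  move=> yu ->; rewrite ler_expR lerN2 ler_pM2r ?invr_gt0// ler_pXn2r// nnegrE ?subr_ge0//.
  by rewrite (le_trans _ yu)// subr_ge0.
have PE i : (P (E i) <= (2 * b)%:E)%E.
  rewrite /E lY; last exact: measurableU.
  apply: (le_trans (measureU2 _ _ _)) => //.
  rewrite mulr2n mulrDl mul1r EFinD; have /ler_normlP[ai1 ai2] := aa i; apply: leeD.
    apply: (le_trans (@normal_prob_tail _ (a i) (- y) _ _ _)) => //.
      by move=> z /=; rewrite in_itv/= => zy; apply: mulr_le0; lra.
    by rewrite lee_fin (@gauss_le (y + a i))//; [lra|rewrite -sqrrN opprB opprK addrC].
  apply: (le_trans (@normal_prob_tail _ (a i) y _ _ _)) => //.
    by move=> z /=; rewrite in_itv/= andbT => zy; apply: mulr_ge0; lra.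
  by rewrite lee_fin (@gauss_le (y - a i))//; lra.
apply: (@le_trans _ _ (\sum_(i : I) (2 * b)%:E)%E); first exact: lee_sum.
by rewrite sumEFin sumr_const lee_fin -[leLHS]mulr_natl.
Qed.

Lemma powR_near_ge (R : realType) (p M : R) : 0 < p -> \forall t \near +oo, M <= t `^ p.
Proof.
move=> p0; near=> t.
have h : (`|M| + 1) `^ p^-1 <= t by near: t; exact: nbhs_pinfty_ge.
have M1 : 0 <= `|M| + 1 by rewrite addr_ge0.
have := @ge0_ler_powR _ p (ltW p0) ((`|M| + 1) `^ p^-1) t.
rewrite !nnegrE powR_ge0 (le_trans _ h) ?powR_ge0// => /(_ isT isT h).
rewrite -powRrM mulVf ?gt_eqF// powRr1//; apply: le_trans.
by rewrite (le_trans (ler_norm M))// lerDl.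
Unshelve. all: by end_near. Qed.

(** A single Taylor term of the exponential suffices, of an order [j.+1] with [p * j.+1 > k]. *)
Lemma exp_powR_decay (R : realType) (M k a p : R) : 0 < a -> 0 < p ->
  \forall t \near +oo, M * t `^ k * expR (- (a * t `^ p)) <= 1.
Proof.
move=> a0 p0; pose j := Num.truncn (`|k| / p).
have jk : 0 < p * j.+1%:R - k.
  rewrite subr_gt0 mulrC -ltr_pdivrMr//.
  apply: (@le_lt_trans _ _ (`|k| / p)); last exact: truncnS_gt.
  by rewrite ler_pM2r ?invr_gt0// ler_norm.
near=> t.
have t0 : 0 < t by near: t; exact: nbhs_pinfty_gt.
have tM : M * (a ^+ j.+1 / j.+1`!%:R)^-1 <= t `^ (p * j.+1%:R - k).
  by near: t; exact: powR_near_ge.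
have aj0 : 0 < a ^+ j.+1 / j.+1`!%:R by rewrite divr_gt0 ?exprn_gt0// ltr0n fact_gt0.
rewrite expRN ler_pdivrMr ?expR_gt0// mul1r.
have ay0 : 0 <= a * t `^ p by rewrite mulr_ge0 ?powR_ge0 ?ltW.
apply: le_trans (expR_ge1Dxn j ay0).
apply: (@le_trans _ _ ((a * t `^ p) ^+ j.+1 / j.+1`!%:R)); last by rewrite lerDr.
rewrite exprMn -(powR_mulrn _ (powR_ge0 _ _)) -powRrM mulrAC.
have -> : p * j.+1%:R = p * j.+1%:R - k + k by rewrite subrK.
rewrite powRD; last by rewrite (gt_eqF t0) implybT.
rewrite mulrA; apply: ler_wpM2r; first exact: powR_ge0.
by rewrite mulrC -ler_pdivrMr.
Unshelve. all: by end_near. Qed.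

(** For large [t] the shift [alpha] takes up at most half of the threshold c t^ep / m, which leaves
    the exponent c^2 t^(2 ep) / (8 m^2). Half of it absorbs the prefactor [2 m], hence the 16. *)
Lemma gaussian_tail_near (R : realType) (m : nat) d (T : measurableType d)
    (P : probability T R) (Y : R -> 'I_m -> T -> R) (a : R -> 'I_m -> R) (alpha c ep : R) :
  (0 < m)%N -> 0 < c -> 0 < ep ->
  (forall t i, 1 <= t -> measurable_fun setT (Y t i)) ->
  (forall t i, 1 <= t -> has_normal_law P (Y t i) (a t i) 1) ->
  (forall t i, 1 <= t -> `|a t i| <= alpha) ->
  \forall t \near +oo, (P [set w | (c * t `^ ep <= pnorm ((Y t)^~ w))%R] <=
    (expR (- (c ^+ 2 / (16 * m%:R ^+ 2) * t `^ (2 * ep))))%:E)%E.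
Proof.
move=> m0 c0 ep0 mY lY aa.
have m0' : (0 : R) < m%:R by rewrite ltr0n.
have q0 : 0 < c ^+ 2 / (16 * m%:R ^+ 2) by rewrite divr_gt0 ?exprn_gt0 ?mulr_gt0 ?exprn_gt0.
near=> t.
have t1 : 1 <= t by near: t; exact: nbhs_pinfty_ge.
pose q := c ^+ 2 / (16 * m%:R ^+ 2).
have ya : 2 * m%:R * `|alpha| / c <= t `^ ep by near: t; exact: powR_near_ge.
have dec : 2 * m%:R * t `^ 0 * expR (- (q * t `^ (2 * ep))) <= 1.
  by near: t; apply: exp_powR_decay => //; rewrite mulr_gt0.
have tE : t `^ (2 * ep) = (t `^ ep) ^+ 2 by rewrite mulrC powRrM powR_mulrn ?powR_ge0.
rewrite tE; rewrite powRr0 mulr1 tE in dec; move: (t `^ ep) ya dec => y ya dec.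
rewrite -/q.
have al : `|alpha| <= c * y / m%:R / 2.
  rewrite ler_pdivrMr// in ya; rewrite !ler_pdivlMr//.
  by move: ya; move: m%:R `|alpha| => x1 x2; lra.
have al1 := ler_norm alpha.
have y0 : 0 <= c * y / m%:R by rewrite (le_trans _ (_ : 2 * `|alpha| <= _))// ?mulr_ge0//; move: al; lra.
have card_m : #|'I_m|%:R = m%:R :> R by rewrite card_ord.
have al2 : alpha <= c * y / #|'I_m|%:R by rewrite card_m; move: al al1 y0; lra.
have I0 : (0 < #|'I_m|)%N by rewrite card_ord.
have := gaussian_tail (fun i => mY t i t1) (fun i => lY t i t1) I0 (fun i => aa t i t1) al2.
move/le_trans; apply; rewrite card_m lee_fin.
apply: (@le_trans _ _ (2 * m%:R * (expR (- (q * y ^+ 2)) * expR (- (q * y ^+ 2))))); last first.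
  by rewrite mulrA ler_piMl ?expR_ge0.
rewrite mulrA (mulrC m%:R); apply: ler_wpM2l; first by rewrite mulr_ge0// ltW.
rewrite -expRD ler_expR.
have -> : - (q * y ^+ 2) - q * y ^+ 2 = - ((c * y / m%:R / 2) ^+ 2 / 2).
  by rewrite /q; field; rewrite gt_eqF.
rewrite lerN2 ler_pM2r ?invr_gt0// ler_pXn2r// ?nnegrE; move: al al1 y0 al2; rewrite ?card_m; lra.
Unshelve. all: by end_near. Qed.

Lemma fine_measure_split d (T : measurableType d) (R : realType) (P : probability T R)
    (E F : set T) : measurable E -> measurable F ->
  fine (P E) = fine (P (E `&` F)) + fine (P (E `&` ~` F)).
Proof.
move=> mE mF; rewrite -fineD ?fin_num_measure//; first last.
- by apply: measurableI => //; exact: measurableC.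
- exact: measurableI.
by rewrite (measureDI P mE mF) setDE addeC.
Qed.

Lemma fine_measure_le d (T : measurableType d) (R : realType) (P : probability T R)
    (E F : set T) : measurable E -> measurable F -> E `<=` F -> fine (P E) <= fine (P F).
Proof.
move=> mE mF EF; apply: fine_le; rewrite ?fin_num_measure//.
by apply: le_measure; rewrite ?inE.
Qed.

(** The numerator x - p u is within (t1 + t2) a u of 0, and [a / 2 <= p] costs the factor 2. *)
Lemma ratio_near (R : realType) (x p a u t1 t2 : R) : 0 < a -> 0 <= u -> t2 <= 2^-1 ->
  `|x - a * u| <= t1 * (a * u) -> `|p - a| <= t2 * a ->
  [/\ a / 2 <= p, 0 < p & `|x / p - u| <= 2 * (t1 + t2) * u].
Proof.
move=> a0 u0 t2h xau pa.
have pa2 : a / 2 <= p by move/ler_normlP: pa => [pa1 pa2]; nra.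
have p0 : 0 < p by rewrite (lt_le_trans _ pa2)// divr_gt0.
split=> //.
have -> : x / p - u = (x - p * u) / p by field; rewrite gt_eqF.
rewrite normrM normfV (gtr0_norm p0) ler_pdivrMr//.
have -> : x - p * u = (x - a * u) - (p - a) * u by ring.
apply: (le_trans (ler_normB _ _)); rewrite normrM (ger0_norm u0).
have h1 : `|p - a| * u <= t2 * a * u by exact: ler_wpM2r.
have t20 : 0 <= t2 by rewrite -(pmulr_lge0 _ a0) (le_trans _ pa).
apply: (@le_trans _ _ ((t1 + t2) * u * a)); first by move: xau h1; lra.
have [t12|t12] := leP 0 ((t1 + t2) * u).
  by move: t12 pa2; set s := _ * u; move=> s0 pa2; rewrite -[leRHS]mulrA [leRHS](_ : _ = s * (2 * p)); [nra|rewrite /s; ring].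
exfalso; move: (normr_ge0 (x - a * u)) (normr_ge0 (p - a)) => n1 n2.
have : 0 <= (t1 + t2) * u * a by rewrite (le_trans (addr_ge0 n1 (mulr_ge0 n2 u0)))//; move: xau h1; lra.
by rewrite pmulr_lge0// leNgt t12.
Qed.

(** * Conditioning on survival *)

Section conditional_estimate.
Context (R : realType) (n : nat) (eta : 'I_n -> R).
Context d (T : measurableType d) (P : probability T R) (X : 'I_n -> R -> T -> R).
Hypotheses (bmX : bm_process P X eta) (n0 : (0 < n)%N) (eta_chamber : chamber eta).
Context d' (T' : measurableType d') (P' : probability T' R) (Z : 'I_n -> T' -> R).
Hypothesis stdZ : std_gaussian P' Z.
Context d'' (T'' : measurableType d'') (Q : probability T'' R).
Variable W : 'I_(n * n.+1) -> T'' -> R.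
Hypothesis stdW : std_gaussian Q W.

Let x t A := survival_mass P X t A.
Let u t A := free_mass Q W t A.
Let p t := fine (P (survives X t)).
Let rad t w := pnorm (fun i => X i t w).
Let frad t w := Num.sqrt t * pnorm (W^~ w).
Let ray (c ep t : R) : set R := [set r | c * t `^ (2^-1 + ep) <= r].

Let mrad t (A : set R) : measurable A -> measurable (rad t @^-1` A).
Proof.
move=> mA; have [mX _ _ _ _] := bmX; rewrite -[_ @^-1` _]setTI.
have h : measurable_fun setT (rad t).
  exact: (pt_measurable_comp (@pt_measurable_pnorm R _) (fun i => mX i t)).
exact: h.
Qed.

Let mfrad t (A : set R) : measurable A -> measurable (frad t @^-1` A).
Proof.
move=> mA; have [mW _ _] := stdW; rewrite -[_ @^-1` _]setTI.
have h : measurable_fun setT (frad t).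
  by apply: measurable_funM => //; exact: (pt_measurable_comp (@pt_measurable_pnorm R _) mW).
exact: h.
Qed.

Let msurv t : 0 < t -> measurable (survives X t).
Proof. by move=> t0; exact: (measurable_survives bmX t0 n0 eta_chamber). Qed.

Let mray c ep t : measurable (ray c ep t).
Proof.
rewrite (_ : ray c ep t = `[c * t `^ (2^-1 + ep), +oo[%classic); first exact: measurable_itv.
by apply/seteqP; split=> r /=; rewrite in_itv/= andbT.
Qed.

Lemma survival_mass_split t A C : 0 < t -> measurable A -> measurable C ->
  survival_mass P X t A = survival_mass P X t (A `&` C) + survival_mass P X t (A `&` ~` C).
Proof.
move=> t0 mA mC; rewrite /survival_mass (fine_measure_split P (F := rad t @^-1` C)).
- by rewrite setIAC [X in _ + fine (P X)]setIAC.
- by apply: measurableI; [exact: mrad|exact: msurv].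
- exact: mrad.
Qed.

Lemma free_mass_split t A C : measurable A -> measurable C ->
  free_mass Q W t A = free_mass Q W t (A `&` C) + free_mass Q W t (A `&` ~` C).
Proof.
by move=> mA mC; rewrite /free_mass (fine_measure_split Q (F := frad t @^-1` C))//; exact: mfrad.
Qed.

Lemma survival_mass_le t A C : 0 < t -> measurable A -> measurable C -> A `<=` C ->
  survival_mass P X t A <= survival_mass P X t C.
Proof.
move=> t0 mA mC AC; apply: fine_measure_le.
- by apply: measurableI; [exact: mrad|exact: msurv].
- by apply: measurableI; [exact: mrad|exact: msurv].
- by move=> w [/AC].
Qed.

Lemma free_mass_le t A C : measurable A -> measurable C -> A `<=` C ->
  free_mass Q W t A <= free_mass Q W t C.
Proof. by move=> mA mC AC; apply: fine_measure_le; [exact: mfrad|exact: mfrad|move=> w /AC]. Qed.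

Lemma survival_mass_ge0 t A : 0 <= survival_mass P X t A. Proof. by rewrite fine_ge0. Qed.
Lemma free_mass_ge0 t A : 0 <= free_mass Q W t A. Proof. by rewrite fine_ge0. Qed.

Let sqrt_powR (c ep t r : R) : 0 < t ->
  (c * t `^ (2^-1 + ep) <= Num.sqrt t * r) = (c * t `^ ep <= r).
Proof.
move=> t0; rewrite powRD; last by rewrite (gt_eqF t0) implybT.
by rewrite (powR12_sqrt (ltW t0)) mulrCA ler_pM2l// sqrtr_gt0.
Qed.

(** The survival event is simply dropped: the unconditioned position divided by sqrt(t) is Gaussian,
    with mean bounded by |eta| for [t >= 1]. *)
Lemma survival_tail c ep : 0 < c -> 0 < ep -> \forall t \near +oo,
  survival_mass P X t (ray c ep t) <= expR (- (c ^+ 2 / (16 * n%:R ^+ 2) * t `^ (2 * ep))).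
Proof.
move=> c0 ep0.
pose Y t (i : 'I_n) w := (Num.sqrt t)^-1 * X i t w.
have t10 (t : R) : 1 <= t -> 0 < t by exact: lt_le_trans.
have H := @gaussian_tail_near R n _ _ P Y (fun t i => eta i * (Num.sqrt t)^-1) (pnorm eta) c ep n0 c0 ep0.
have {}H := H (fun t i t1 => let: And3 m _ _ := bm_scaled bmX (t10 t t1) in m i).
have {}H := H (fun t i t1 => let: And3 _ _ l := bm_scaled bmX (t10 t t1) in l i).
have {}H : \forall t \near +oo, (P [set w | (c * t `^ ep <= pnorm ((Y t)^~ w))%R] <=
    (expR (- (c ^+ 2 / (16 * n%:R ^+ 2) * t `^ (2 * ep))))%:E)%E.
  apply: H => t i t1.
  have s1 : 1 <= Num.sqrt t by rewrite -sqrtr1 ler_wsqrtr.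
  rewrite normrM (@le_trans _ _ (`|eta i| * 1))//.
    by rewrite ler_wpM2l// normfV ger0_norm ?sqrtr_ge0// invf_le1// (lt_le_trans _ s1).
  by rewrite mulr1 coord_le_pnorm.
near=> t.
have t0 : 0 < t by near: t; exact: nbhs_pinfty_gt.
have Ht : (P [set w | (c * t `^ ep <= pnorm ((Y t)^~ w))%R] <=
    (expR (- (c ^+ 2 / (16 * n%:R ^+ 2) * t `^ (2 * ep))))%:E)%E by near: t; exact: H.
rewrite -lee_fin; apply: le_trans Ht; rewrite /survival_mass fineK; last first.
  by rewrite fin_num_measure//; apply: measurableI; [exact: mrad|exact: msurv].
rewrite (_ : [set w | _] = rad t @^-1` ray c ep t).
  by apply: le_measure; rewrite ?inE; [apply: measurableI; [exact: mrad|exact: msurv]|exact: mrad|exact: subIsetl].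
apply/seteqP; split=> w; rewrite /ray /rad /=; rewrite -(@sqrt_powR c ep t)// pnormZ gtr0_norm ?invr_gt0 ?sqrtr_gt0// mulVKf//;
  by rewrite gt_eqF// sqrtr_gt0.
Unshelve. all: by end_near. Qed.

Lemma free_tail c ep : 0 < c -> 0 < ep -> \forall t \near +oo,
  free_mass Q W t (ray c ep t) <= expR (- (c ^+ 2 / (16 * (n * n.+1)%:R ^+ 2) * t `^ (2 * ep))).
Proof.
move=> c0 ep0; have [mW _ lW] := stdW.
have N0 : (0 < n * n.+1)%N by rewrite muln_gt0 n0.
have H := @gaussian_tail_near R _ _ _ Q (fun _ => W) (fun _ _ => 0) 0 c ep N0 c0 ep0
  (fun _ i _ => mW i) (fun _ i _ => lW i).
have {}H : \forall t \near +oo, (Q [set w | (c * t `^ ep <= pnorm (W^~ w))%R] <=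
    (expR (- (c ^+ 2 / (16 * (n * n.+1)%:R ^+ 2) * t `^ (2 * ep))))%:E)%E.
  by apply: H => t i _; rewrite normr0.
near=> t.
have t0 : 0 < t by near: t; exact: nbhs_pinfty_gt.
have Ht : (Q [set w | (c * t `^ ep <= pnorm (W^~ w))%R] <=
    (expR (- (c ^+ 2 / (16 * (n * n.+1)%:R ^+ 2) * t `^ (2 * ep))))%:E)%E by near: t; exact: H.
rewrite -lee_fin; apply: le_trans Ht; rewrite /free_mass fineK; last first.
  by rewrite fin_num_measure//; exact: mfrad.
rewrite (_ : [set w | _] = frad t @^-1` ray c ep t)//.
by apply/seteqP; split=> w; rewrite /ray /frad /= sqrt_powR.
Unshelve. all: by end_near. Qed.

Lemma survival_massT t : survival_mass P X t setT = fine (P (survives X t)).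
Proof. by rewrite /survival_mass preimage_setT setTI. Qed.

Lemma free_massT t : free_mass Q W t setT = 1.
Proof. by rewrite /free_mass preimage_setT probability_setT. Qed.

(** The survival probability [p t] is the mass of the region plus the mass of the tail. The former
    is compared with [a t] by [survival_mass_near]; the tails are smaller than any power of [t],
    whereas [a t] is bounded below by one. Dividing is then [ratio_near]. *)
Lemma conditional_estimate c ep : 0 < c -> 0 < ep -> ep < 2^-1 ->
  exists C M : R, \forall t \near +oo,
    [/\ 0 < p t, (p t)^-1 <= M * t `^ (n ^ 2)%:R
      & forall A : set R, measurable A -> (forall r, A r -> r < c * t `^ (2^-1 + ep)) ->
        `|x t A / p t - u t A| <= C * t `^ (ep - 2^-1) * u t A].
Proof.
move=> c0 ep0 ep2; have [C1 C10 [b b0 H]] := survival_mass_near bmX n0 eta_chamber stdZ stdW.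
pose k := (n ^ 2)%N.
pose a t := expR (- (pnorm eta ^+ 2 / (2 * t))) * b * (Num.sqrt t)^-1 ^+ k.
(* For [t >= 1] the exponential in [a t] is at least exp(-|eta|^2), and sqrt(t) <= t gives the crude
   exponent n^2 in place of n^2/2. *)
pose M := (expR (- pnorm eta ^+ 2) * b)^-1.
have M0 : 0 < M by rewrite invr_gt0 mulr_gt0 ?expR_gt0.
have aP t : 1 <= t -> 0 < a t /\ (a t)^-1 <= M * t `^ k%:R.
  move=> t1; have t0 : 0 < t by rewrite (lt_le_trans _ t1).
  have st0 : 0 < Num.sqrt t by rewrite sqrtr_gt0.
  have at0 : 0 < a t by rewrite mulr_gt0 ?mulr_gt0 ?expR_gt0// exprn_gt0// invr_gt0.
  split=> //; rewrite (powR_mulrn k (ltW t0)).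
  have l0 : 0 < (M * t ^+ k)^-1 by rewrite invr_gt0 mulr_gt0 ?exprn_gt0.
  rewrite -[leRHS]invrK lef_pV2 ?posrE//.
  rewrite invfM /M invrK -exprVn; apply: ler_pM.
  - by rewrite mulr_ge0 ?expR_ge0// ltW.
  - by rewrite exprn_ge0// invr_ge0 (ltW t0).
  - rewrite ler_pM2r// ler_expR lerN2 ler_pdivrMr ?mulr_gt0// ler_peMr ?sqr_ge0//.
    by move: t1; lra.
  - apply: lerXn2r; rewrite ?nnegrE ?invr_ge0 ?(ltW t0) ?(ltW st0)//.
    rewrite lef_pV2 ?posrE// -[leRHS](ger0_norm (ltW t0)) -sqrtr_sqr; apply: ler_wsqrtr.
    by rewrite expr2 ler_peMl// ltW.
(* The error inside the region contributes [C1 * c], and each of the two tails contributes 1. *)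
pose K := C1 * c + 2.
have K0 : 0 < K by rewrite /K; have : 0 <= C1 * c by [rewrite mulr_ge0// ltW]; lra.
exists (2 * (C1 * c + K)), (2 * M).
have n0' : (0 : R) < n%:R by rewrite ltr0n.
have N0' : (0 : R) < (n * n.+1)%:R by rewrite ltr0n muln_gt0 n0.
near=> t.
have t1 : 1 <= t by near: t; exact: nbhs_pinfty_ge.
have t0 : 0 < t by rewrite (lt_le_trans _ t1).
have [at0 atM] := aP t t1.
have tK : 2 * K <= t `^ (2^-1 - ep) by near: t; apply: powR_near_ge; rewrite subr_gt0.
have tc : 2 * c <= t `^ (2^-1 - ep) by near: t; apply: powR_near_ge; rewrite subr_gt0.
have xtail : survival_mass P X t (ray c ep t) <=
    expR (- (c ^+ 2 / (16 * n%:R ^+ 2) * t `^ (2 * ep))) by near: t; exact: survival_tail.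
have utail : free_mass Q W t (ray c ep t) <=
    expR (- (c ^+ 2 / (16 * (n * n.+1)%:R ^+ 2) * t `^ (2 * ep))) by near: t; exact: free_tail.
have xdec : M * t `^ (k%:R + (2^-1 - ep)) * expR (- (c ^+ 2 / (16 * n%:R ^+ 2) * t `^ (2 * ep))) <= 1.
  near: t; apply: exp_powR_decay; last by rewrite mulr_gt0.
  by rewrite divr_gt0 ?exprn_gt0// mulr_gt0 ?exprn_gt0.
have udec : 1 * t `^ (2^-1 - ep) * expR (- (c ^+ 2 / (16 * (n * n.+1)%:R ^+ 2) * t `^ (2 * ep))) <= 1.
  near: t; apply: exp_powR_decay; last by rewrite mulr_gt0.
  by rewrite divr_gt0 ?exprn_gt0// mulr_gt0 ?exprn_gt0.
pose D := t `^ (2^-1 - ep); have D0 : 0 < D by exact: powR_gt0.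
(* With [D^-1] the claimed rate, [e = c * D^-1] is the parameter for which [e * t] equals the radius
   of the region. *)
have DE : t `^ (ep - 2^-1) = D^-1 by rewrite -powRN opprB.
have e0 : 0 <= c * D^-1 by rewrite mulr_ge0// ?invr_ge0 ltW.
have halfD q : 2 * q <= D -> q * D^-1 <= 2^-1.
  by move=> qD; rewrite ler_pdivrMr// mulrC ler_pdivlMr// mulrC.
have e2 : c * D^-1 <= 2^-1 by exact: halfD.
have eR : c * D^-1 * t = c * t `^ (2^-1 + ep).
  rewrite -mulrA -DE -[in LHS](powRr1 (ltW t0)) -powRrM mul1r -powRD; last by rewrite (gt_eqF t0) implybT.
  by congr (_ * _ `^ _); field.
rewrite DE.
have near_in (A : set R) : measurable A -> (forall r, A r -> r < c * t `^ (2^-1 + ep)) ->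
    `|x t A - a t * u t A| <= C1 * (c * D^-1) * (a t * u t A).
  move=> mA AR; apply: (H t (c * D^-1) A) => //.
  by move=> r /AR rR; rewrite eR ltW.
have pa : `|p t - a t| <= K * D^-1 * a t.
  have inR r : (~` ray c ep t) r -> r < c * t `^ (2^-1 + ep) by move/negP; rewrite -ltNge.
  have xi := near_in _ (measurableC (mray c ep t)) inR.
  have pE : p t = x t (ray c ep t) + x t (~` ray c ep t).
    by rewrite /p -survival_massT (@survival_mass_split t setT (ray c ep t)) ?setTI.
  have uE : u t (ray c ep t) + u t (~` ray c ep t) = 1.
    by rewrite -(free_massT t) (@free_mass_split t setT (ray c ep t)) ?setTI.
  have xo : x t (ray c ep t) <= D^-1 * a t.
    apply: (le_trans xtail); set E := expR _.
    rewrite powRD in xdec; last by rewrite (gt_eqF t0) implybT.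
    have Ma : 1 <= M * t `^ k%:R * a t.
      by rewrite -[leLHS](mulVf (lt0r_neq0 at0)); apply: ler_wpM2r => //; exact: ltW.
    apply: (@le_trans _ _ (E * (M * t `^ k%:R * a t))).
      by rewrite ler_peMr// expR_ge0.
    have -> : E * (M * t `^ k%:R * a t) = M * (t `^ k%:R * D) * E * (D^-1 * a t).
      by move: (t `^ _) => tk; field; rewrite gt_eqF.
    by apply: ler_piMl => //; apply: mulr_ge0; [rewrite invr_ge0|]; exact: ltW.
  have uo : u t (ray c ep t) <= D^-1.
    apply: (le_trans utail); set E := expR _.
    by rewrite -[leRHS]mul1r ler_pdivlMr// mulrC; move: udec; rewrite mul1r.
  have xo0 : 0 <= x t (ray c ep t) by exact: survival_mass_ge0.
  have uo0 : 0 <= u t (ray c ep t) by exact: free_mass_ge0.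
  have ui0 : 0 <= u t (~` ray c ep t) by exact: free_mass_ge0.
  have -> : p t - a t = x t (ray c ep t) +
      ((x t (~` ray c ep t) - a t * u t (~` ray c ep t)) - a t * u t (ray c ep t)).
    by rewrite pE -[X in _ - X](mulr1 (a t)) -uE; ring.
  apply: (le_trans (ler_normD _ _)); rewrite (ger0_norm xo0).
  apply: (le_trans (lerD xo (ler_normB _ _))).
  rewrite [`|a t * _|]ger0_norm; last by rewrite mulr_ge0// ltW.
  have h1 : a t * u t (ray c ep t) <= D^-1 * a t by rewrite mulrC; apply: ler_wpM2r => //; exact: ltW.
  have h2 : C1 * (c * D^-1) * (a t * u t (~` ray c ep t)) <= C1 * (c * D^-1) * a t.
    apply: ler_wpM2l; first by rewrite mulr_ge0.
    by rewrite ler_piMr ?(ltW at0)// -uE lerDr.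
  apply: (le_trans (lerD (lexx _) (lerD (le_trans xi h2) h1))).
  by rewrite le_eqVlt; apply/orP; left; apply/eqP; rewrite /K; ring.
have K2 : K * D^-1 <= 2^-1 by exact: halfD.
(* The empty set serves to extract the bounds on [p t], which do not involve [A]. *)
have [pa2 p0 _] := ratio_near at0 (free_mass_ge0 t set0) K2 (near_in set0 measurable0 (fun r => False_ind _)) pa.
split=> //.
  apply: (@le_trans _ _ (2 * (a t)^-1)); last by rewrite -mulrA ler_pM2l.
  by rewrite -[2 / a t]invf_div lef_pV2 ?posrE// divr_gt0.
move=> A mA AR.
have [_ _ h] := ratio_near at0 (free_mass_ge0 t A) K2 (near_in A mA AR) pa.
rewrite (_ : 2 * (C1 * c + K) / D = 2 * (C1 * (c * D^-1) + K * D^-1)); last by ring.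
exact: h.
Unshelve. all: by end_near. Qed.

(** Half of the exponential rate pays for the polynomial growth of 1/[p t]. That growth is taken
    from [conditional_estimate] with the arbitrary exponent 1/4. *)
Lemma conditional_tail c ep : 0 < c -> 0 < ep -> exists2 a : R, 0 < a &
  \forall t \near +oo, x t (ray c ep t) / p t <= expR (- (a * t `^ (2 * ep))) /\
                        u t (ray c ep t) <= expR (- (a * t `^ (2 * ep))).
Proof.
move=> c0 ep0.
have q0 : 0 < 4^-1 :> R by rewrite invr_gt0.
have q2 : 4^-1 < 2^-1 :> R by rewrite ltf_pV2 ?posrE// ltr_nat.
have [C [M H]] := conditional_estimate ltr01 q0 q2.
have n0' : (0 : R) < n%:R by rewrite ltr0n.
have N0' : (0 : R) < (n * n.+1)%:R by rewrite ltr0n muln_gt0 n0.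
pose a1 := c ^+ 2 / (16 * n%:R ^+ 2); pose a2 := c ^+ 2 / (16 * (n * n.+1)%:R ^+ 2).
have a10 : 0 < a1 by rewrite divr_gt0 ?exprn_gt0// mulr_gt0 ?exprn_gt0.
have a20 : 0 < a2 by rewrite divr_gt0 ?exprn_gt0// mulr_gt0 ?exprn_gt0.
exists (Num.min (a1 / 2) a2); first by rewrite lt_min a20 divr_gt0.
near=> t.
have [p0 pM _] : [/\ 0 < p t, (p t)^-1 <= M * t `^ (n ^ 2)%:R
      & forall A : set R, measurable A -> (forall r, A r -> r < 1 * t `^ (2^-1 + 4^-1)) ->
        `|x t A / p t - u t A| <= C * t `^ (4^-1 - 2^-1) * u t A] by near: t; exact: H.
have xt : x t (ray c ep t) <= expR (- (a1 * t `^ (2 * ep))) by near: t; exact: survival_tail.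
have ut : u t (ray c ep t) <= expR (- (a2 * t `^ (2 * ep))) by near: t; exact: free_tail.
have dec : M * t `^ (n ^ 2)%:R * expR (- (a1 / 2 * t `^ (2 * ep))) <= 1.
  by near: t; apply: exp_powR_decay; [rewrite divr_gt0|rewrite mulr_gt0].
have y0 := powR_ge0 t (2 * ep); split; last first.
  by apply: (le_trans ut); rewrite ler_expR lerN2 ler_wpM2r// ge_min lexx orbT.
apply: (@le_trans _ _ (expR (- (a1 / 2 * t `^ (2 * ep))))); last first.
  by rewrite ler_expR lerN2 ler_wpM2r// ge_min lexx.
apply: (@le_trans _ _ (expR (- (a1 * t `^ (2 * ep))) * (M * t `^ (n ^ 2)%:R))).
  by apply: ler_pM => //; [exact: survival_mass_ge0|rewrite invr_ge0 ltW].
have -> : expR (- (a1 * t `^ (2 * ep))) =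
    expR (- (a1 / 2 * t `^ (2 * ep))) * expR (- (a1 / 2 * t `^ (2 * ep))).
  by rewrite -expRD; congr expR; field.
by rewrite -mulrA ler_piMr ?expR_ge0// mulrC.
Unshelve. all: by end_near. Qed.

(** [A] is cut at radius t^(3/4): the part inside contributes at most delta/3 by the relative
    estimate, as the free mass is at most 1, and each of the two tails at most delta/3. *)
Lemma conditional_total_variation delta : 0 < delta -> \forall t \near +oo,
  forall A : set R, measurable A -> `|x t A / p t - u t A| <= delta.
Proof.
move=> d0.
have q0 : 0 < 4^-1 :> R by rewrite invr_gt0.
have q2 : 4^-1 < 2^-1 :> R by rewrite ltf_pV2 ?posrE// ltr_nat.
have [C [M H]] := conditional_estimate ltr01 q0 q2.
have [a a0 Ha] := conditional_tail ltr01 q0.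
near=> t => A mA.
have t0 : 0 < t by near: t; exact: nbhs_pinfty_gt.
have [p0 _ HA] : [/\ 0 < p t, (p t)^-1 <= M * t `^ (n ^ 2)%:R
      & forall A : set R, measurable A -> (forall r, A r -> r < 1 * t `^ (2^-1 + 4^-1)) ->
        `|x t A / p t - u t A| <= C * t `^ (4^-1 - 2^-1) * u t A] by near: t; exact: H.
have [xt ut] : x t (ray 1 4^-1 t) / p t <= expR (- (a * t `^ (2 * 4^-1))) /\
                        u t (ray 1 4^-1 t) <= expR (- (a * t `^ (2 * 4^-1))) by near: t; exact: Ha.
have dec : 3 / delta * t `^ 0 * expR (- (a * t `^ (2 * 4^-1))) <= 1.
  by near: t; apply: exp_powR_decay; rewrite ?mulr_gt0.
rewrite powRr0 mulr1 mulrAC ler_pdivrMr// mul1r in dec.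
have Cd : 3 * `|C| / delta <= t `^ 4^-1 by near: t; exact: powR_near_ge.
have T0 : 0 < t `^ 4^-1 by exact: powR_gt0.
have CT : `|C| * (t `^ 4^-1)^-1 <= delta / 3.
  rewrite ler_pdivrMr//; rewrite ler_pdivrMr// in Cd.
  by rewrite -(ler_pM2l (ltr0Sn R 2)) mulrA (mulrC delta) !mulrA mulfV// mul1r mulrC (mulrC delta); move: Cd; rewrite mulrC.
have TE : t `^ (4^-1 - 2^-1) = (t `^ 4^-1)^-1.
  by rewrite -powRN; congr (_ `^ _); field.
have inR r : (A `&` ~` ray 1 4^-1 t) r -> r < 1 * t `^ (2^-1 + 4^-1).
  by move=> [_ /negP]; rewrite -ltNge.
have := HA _ (measurableI _ _ mA (measurableC (mray 1 4^-1 t))) inR.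
have u1 : u t (A `&` ~` ray 1 4^-1 t) <= 1.
  by rewrite -(free_massT t); apply: free_mass_le => //; apply: measurableI => //; exact: measurableC.
rewrite TE => h.
have {}h : `|x t (A `&` ~` ray 1 4^-1 t) / p t - u t (A `&` ~` ray 1 4^-1 t)| <= delta / 3.
  apply: (le_trans h); apply: (le_trans _ CT).
  apply: (@le_trans _ _ (`|C| * (t `^ 4^-1)^-1 * u t (A `&` ~` ray 1 4^-1 t))).
    by apply: ler_wpM2r; [exact: free_mass_ge0|rewrite ler_pM2r ?invr_gt0// ler_norm].
  by rewrite ler_piMr// mulr_ge0// invr_ge0 ltW.
have xo : x t (A `&` ray 1 4^-1 t) / p t <= x t (ray 1 4^-1 t) / p t.
  by rewrite ler_pM2r ?invr_gt0//; apply: survival_mass_le => //; exact: measurableI.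
have uo : u t (A `&` ray 1 4^-1 t) <= u t (ray 1 4^-1 t).
  by apply: free_mass_le => //; exact: measurableI.
have xo0 : 0 <= x t (A `&` ray 1 4^-1 t) / p t.
  by rewrite divr_ge0 ?(ltW p0)//; exact: survival_mass_ge0.
have uo0 : 0 <= u t (A `&` ray 1 4^-1 t) by exact: free_mass_ge0.
rewrite (_ : x t A = x t (A `&` ray 1 4^-1 t) + x t (A `&` ~` ray 1 4^-1 t)); last exact: survival_mass_split.
rewrite (_ : u t A = u t (A `&` ray 1 4^-1 t) + u t (A `&` ~` ray 1 4^-1 t)); last exact: free_mass_split.
have := le_trans xo xt; have := le_trans uo ut; rewrite (mulrDl (x t _)).
move: h xo0 uo0 dec; move: (x t _ / p t) (x t _ / p t) (u t _) (u t _) (expR _) => x1 x2 u1' u2 E.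
move=> /ler_normlP[h1 h2] x10 u10 E3 u1E x1E; apply/ler_normlP; split; lra.
Unshelve. all: by end_near. Qed.

End conditional_estimate.

(** * Densities and the theorem *)

Lemma restricted_law_density (R : realType) d (T : measurableType d) (P : probability T R)
    (S : set T) (f : T -> R) : measurable S -> measurable_fun setT f ->
  (forall A : set R, measurable A -> lebesgue_measure A = 0%E -> fine (P (f @^-1` A `&` S)) = 0) ->
  exists2 h : R -> R, measurable_fun setT h /\ (forall r, 0 <= h r) &
  forall A : set R, measurable A ->
    P (f @^-1` A `&` S) = (\int[lebesgue_measure]_(r in A) (h r)%:E)%E.
Proof.
move=> mS mf ac.
have mpre (A : set R) : measurable A -> measurable (f @^-1` A).
  by move=> mA; rewrite -[_ @^-1` _]setTI; exact: mf.
pose m := @pushm _ _ T (measurableTypeR R) R (mrestr P mS) f mf.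
have mE A : m A = P (f @^-1` A `&` S) by [].
have moo : (m setT < +oo)%E.
  by rewrite mE ltey_eq fin_num_measure//; apply: measurableI => //; exact: mpre.
pose nu := mfrestr (@measurableT _ (measurableTypeR R)) moo.
have nuE A : nu A = P (f @^-1` A `&` S).
  by rewrite -mE /nu /= /mfrestr /mrestr setIT.
have dom : nu `<< @lebesgue_measure R.
  apply/null_content_dominatesP => A mA A0.
  rewrite nuE -[LHS]fineK ?ac// fin_num_measure//.
  by apply: measurableI => //; exact: mpre.
have [h [h0 hfin hint hE]] := radon_nikodym_sigma_finite dom.
exists (fun r => fine (h r)); first split.
- by apply: measurableT_comp => //; exact: measurable_int hint.
- by move=> r; rewrite fine_ge0.
move=> A mA; transitivity (\int[lebesgue_measure]_(r in A) h r)%E.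
  by transitivity (nu A); [rewrite nuE|exact: hE].
by apply: eq_integral => r _; rewrite fineK.
Qed.

(** On the set where [g < f] the integral of [f - g] is nonpositive by hypothesis, so this set is
    null; finiteness of the integral of [g] permits the subtraction. *)
Lemma ae_le_density (R : realType) (f g : R -> R) (D : set R) : measurable D ->
  measurable_fun setT f -> measurable_fun setT g ->
  (forall r, 0 <= f r) -> (forall r, 0 <= g r) ->
  (forall A, measurable A -> A `<=` D ->
    (\int[lebesgue_measure]_(r in A) (f r)%:E <= \int[lebesgue_measure]_(r in A) (g r)%:E)%E /\
    (\int[lebesgue_measure]_(r in A) (g r)%:E < +oo)%E) ->
  {ae lebesgue_measure, forall r, D r -> f r <= g r}.
Proof.
move=> mD mf mg f0 g0 fg.
pose A := D `&` [set r | g r < f r].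
have mA : measurable A.
  apply: measurableI => //.
  rewrite (_ : [set r | _] = (fun r => f r - g r) @^-1` `]0, +oo[%classic).
    by rewrite -[_ @^-1` _]setTI; apply: (measurable_funB mf mg) => //; exact: measurable_itv.
  by apply/seteqP; split=> r /=; rewrite in_itv/= andbT subr_gt0.
have [le_fg lt_g] := fg A mA (@subIsetl _ _ _).
have mfA : measurable_fun A (fun r => (f r - g r)%:E).
  by apply/measurable_EFinP; apply: measurable_funTS; exact: measurable_funB.
have gA0 : (0 <= \int[lebesgue_measure]_(r in A) (g r)%:E)%E.
  by apply: integral_ge0 => r _; rewrite lee_fin.
have D0 r : A r -> (0 <= (f r - g r)%:E)%E.
  by move=> [_ /= /ltW]; rewrite lee_fin subr_ge0.
have int0 : (\int[lebesgue_measure]_(r in A) `|(f r - g r)%:E| = 0)%E.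
  apply/eqP; rewrite eq_le integral_ge0 ?andbT//.
  have -> : (\int[lebesgue_measure]_(r in A) `|(f r - g r)%:E| =
      \int[lebesgue_measure]_(r in A) (f r - g r)%:E)%E.
    by apply: eq_integral => r; rewrite inE => Ar; rewrite gee0_abs// D0.
  rewrite -(@leeD2lE _ (\int[lebesgue_measure]_(r in A) (g r)%:E)%E) ?ge0_fin_numE// adde0.
  rewrite -ge0_integralD//.
  - apply: le_trans le_fg; rewrite le_eqVlt; apply/orP; left; apply/eqP.
    by apply: eq_integral => r _; rewrite -EFinD addrC subrK.
  - by move=> r _; rewrite lee_fin.
  - by apply/measurable_EFinP; apply: measurable_funTS.
have := (@ae_eq_integral_abs _ _ _ lebesgue_measure A mA (fun r => (f r - g r)%:E) mfA).1 int0.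
apply: filterS => r h Dr; rewrite leNgt; apply/negP => gf.
have Ar : A r by split.
by have /= -[] := h Ar; move: gf; rewrite -subr_gt0 => + fg0; rewrite fg0 ltxx.
Qed.

Lemma enorm_row (R : realType) n (x : 'I_n -> R) : enorm (\row_i x i) = pnorm x.
Proof. by congr Num.sqrt; apply: eq_bigr => i _; rewrite mxE. Qed.

Lemma chamberB_row (R : realType) n (x : 'I_n -> R) : chamberB (\row_i x i) <-> chamber x.
Proof.
split=> [[dec pos] [i j]|cx]; last split=> [i j ij|i].
- rewrite /wall_form/=; case: eqVneq => [_|ij]; first by have := pos i; rewrite mxE.
  case: ltnP => h; rewrite subr_gt0; first by have := dec i j h; rewrite !mxE.
  have ji : (j < i)%N by rewrite ltn_neqAle h andbT eq_sym.
  by have := dec j i ji; rewrite !mxE.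
- by have := cx (i, j); rewrite /wall_form/= !mxE ij lt_eqF// subr_gt0.
- by have := cx (i, i); rewrite /wall_form/= eqxx mxE.
Qed.

Section brownian_motion.
Context (R : realType) (n : nat) (eta : 'rV[R]_n).
Context d (T : measurableType d) (P : probability T R) (B : 'I_n -> R -> {RV P >-> R}).
Hypothesis B_bm : brownian_motion eta B.

Lemma radial_partE t : radial_part B t = fun w => pnorm (fun i => B i t w).
Proof. by apply/funext => w; exact: enorm_row. Qed.

Lemma no_wall_hitE t : no_wall_hit B t = survives (fun i s w => B i s w) t.
Proof.
by apply/seteqP; split=> w h s /h /chamberB_row.
Qed.

Lemma brownian_motion_process : bm_process P (fun i s w => B i s w) (eta 0).
Proof.
have [B0 cB lB iB] := B_bm; split=> //.
by move=> i w; rewrite -(B0 w) mxE.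
Qed.

(** At time 1 this supplies the auxiliary vector on the probability space of the motion itself. *)
Lemma brownian_motion_std_gaussian t : 0 < t ->
  std_gaussian P (fun i w => (Num.sqrt t)^-1 * B i t w - eta 0 i * (Num.sqrt t)^-1).
Proof.
move=> t0; have [mY iY lY] := bm_scaled brownian_motion_process t0; split.
- by move=> i; exact: measurable_funB.
- apply: (indep_comp (g := fun i x => x - eta 0 i * (Num.sqrt t)^-1) iY) => i.
  exact: measurable_funB.
- move=> i; have := has_normal_law_affine (- (eta 0 i * (Num.sqrt t)^-1)) ltr01 ltr01 (lY i).
  rewrite !mul1r subrr => h A mA; rewrite -h//; congr (P _).
  by apply/seteqP; split=> w /=; rewrite mul1r.
Qed.

End brownian_motion.

Section radial_comparison.
Context (R : realType) (n : nat) (n_gt0 : (0 < n)%N) (eta : 'rV[R]_n).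
Hypothesis eta_chamber : chamberB eta.
Context d (T : measurableType d) (P : probability T R) (B : 'I_n -> R -> {RV P >-> R}).
Hypothesis B_bm : brownian_motion eta B.
Context d' (T' : measurableType d') (Q : probability T' R).
Variable W : 'I_(n * n.+1) -> R -> {RV Q >-> R}.
Hypothesis W_bm : brownian_motion 0 W.

Let N := (n * n.+1)%N.
Let X i s w := B i s w.
Let W1 i w := W i 1 w.
Let constrained t A := cond_prob P (no_wall_hit B t) (radial_part B t @^-1` A).
Let unconstrained t A := Q (radial_part W t @^-1` A).

Let bmX : bm_process P X (eta 0). Proof. exact: brownian_motion_process. Qed.

Let chamber_eta : chamber (eta 0).
Proof.
apply/chamberB_row; rewrite (_ : \row_i eta 0 i = eta)//.
by apply/rowP => i; rewrite mxE.
Qed.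

Let scaledW t : 0 < t -> std_gaussian Q (fun i w => (Num.sqrt t)^-1 * W i t w).
Proof.
move=> t0; have := brownian_motion_std_gaussian W_bm t0.
by under [in X in X -> _]eq_fun do under eq_fun do rewrite mxE mul0r subr0.
Qed.

Let stdW1 : std_gaussian Q W1.
Proof.
have := scaledW ltr01; rewrite sqrtr1 invr1.
by under [in X in X -> _]eq_fun do under eq_fun do rewrite mul1r.
Qed.

Let stdZ := brownian_motion_std_gaussian B_bm ltr01.

Let N0 : (0 < #|'I_N|)%N. Proof. by rewrite card_ord muln_gt0 n_gt0. Qed.

Let unconstrained_density t A : 0 < t -> measurable A -> unconstrained t A =
  (\int[lebesgue_measure]_(r in A) ((Num.sqrt t)^-1 * radial_pdf #|'I_N| ((Num.sqrt t)^-1 * r))%:E)%E.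
Proof.
move=> t0 mA; have st0 : 0 < Num.sqrt t by rewrite sqrtr_gt0.
rewrite -(radial_density N0 (scaledW t0) st0 mA) /unconstrained radial_partE; congr (Q _).
apply/seteqP; split=> w /=; rewrite pnormZ gtr0_norm ?invr_gt0// mulVKf//; exact: lt0r_neq0.
Qed.

Let unconstrainedE t A : 0 < t -> measurable A -> unconstrained t A = (free_mass Q W1 t A)%:E.
Proof.
move=> t0 mA; have st0 : 0 < Num.sqrt t by rewrite sqrtr_gt0.
have h := radial_density N0 stdW1 st0 mA.
rewrite unconstrained_density// -h /free_mass fineK// fin_num_measure//.
have [mW _ _] := stdW1; rewrite -[_ @^-1` _]setTI.
have mp : measurable_fun setT (fun w => Num.sqrt t * pnorm (W1^~ w)).
  by apply: measurable_funM => //; exact: (pt_measurable_comp (@pt_measurable_pnorm R _) mW).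
exact: mp.
Qed.

Let constrainedE t A :
  constrained t A = (survival_mass P X t A / fine (P (survives X t)))%:E.
Proof. by rewrite /constrained /cond_prob no_wall_hitE radial_partE. Qed.

Lemma constrained_density_exists t : 0 < t -> exists f, is_density (constrained t) f.
Proof.
move=> t0; have mS : measurable (survives X t) by exact: (measurable_survives bmX).
have mrad : measurable_fun setT (fun w => pnorm (fun i => X i t w)).
  have [mX _ _ _ _] := bmX.
  exact: (pt_measurable_comp (@pt_measurable_pnorm R _) (fun i => mX i t)).
have [h [mh h0] hE] := restricted_law_density mS mrad
  (fun A mA => survival_mass_null bmX n_gt0 chamber_eta stdZ t0 mA).
pose p := fine (P (survives X t)); have p0 : 0 <= p^-1 by rewrite invr_ge0 fine_ge0.
exists (fun r => p^-1 * h r); split.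
- exact: measurable_funM.
- by move=> r; rewrite mulr_ge0.
move=> A mA; rewrite constrainedE -/p.
under eq_integral do rewrite EFinM.
rewrite ge0_integralZl//; last 2 first.
- by apply/measurable_EFinP; apply: measurable_funTS.
- by move=> r _; rewrite lee_fin.
have PA : P ((fun w => pnorm (fun i => X i t w)) @^-1` A `&` survives X t) =
    (survival_mass P X t A)%:E.
  rewrite /survival_mass fineK// fin_num_measure//; apply: measurableI => //.
  by rewrite -[_ @^-1` _]setTI; exact: mrad.
by rewrite -hE// PA -EFinM mulrC.
Qed.

Lemma unconstrained_density_exists t : 0 < t -> exists g, is_density (unconstrained t) g.
Proof.
move=> t0; exists (fun r => (Num.sqrt t)^-1 * radial_pdf #|'I_N| ((Num.sqrt t)^-1 * r)); split.
- apply: measurable_funM => //; apply: measurableT_comp; first exact: measurable_radial_pdf.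
  exact: measurable_funM.
- by move=> r; rewrite mulr_ge0 ?invr_ge0 ?sqrtr_ge0 ?radial_pdf_ge0.
by move=> A mA; exact: unconstrained_density.
Qed.

(** Brownian scaling: the free law of [A] at time 1 is that of the dilated set [A'] at time [t], so
    the unrescaled bound applies to [A']. *)
Lemma rescaled_total_variation delta : 0 < delta -> \forall t \near +oo,
  forall A : set R, measurable A ->
  (`| cond_prob P (no_wall_hit B t) ((fun w => (radial_part B t w / Num.sqrt t)%R) @^-1` A) -
      unconstrained 1%R A | <= delta%:E)%E.
Proof.
move=> d0; have H := conditional_total_variation bmX n_gt0 chamber_eta stdZ stdW1 d0.
near=> t => A mA.
have t0 : 0 < t by near: t; exact: nbhs_pinfty_gt.
have st0 : 0 < Num.sqrt t by rewrite sqrtr_gt0.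
pose A' := (fun r : R => r / Num.sqrt t) @^-1` A.
have mA' : measurable A'.
  by rewrite -[A']setTI; apply: (@measurable_funM _ _ _ _ id) => //.
have HA : forall A : set R, measurable A ->
    `|survival_mass P X t A / fine (P (survives X t)) - free_mass Q W1 t A| <= delta.
  by near: t; exact: H.
rewrite (_ : cond_prob _ _ _ = (survival_mass P X t A' / fine (P (survives X t)))%:E); last first.
  by rewrite /cond_prob no_wall_hitE radial_partE.
rewrite (_ : unconstrained 1 A = (free_mass Q W1 t A')%:E); first by rewrite lee_fin HA.
rewrite unconstrainedE ?ltr01// /free_mass sqrtr1; congr (fine (Q _))%:E.
by apply/seteqP; split=> w; rewrite /A' /= mul1r [_ / _]mulrC mulKf// gt_eqF.
Unshelve. all: by end_near. Qed.

Lemma radial_tails c ep : 0 < c -> 0 < ep -> exists2 a : R, 0 < a &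
  \forall t \near +oo,
    (constrained t [set r | (c * t `^ (2^-1 + ep) <= r)%R]
             <= (expR (- (a * t `^ (2 * ep))))%:E)%E /\
    (unconstrained t [set r | (c * t `^ (2^-1 + ep) <= r)%R]
             <= (expR (- (a * t `^ (2 * ep))))%:E)%E.
Proof.
move=> c0 ep0.
have [a a0 Ha] := conditional_tail bmX n_gt0 chamber_eta stdZ stdW1 c0 ep0.
exists a => //; near=> t.
have t0 : 0 < t by near: t; exact: nbhs_pinfty_gt.
have mray : measurable [set r | (c * t `^ (2^-1 + ep) <= r)%R].
  rewrite (_ : [set r | _] = `[c * t `^ (2^-1 + ep), +oo[%classic); first exact: measurable_itv.
  by apply/seteqP; split=> r /=; rewrite in_itv/= andbT.
rewrite constrainedE unconstrainedE// !lee_fin.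
by near: t; exact: Ha.
Unshelve. all: by end_near. Qed.

(** The bound holds for the masses of all measurable subsets of the region with an error relative to
    the free mass, so [ae_le_density] turns it into almost everywhere inequalities between any
    versions [f] and [g] of the densities. *)
Lemma radial_density_ratio c ep : 0 < c -> 0 < ep -> ep < 2^-1 ->
  exists C : R, \forall t \near +oo, forall f g : R -> R,
    is_density (constrained t) f -> is_density (unconstrained t) g ->
    {ae lebesgue_measure, forall r : R,
      0 <= r -> r < c * t `^ (2^-1 + ep) ->
      `| f r / g r - 1 | <= C * t `^ (ep - 2^-1)}.
Proof.
move=> c0 ep0 ep2.
have [C [M H]] := conditional_estimate bmX n_gt0 chamber_eta stdZ stdW1 c0 ep0 ep2.
exists `|C|; near=> t => f g [mf f0 fE] [mg g0 gE].
have t0 : 0 < t by near: t; exact: nbhs_pinfty_gt.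
have st0 : 0 < Num.sqrt t by rewrite sqrtr_gt0.
have [_ _ est] : [/\ 0 < fine (P (survives X t)),
    (fine (P (survives X t)))^-1 <= M * t `^ (n ^ 2)%:R
  & forall A : set R, measurable A -> (forall r, A r -> r < c * t `^ (2^-1 + ep)) ->
    `|survival_mass P X t A / fine (P (survives X t)) - free_mass Q W1 t A| <=
      C * t `^ (ep - 2^-1) * free_mass Q W1 t A] by near: t; exact: H.
pose D : set R := `]-oo, c * t `^ (2^-1 + ep)[%classic.
have mD : measurable D by exact: measurable_itv.
set th := `|C| * t `^ (ep - 2^-1).
have th0 : 0 <= th by rewrite mulr_ge0 ?powR_ge0.
have {}est A : measurable A -> A `<=` D ->
    `|survival_mass P X t A / fine (P (survives X t)) - free_mass Q W1 t A| <=
      th * free_mass Q W1 t A.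
  move=> mA AD; apply: (le_trans (est A mA _)).
    by move=> r /AD; rewrite /D/= in_itv.
  by rewrite ler_wpM2r ?fine_ge0// ler_wpM2r ?powR_ge0 ?ler_norm.
have intf A : measurable A -> (\int[lebesgue_measure]_(r in A) (f r)%:E =
    (survival_mass P X t A / fine (P (survives X t)))%:E)%E.
  by move=> mA; rewrite -fE// constrainedE.
have intg A : measurable A -> (\int[lebesgue_measure]_(r in A) (g r)%:E = (free_mass Q W1 t A)%:E)%E.
  by move=> mA; rewrite -gE// unconstrainedE.
have meas_in (k : R -> R) A : measurable_fun setT k -> measurable A ->
    measurable_fun A (fun r => (k r)%:E).
  by move=> mk mA; apply/measurable_EFinP; apply: measurable_funTS.
have intZg k A : 0 <= k -> measurable A -> (\int[lebesgue_measure]_(r in A) (k * g r)%:E =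
    (k * free_mass Q W1 t A)%:E)%E.
  move=> k0 mA; under eq_integral do rewrite EFinM.
  rewrite ge0_integralZl//; [by rewrite intg|exact: meas_in|by move=> r _; rewrite lee_fin].
have upper : {ae lebesgue_measure, forall r, D r -> f r <= (1 + th) * g r}.
  apply: ae_le_density => //.
  - exact: measurable_funM.
  - by move=> r; rewrite mulr_ge0// addr_ge0.
  move=> A mA AD; rewrite intf// intZg ?addr_ge0// ltry lee_fin; split=> //.
  by have /ler_normlP[h1 h2] := est A mA AD; lra.
(* Written with [th * g r] on the right because [1 - th] may be negative, while [ae_le_density]
   compares nonnegative functions. *)
have lower : {ae lebesgue_measure, forall r, D r -> g r <= f r + th * g r}.
  apply: ae_le_density => //.
  - by apply: measurable_funD => //; exact: measurable_funM.
  - by move=> r; rewrite addr_ge0// mulr_ge0.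
  move=> A mA AD.
  have -> : (\int[lebesgue_measure]_(r in A) (f r + th * g r)%:E =
      (survival_mass P X t A / fine (P (survives X t)) + th * free_mass Q W1 t A)%:E)%E.
    under eq_integral do rewrite EFinD.
    rewrite ge0_integralD//; first by rewrite intf// intZg// -EFinD.
    - by move=> r _; rewrite lee_fin.
    - exact: meas_in.
    - by move=> r _; rewrite lee_fin mulr_ge0.
    - by apply: meas_in => //; exact: measurable_funM.
  rewrite intg// ltry lee_fin; split=> //.
  by have /ler_normlP[h1 h2] := est A mA AD; lra.
(* Dividing by [g] needs [g > 0] almost everywhere. The explicit density [dens] is positive for
   [r > 0] and almost everywhere below [g]; the remaining point [r = 0] is null. *)
pose dens r := (Num.sqrt t)^-1 * radial_pdf #|'I_N| ((Num.sqrt t)^-1 * r).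
have pos : {ae lebesgue_measure, forall r, [set: R] r -> dens r <= g r}.
  apply: ae_le_density => //.
  - apply: measurable_funM => //; apply: measurableT_comp; first exact: measurable_radial_pdf.
    exact: measurable_funM.
  - by move=> r; rewrite mulr_ge0 ?invr_ge0 ?sqrtr_ge0 ?radial_pdf_ge0.
  by move=> A mA _; rewrite -unconstrained_density// gE// intg// ltry lexx.
have ne0 : {ae lebesgue_measure, forall r : R, r != 0}.
  exists [set 0]; split=> //; first exact: lebesgue_measure_set1.
  by move=> r /= /negP; rewrite negbK => /eqP.
have aeF : Filter (nbhs (almost_everywhere (@lebesgue_measure R))).
  exact: (ae_filter_ringOfSetsType (@lebesgue_measure R)).
have := @filterI _ _ aeF _ _ (@filterI _ _ aeF _ _ upper lower) (@filterI _ _ aeF _ _ pos ne0).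
apply: (@filterS _ _ aeF) => r [[fu fl] [gd rn0]] r0 rR.
have rD : D r by rewrite /D/= in_itv.
have gr0 : 0 < g r.
  apply: lt_le_trans (gd Logic.I); rewrite /dens mulr_gt0 ?invr_gt0//.
  apply: (radial_pdf_gt0 N0 stdW1); rewrite mulr_gt0 ?invr_gt0//.
  by rewrite lt_neqAle eq_sym rn0.
have -> : f r / g r - 1 = (f r - g r) / g r by rewrite mulrBl divff// gt_eqF.
rewrite normrM normfV (gtr0_norm gr0) ler_pdivrMr//.
have := fu rD; have := fl rD => h1 h2; apply/ler_normlP; split; lra.
Unshelve. all: by end_near. Qed.

End radial_comparison.

Theorem mainTheorem7 (R : realType) (n : nat) (n_gt0 : (0 < n)%N)
    (eta : 'rV[R]_n) (eta_chamber : chamberB eta)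
    (d : measure_display) (T : measurableType d) (P : probability T R)
    (B : 'I_n -> R -> {RV P >-> R}) (B_bm : brownian_motion eta B)
    (d' : measure_display) (T' : measurableType d') (Q : probability T' R)
    (W : 'I_(n * n.+1) -> R -> {RV Q >-> R}) (W_bm : brownian_motion 0 W) :
  let constrained (t : R) (A : set R) : \bar R :=
    cond_prob P (no_wall_hit B t) (radial_part B t @^-1` A) in
  let unconstrained (t : R) (A : set R) : \bar R :=
    Q (radial_part W t @^-1` A) in
  let rescaled (t : R) (A : set R) : \bar R :=
    cond_prob P (no_wall_hit B t)
      ((fun w => radial_part B t w / Num.sqrt t) @^-1` A) in
  [/\ (forall delta : R, 0 < delta ->
        \forall t \near +oo, forall A : set R, measurable A ->
          (`| rescaled t A - unconstrained 1%R A | <= delta%:E)%E),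
      (forall t : R, 0 < t ->
        (exists f : R -> R, is_density (constrained t) f) /\
        (exists g : R -> R, is_density (unconstrained t) g)),
      (forall c epsilon : R, 0 < c -> 0 < epsilon -> epsilon < 2^-1 ->
        exists C : R, \forall t \near +oo, forall f g : R -> R,
          is_density (constrained t) f -> is_density (unconstrained t) g ->
          {ae lebesgue_measure, forall r : R,
            0 <= r -> r < c * t `^ (2^-1 + epsilon) ->
            `| f r / g r - 1 | <= C * t `^ (epsilon - 2^-1)})
    & (forall c epsilon : R, 0 < c -> 0 < epsilon ->
        exists2 a : R, 0 < a & \forall t \near +oo,
          (constrained t [set r | (c * t `^ (2^-1 + epsilon) <= r)%R]
             <= (expR (- (a * t `^ (2 * epsilon))))%:E)%E /\
          (unconstrained t [set r | (c * t `^ (2^-1 + epsilon) <= r)%R]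
             <= (expR (- (a * t `^ (2 * epsilon))))%:E)%E)].
Proof.
move=> constrained unconstrained rescaled; split.
- by move=> delta d0; exact: (rescaled_total_variation n_gt0 eta_chamber B_bm W_bm d0).
- move=> t t0; split; first exact: (constrained_density_exists n_gt0 eta_chamber B_bm t0).
  exact: (unconstrained_density_exists n_gt0 W_bm t0).
- by move=> c ep c0 ep0 ep2; exact: (radial_density_ratio n_gt0 eta_chamber B_bm W_bm c0 ep0 ep2).
- by move=> c ep c0 ep0; exact: (radial_tails n_gt0 eta_chamber B_bm W_bm c0 ep0).
Qed.
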